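(* Let $B$ be a Cartan subalgebra of a W*-algebra $A$, together with a faithful normal state $\mathbf m$ on $B$. Let $(G(B),\Sigma(B))$ be the Weyl twist of $(A,B)$, let $X=G(B)^{(0)}$ be the spectrum of $B$, and let $\mu$ be the probability measure on $X$ with $\mathbf m(b)=\int_X \hat b\,d\mu$ for $b\in B$ ($\hat b$ denoting the Gelfand transform of $b$). Then there exists a $*$-isomorphism $$\tilde\jmath:\ \mathrm{PIN}(B)B\to C_c(G(B),\Sigma(B)),\qquad \tilde\jmath\Big(\sum_i u_ib_i\Big)=\sum_i \Delta_{S(u_i)}\,\hat b_i\quad\text{(finite sums, } u_i\in \mathrm{PIN}(B),\ b_i\in B),$$ and it extends to an isomorphism $\Phi: A\to W^*(G(B),\Sigma(B),\mu)$ of W*-algebras sending $B$ onto $C(X)$.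
   Context: $\mathbb T$ is the group of complex numbers of modulus one. Cartan subalgebra: a commutative W*-subalgebra $B$ of a W*-algebra $A$ is a Cartan subalgebra if (i) $B$ is maximal abelian in $A$; (ii) $\mathrm{PIN}(B)$ generates $A$ as a W*-algebra; (iii) there is a faithful normal conditional expectation of $A$ onto $B$. Here $\mathrm{PIN}(B)$ is the inverse semigroup of partial isometries $u\in A$ with $u^*u,uu^*\in B$, $uBu^*\subset B$, $u^*Bu\subset B$. Let $\mathrm{PI}(B)$ be the set of partial isometries of $B$. $\mathrm{PIN}(B)B$ is the set of finite sums of elements $ub$ with $u\in\mathrm{PIN}(B)$, $b\in B$; it is a $*$-subalgebra of $A$. Weyl twist: Let $X$ be the (compact, extremally disconnected) spectrum of $B$; $\mathrm{PI}(B)$ is identified by the Gelfand transform with the set $\mathcal T(X)$ of continuous functions $h:\mathrm{supp}(h)\to\mathbb T$ with $\mathrm{supp}(h)\subset X$ compact open (extended by $0$). Each $u\in\mathrm{PIN}(B)$ defines a homeomorphism $\varphi_u:\mathrm{dom}(u)\to\mathrm{ran}(u)$ between the compact open subsets of $X$ corresponding to the projections $u^*u$ and $uu^*$, by $\widehat{ubu^*}=\hat b\circ\varphi_u^{-1}$ on $\mathrm{ran}(u)$. On the set of pairs $(u,x)$ with $u\in \mathrm{PIN}(B)$, $x\in\mathrm{dom}(u)$, put $(u,x)\sim(v,y)$ iff $x=y$ and there are $a,b\in\mathrm{PI}(B)$ with $\hat a(x)=\hat b(x)=1$ and $ua=vb$; and $(u,x)\approx(v,y)$ iff $x=y$ and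 there are $a,b\in\mathrm{PI}(B)$ with $|\hat a(x)|=|\hat b(x)|=1$ and $ua=vb$. Classes are denoted $[u,x]$ and $[[u,x]]$. $\Sigma(B)$ (classes for $\sim$) and $G(B)$ (classes for $\approx$) are groupoids with unit space $X$, $[u,\varphi_v(x)][v,x]=[uv,x]$, $[u,x]^{-1}=[u^*,\varphi_u(x)]$, and likewise for $[[\cdot]]$. $\mathbb T$ acts on $\Sigma(B)$ by $[u,x]\theta=[\theta u,x]$ with quotient $p:\Sigma(B)\to G(B)$, $p([u,x])=[[u,x]]$. $G(B)$ has the topology with basic open sets $\{[[u,x]]:x\in\mathrm{dom}(u)\cap U\}$, $U\subset X$ open, and $\Sigma(B)$ the topology with basic open sets $S(u)W$, where $S(u)=\{[u,x]:x\in\mathrm{dom}(u)\}$ and $W\subset\mathbb T$ is open. The pair $(G(B),\Sigma(B))$ is the Weyl twist of $(A,B)$; $G(B)$ is étale. Convolution algebra: write $(G,\Sigma)=(G(B),\Sigma(B))$, with range $r$ and domain $d$, and $\sigma'=p(\sigma)$. For $u\in\mathrm{PIN}(B)$, $\Delta_{S(u)}:\Sigma\to\mathbb C$ is $\Delta_{S(u)}(\sigma)=\overline\theta$ if $\sigma=\theta s$ with $\theta\in\mathbb T$, $s\in S(u)$, and $0$ if $\sigma\notin\mathbb T S(u)$. $C_c(G,\Sigma)$ is the set of finite sums of functions $\Delta_{S(u)}b:\sigma\mapsto\Delta_{S(u)}(\sigma)b(d(\sigma))$, $u\in\mathrm{PIN}(B)$, $b\in C(X)$; it is a $*$-algebra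 with $f*g(\sigma)=\sum_{\tau'\in r^{-1}(r(\sigma))}f(\tau)g(\tau^{-1}\sigma)$ (where $\tau$ is any lift of $\tau'\in G$) and $f^*(\sigma)=\overline{f(\sigma^{-1})}$. $C(X)$ is embedded in $C_c(G,\Sigma)$ by sending $b$ to the function $\tilde b$ supported on $X\times\mathbb T\subset \Sigma$ with $\tilde b(x,\theta)=\overline\theta b(x)$. W*-algebra: $\mu$ is quasi-invariant for $G$. $L^2(G,\Sigma,d^*\mu)$ is the completion of $C_c(G,\Sigma)$ for the scalar product $(f|g)=\int_X\sum_{\gamma\in d^{-1}(x)}(\overline f g)(\gamma)\,d\mu(x)$ ($\overline fg$ being viewed as a function on $G$), and $\mathrm{Reg}$ is the representation of $C_c(G,\Sigma)$ on it by $\mathrm{Reg}(f)\xi=f*\xi$ (this is the GNS representation of the state $f\mapsto\int f(x,1)\,d\mu(x)$). $W^*(G,\Sigma,\mu)$ is the weak closure of $\mathrm{Reg}(C_c(G,\Sigma))$. ''Extends'' means that $\Phi(a)=\mathrm{Reg}(\tilde\jmath(a))$ for $a\in \mathrm{PIN}(B)B$; $C(X)$ is viewed in $W^*(G,\Sigma,\mu)$ through $\mathrm{Reg}$. *)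

(* Defs.v *)
From HB Require Import structures.
From mathcomp Require Import all_boot all_order all_algebra.
From mathcomp Require Import complex.
From mathcomp Require Import all_classical all_reals all_analysis.

Set Implicit Arguments.
Unset Strict Implicit.
Unset Printing Implicit Defensive.

Import Order.TTheory GRing.Theory Num.Theory.
Import numFieldNormedType.Exports.

Local Open Scope classical_set_scope.
Local Open Scope ring_scope.

(* The inner product [dot] is linear in its first argument and conjugate linear
   in the second one, as in [sesquilinear.v]. *)

Record hilbert (R : realType) := Hilbert {
  hcarrier :> completeNormedModType R[i] ;
  dot : {dot hcarrier for Num.conj} ;
  dot_normE : forall x : hcarrier, `|x| ^+ 2 = dot x x }.

Section Operators.
Context {R : realType} {H : hilbert R}.
Implicit Types (S T : H -> H) (M : set (H -> H)).

Definition bounded_op T := linear T /\ continuous T.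

Definition adjoint_pair S T := forall x y : H, dot H (S x) y = dot H x (T y).

(* Closure in B(H) for the weak operator topology: [s] lists the pairs of
   vectors defining a basic neighbourhood of [T]. *)
Definition weak_closure M : set (H -> H) :=
  [set T | bounded_op T /\
    forall (s : seq (H * H)) (e : R[i]), 0 < e ->
      exists2 S, M S &
        forall v, v \in s -> `| dot H (T v.1) v.2 - dot H (S v.1) v.2 | < e ].

End Operators.

(* A W*-algebra is a *-algebra together with a faithful unital representation
   as a von Neumann algebra on a Hilbert space.  The norm, the order and the
   weak* topology do not depend on the representation; by Sakai's theorem these
   are the C*-algebras with a predual.  [algType] excludes the zero algebra,
   which has no state. *)

Record wstarAlgebra (R : realType) := WstarAlgebra {
  wcarrier :> algType R[i] ;
  star : wcarrier -> wcarrier ;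
  wspace : hilbert R ;
  rep : wcarrier -> wspace -> wspace ;
  rep_bounded : forall a, bounded_op (rep a) ;
  rep_linear : forall (k : R[i]) a b x,
    rep (k *: a + b) x = k *: rep a x + rep b x ;
  rep_one : forall x, rep 1 x = x ;
  rep_mul : forall a b x, rep (a * b) x = rep a (rep b x) ;
  rep_star : forall a, adjoint_pair (rep a) (rep (star a)) ;
  rep_inj : injective rep ;
  rep_closed : weak_closure (range rep) `<=` range rep }.

Section WstarTheory.
Context {R : realType} {A : wstarAlgebra R}.
Implicit Types (B D : set A) (u : A).

Local Notation "a ^@" := (@star R A a) (at level 2, format "a ^@").

Definition star_subalgebra D :=
  [/\ D 1,
      forall (k : R[i]) a b, D a -> D b -> D (k *: a + b),
      forall a b, D a -> D b -> D (a * b)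
    & forall a, D a -> D a^@].

Definition wstar_subalgebra D :=
  star_subalgebra D /\ weak_closure (@rep R A @` D) `<=` @rep R A @` D.

Definition commutative_set D := forall a b, D a -> D b -> a * b = b * a.

Definition generates S :=
  forall D, wstar_subalgebra D -> S `<=` D -> D = [set: A].

Definition maximal_abelian B :=
  [/\ star_subalgebra B, commutative_set B
    & forall D, star_subalgebra D -> commutative_set D -> B `<=` D -> D = B].

Definition pos_in D : set A := [set a | exists2 c, D c & a = c^@ * c].

Definition le_in D a b := pos_in D (b - a).

Definition is_lub_in D S s :=
  [/\ D s, forall a, S a -> le_in D a s
    & forall t, D t -> (forall a, S a -> le_in D a t) -> le_in D s t].

(* Normality of positive maps is preservation of the suprema of such families
   [S]: upward directed, positive, with supremum [s] in [D]. *)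
Definition increases_to D S s :=
  [/\ S !=set0, S `<=` pos_in D,
      forall a b, S a -> S b -> exists c, [/\ S c, le_in D a c & le_in D b c]
    & is_lub_in D S s].

Definition conditional_expectation B (E : A -> A) :=
  [/\ linear E,
      forall a, B (E a),
      forall b, B b -> E b = b,
      forall a b c, B b -> B c -> E (b * a * c) = b * E a * c
    & forall a, pos_in [set: A] a -> pos_in B (E a)].

Definition faithful_map (E : A -> A) :=
  forall a, pos_in [set: A] a -> E a = 0 -> a = 0.

Definition normal_map B (E : A -> A) :=
  forall S s, increases_to [set: A] S s -> is_lub_in B (E @` S) (E s).

(* The elements of a subalgebra [B] form the type [set_type B]; as it carries no
   algebraic structure, the operations are transported along [val]. *)
Definition faithful_normal_state B (m : B -> R[i]) :=
  [/\ (forall (k : R[i]) (a b c : B),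
         val c = k *: val a + val b -> m c = k * m a + m b),
      (forall e : B, val e = 1 -> m e = 1),
      (forall b : B, pos_in B (val b) -> 0 <= m b),
      (forall b : B, pos_in B (val b) -> m b = 0 -> val b = 0)
    & (forall (S : set B) (s : B), increases_to B (val @` S) (val s) ->
         forall c : R[i], (forall b : B, S b -> m b <= c) -> m s <= c)].

Definition partial_isometry u := u * u^@ * u = u.

Definition PIN B : set A :=
  [set u | [/\ partial_isometry u,
               B (u^@ * u), B (u * u^@),
               forall b, B b -> B (u * b * u^@)
             & forall b, B b -> B (u^@ * b * u)]].

Definition PINB B : set A :=
  [set a | exists n (u : 'I_n -> A) (b : 'I_n -> A),
     [/\ forall i, PIN B (u i), forall i, B (b i)
       & a = \sum_(i < n) u i * b i]].

Definition PI B : set A := [set a | B a /\ partial_isometry a].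

Definition cartan B :=
  [/\ wstar_subalgebra B, commutative_set B, maximal_abelian B,
      generates (PIN B)
    & exists E, [/\ conditional_expectation B E, faithful_map E
                  & normal_map B E]].

Definition characters B : set {ptws B -> R[i]^o} :=
  [set chi | [/\ exists b : B, chi b != 0,
      (forall (k : R[i]) (a b c : B),
         val c = k *: val a + val b -> chi c = k * chi a + chi b)
    & (forall a b c : B, val c = val a * val b -> chi c = chi a * chi b)]].

Definition spectrum B : topologicalType := set_type (@characters B).

Definition gelfand B (b : B) (x : spectrum B) : R[i] := \val x b.

Definition dom B u : set (spectrum B) :=
  [set x | exists2 p : B, val p = u^@ * u & gelfand p x = 1].

Definition phi B u (x : spectrum B) : spectrum B :=
  xget x [set y | dom u^@ y /\
    forall b c : B, val c = u * val b * u^@ -> gelfand c y = gelfand b x].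

End WstarTheory.

Arguments spectrum {R A} B.
Arguments dom {R A B} u.
Arguments phi {R A B} u x.

(* Measurable types of the library are pointed, so a Borel measure on [X] comes
   with a base point of [X], which plays no other role. *)

Definition pointed_at (X : topologicalType) (x0 : X) : Type := X.

HB.instance Definition _ (X : topologicalType) (x0 : X) :=
  Topological.on (pointed_at x0).
HB.instance Definition _ (X : topologicalType) (x0 : X) :=
  isPointed.Build (pointed_at x0) x0.

Definition borel (X : topologicalType) (x0 : X) :=
  g_sigma_algebraType (@open (pointed_at x0)).

Record regular_probability (R : realType) (X : topologicalType) :=
  RegularProbability {
    base_point : X ;
    rprob : probability (borel base_point) R ;
    rprob_regular : forall E : set (borel base_point), measurable E ->
      forall e : R, 0 < e ->
      exists K U : set X, [/\ compact K, open U, K `<=` E, E `<=` U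
        & (rprob (U `\` K) < e%:E)%E] }.

Definition cintegral (R : realType) (X : topologicalType)
    (mu : regular_probability R X) (f : X -> R[i]) : R[i] :=
  Complex (\int[rprob mu]_x complex.Re (f x)) (\int[rprob mu]_x complex.Im (f x)).

Section Weyl.
Context {R : realType} {A : wstarAlgebra R} (B : set A).
Local Notation X := (spectrum B).
Implicit Types (u v : A) (x y : X) (q : A * X).

Local Notation "a ^@" := (@star R A a) (at level 2, format "a ^@").

Definition germ_dom : set (A * X) := [set q | PIN B q.1 /\ dom q.1 q.2].

Definition sim q q' := q.2 = q'.2 /\
  exists a b : B, [/\ PI B (val a), PI B (val b),
    gelfand a q.2 = 1, gelfand b q.2 = 1 & q.1 * val a = q'.1 * val b].

Definition approx q q' := q.2 = q'.2 /\
  exists a b : B, [/\ PI B (val a), PI B (val b),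
    `|gelfand a q.2| = 1, `|gelfand b q.2| = 1 & q.1 * val a = q'.1 * val b].

Section Classes.
Variable e : A * X -> A * X -> Prop.

Definition class_of q : set (A * X) := [set q' | germ_dom q' /\ e q q'].

Definition classes : set (set (A * X)) := class_of @` germ_dom.

Lemma class_in q : germ_dom q -> class_of q \in classes.
Proof. by move=> hq; apply/mem_set; exists q. Qed.

Lemma classes_ex (c : classes) : exists q, germ_dom q /\ class_of q = val c.
Proof. by have /set_mem[q ? ?] := valP c; exists q. Qed.

Definition repr_of (c : classes) : A * X := projT1 (cid (classes_ex c)).

Lemma repr_ofP (c : classes) :
  germ_dom (repr_of c) /\ class_of (repr_of c) = val c.
Proof. exact: projT2 (cid (classes_ex c)). Qed.

Definition is_class (c : classes) u x :=
  germ_dom (u, x) /\ val c = class_of (u, x).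

Definition source (c : classes) : X := (repr_of c).2.
Definition target (c : classes) : X := phi (repr_of c).1 (repr_of c).2.

End Classes.

Definition SigmaB := set_type (classes sim).
Definition GB := set_type (classes approx).

(* an arbitrary lift of [g] for the quotient map from [SigmaB] to [GB], which
   sends the class of [(u, x)] for [sim] to its class for [approx] *)
Definition liftG (g : GB) : SigmaB :=
  exist _ (class_of sim (repr_of g)) (class_in sim (repr_ofP g).1).

(* These operations are defined by their graphs on classes; the default value of
   [xget] only serves for non composable pairs and for scalars of modulus <> 1. *)
Definition Smul (s t : SigmaB) : SigmaB :=
  xget s [set r : SigmaB | exists u v x,
    [/\ is_class s u (phi v x), is_class t v x & is_class r (u * v) x]].

Definition Sinv (s : SigmaB) : SigmaB :=
  xget s [set r : SigmaB | exists u x, is_class s u x /\ is_class r u^@ (phi u x)].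

Definition Sact (s : SigmaB) (z : R[i]) : SigmaB :=
  xget s [set r : SigmaB | exists u x, is_class s u x /\ is_class r (z *: u) x].

Definition bisection u : set SigmaB := [set s | exists x, is_class s u x].

Definition Delta u (s : SigmaB) : R[i] :=
  xget 0 [set w | exists z t,
    [/\ `|z| = 1, bisection u t, s = Sact t z & w = z^*]].

Definition Delta_mul u (b : X -> R[i]) (s : SigmaB) : R[i] :=
  Delta u s * b (source s).

Definition continuousC (b : X -> R[i]) := continuous (b : X -> R[i]^o).

Definition Cc : set (SigmaB -> R[i]) :=
  [set f | exists n (u : 'I_n -> A) (b : 'I_n -> X -> R[i]),
     [/\ forall i, PIN B (u i), forall i, continuousC (b i)
       & f = \sum_(i < n) Delta_mul (u i) (b i)]].

Definition conv (f g : SigmaB -> R[i]) (s : SigmaB) : R[i] :=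
  \sum_(t \in [set t : GB | target t = target s])
     f (liftG t) * g (Smul (Sinv (liftG t)) s).

Definition convstar (f : SigmaB -> R[i]) (s : SigmaB) : R[i] := (f (Sinv s))^*.

(* [C(X)] in [Cc]: the point [(x, z)] of [X * T] is the element [[1, x] z]. *)
Definition tilde (b : X -> R[i]) (s : SigmaB) : R[i] :=
  xget 0 [set w | exists (z : R[i]) x,
    [/\ `|z| = 1, is_class s (z *: 1) x & w = z^* * b x]].

Definition L2dot (mu : regular_probability R X) (f g : SigmaB -> R[i]) : R[i] :=
  cintegral mu (fun x =>
    \sum_(t \in [set t : GB | source t = x]) (f (liftG t))^* * g (liftG t)).

(* [K], with [iota] restricted to [Cc], is the completion of [Cc] for the scalar
   product [L2dot mu], which is conjugate linear in its first argument. *)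
Definition is_L2 (mu : regular_probability R X) (K : hilbert R)
    (iota : (SigmaB -> R[i]) -> K) :=
  [/\ (forall (k : R[i]) f g, Cc f -> Cc g ->
         iota (fun s => k * f s + g s) = k *: iota f + iota g),
      (forall f g, Cc f -> Cc g -> dot K (iota g) (iota f) = L2dot mu f g)
    & closure (iota @` Cc) = [set: K]].

Section Regular.
Context {K : hilbert R} (iota : (SigmaB -> R[i]) -> K).

(* [T] is the operator [Reg f], the bounded extension of [f * _] from [Cc] *)
Definition is_Reg (f : SigmaB -> R[i]) (T : K -> K) :=
  bounded_op T /\ forall xi, Cc xi -> T (iota xi) = iota (conv f xi).

Definition twist_Wstar : set (K -> K) :=
  weak_closure [set T | exists2 f, Cc f & is_Reg f T].

Definition Reg_CX : set (K -> K) :=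
  [set T | exists2 b, continuousC b & is_Reg (tilde b) T].

End Regular.

Definition star_iso_Cc (j : A -> SigmaB -> R[i]) :=
  [/\ set_bij (PINB B) Cc j,
      (forall (k : R[i]) a b, PINB B a -> PINB B b ->
         j (k *: a + b) = fun s => k * j a s + j b s),
      (forall a b, PINB B a -> PINB B b -> j (a * b) = conv (j a) (j b))
    & (forall a, PINB B a -> j a^@ = convstar (j a))].

End Weyl.

(* *-isomorphism of [A] onto the algebra [M] of operators on [K]; between
   W*-algebras it is automatically a homeomorphism for the weak* topologies. *)
Definition wstar_iso (R : realType) (A : wstarAlgebra R) (K : hilbert R)
    (M : set (K -> K)) (Phi : A -> K -> K) :=
  [/\ set_bij [set: A] M Phi,
      (forall (k : R[i]) a b x, Phi (k *: a + b) x = k *: Phi a x + Phi b x),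
      (forall a b x, Phi (a * b) x = Phi a (Phi b x))
    & (forall a, adjoint_pair (Phi a) (Phi (star a)))].

(* Main.v *)
(* Let [E] be the conditional expectation of [A] onto [B].  The function attached
   to [a] takes at the class of [(u, x)] the value at [x] of the Gelfand transform
   of [E (u^* a)].  For [w] in PIN(B), the element [w^* E(w)] commutes with [B],
   so it lies in [B], and it is a projection [p] with [E w = w p]; applied to
   [w = u^* v] this shows that [(u, x)] and [(v, x)] have the same class in [G(B)]
   (in [Sigma(B)]) iff the transform of [E (u^* v)] at [x] is nonzero (is 1).  The
   functions attached to PIN(B)B therefore multiply as in [A], and their scalar
   product is [m (E (a^* b))], so that the regular representation is the GNS
   representation of the faithful state [m o E] on PIN(B)B.

   It remains to show that the GNS representation of such a state, normal in the
   sense of increasing families, maps [A] onto the weak closure of the image of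
   the weakly dense subalgebra P = PIN(B)B.  By Zorn's lemma the state is a norm
   limit of weak operator continuous functionals.  Resolvents [(x + it)^-1] of
   self-adjoint [x] in P replace Kaplansky's density theorem, because they are
   bounded by [1/|t|] and depend strongly continuously on [x].  For surjectivity,
   a self-adjoint operator in the closure is, after an affine change, of the form
   [(1 + S^2)^-1], a combination of the resolvents [(S + i)^-1] and [(S - i)^-1];
   these are limits of images of bounded nets in [A], hence images by weak
   compactness of balls. *)

Require Import Defs.
From mathcomp Require Import all_boot all_order all_algebra.
From mathcomp Require Import complex.
From mathcomp Require Import all_classical all_reals all_analysis.
From mathcomp Require Import ring lra.

Set Implicit Arguments.
Unset Strict Implicit.
Unset Printing Implicit Defensive.

Import Order.TTheory GRing.Theory Num.Theory.
Import numFieldNormedType.Exports.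
Import Normc.

Local Open Scope classical_set_scope.
Local Open Scope ring_scope.

(** In the completion [K] only the vectors coming from [Cc] are known, so an [a] of [A] outside
    PIN(B)B acts through the form [m (E (r^* a q))], with [q] and [r] in PIN(B)B. Multiplicativity
    and faithfulness of this action have to be carried to [A] one variable at a time, and for that
    two normal functionals agreeing on PIN(B)B must agree on [A]. Weak density settles this for weak
    operator continuous functionals; errors in norm are harmless only on bounded sets. Resolvents
    supply the bounds: PIN(B)B need not be norm closed, but they are norm limits of its elements, by
    Neumann series. On the groupoid side all rests on two identities. By the cocycle identity of
    [coef], another representative of a class in [G(B)] changes values by a scalar of modulus one.
    The equivariance [E (v^* a v) = v^* E(a) v], for [v] in PIN(B) and [a] in PIN(B)B, is not an
    axiom for [E]; it moves values along the arrow of [v] and governs inverses and products of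
    germs. That characters separate [B] comes from [m], faithful and given by integrating
    transforms. *)

Lemma ltr0c (R : realType) (r : R) : (0 < r%:C%C :> R[i]) = (0 < r).
Proof. by rewrite ltcR. Qed.

(** * Real and imaginary parts and the real-valued modulus *)

Section ComplexFacts.
Context {R : realType}.
Implicit Types z w : R[i].

Lemma normcEn z : `|z| = (normc z)%:C%C. Proof. by case: z. Qed.

Lemma normc_ge0 z : 0 <= normc z.
Proof. by rewrite -ler0c -normcEn. Qed.

Lemma normc_real (r : R) : normc (r%:C%C) = `|r|.
Proof. by rewrite /= expr0n /= addr0 sqrtr_sqr. Qed.

Lemma normc_eq0 z : (normc z == 0) = (z == 0).
Proof. by rewrite -[RHS]normr_eq0 normcEn eq_complex /= eqxx andbT. Qed.

Lemma normc_conj z : normc (conjc z) = normc z.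
Proof. by case: z => a b /=; rewrite sqrrN. Qed.

Lemma Re_le_normc z : complex.Re z <= normc z.
Proof.
have := normc_ge_Re z; rewrite normcEn lecR; exact: le_trans (ler_norm _).
Qed.

Lemma normc_sqr z : normc z ^+ 2 = complex.Re z ^+ 2 + complex.Im z ^+ 2.
Proof. by case: z => a b /=; rewrite sqr_sqrtr // addr_ge0 ?sqr_ge0. Qed.

Lemma normc_mulJ z : z * conjc z = (normc z ^+ 2)%:C%C.
Proof. by rewrite -sqr_normc normcEn rmorphXn. Qed.

Lemma ge0_complexE z : 0 <= z -> z = (complex.Re z)%:C%C.
Proof. by case: z => a b; rewrite lecE /= => /andP[/eqP -> _]. Qed.

Lemma ge0cE z : (0 <= z) = (complex.Im z == 0) && (0 <= complex.Re z).
Proof. by rewrite lecE. Qed.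

Lemma cReD z w : complex.Re (z + w) = complex.Re z + complex.Re w.
Proof. by case: z; case: w. Qed.
Lemma cImD z w : complex.Im (z + w) = complex.Im z + complex.Im w.
Proof. by case: z; case: w. Qed.
Lemma cReN z : complex.Re (- z) = - complex.Re z. Proof. by case: z. Qed.

Lemma cReB z w : complex.Re (z - w) = complex.Re z - complex.Re w.
Proof. by rewrite cReD cReN. Qed.
Lemma cReMr (r : R) z : @complex.Re R (r%:C%C * z) = r * complex.Re z.
Proof. by case: z => a b /=; rewrite mul0r subr0. Qed.

Lemma cReJ z : complex.Re (conjc z) = complex.Re z. Proof. by case: z. Qed.

Lemma normcB z w : normc (z - w) = normc (w - z).
Proof. by rewrite -normcN opprB. Qed.

Lemma normc_sum (I : Type) (r : seq I) (F : I -> R[i]) :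
  normc (\sum_(i <- r) F i) <= \sum_(i <- r) normc (F i).
Proof.
elim/big_ind2: _ => [|x x' y y' h h'|//]; first by rewrite normc0.
exact: le_trans (le_normcD _ _) (lerD h h').
Qed.

End ComplexFacts.

(** * Hilbert spaces *)

Section InnerProduct.
Context {R : realType} {H : hilbert R}.
Implicit Types (x y z : H) (k : R[i]) (r : R).

Lemma ipDl x y z : dot H (x + y) z = dot H x z + dot H y z.
Proof. exact: linearDl. Qed.
Lemma ipDr x y z : dot H x (y + z) = dot H x y + dot H x z.
Proof. exact: linearDr. Qed.
Lemma ipZl k x y : dot H (k *: x) y = k * dot H x y.
Proof. exact: linearZl_LR. Qed.
Lemma ipZr k x y : dot H x (k *: y) = conjc k * dot H x y.
Proof. exact: linearZr_LR. Qed.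
Lemma ipC x y : dot H y x = conjc (dot H x y).
Proof. by rewrite (hermC (dot H)) /= expr0 mul1r. Qed.
Lemma ipNl x y : dot H (- x) y = - dot H x y.
Proof. by rewrite -scaleN1r ipZl mulN1r. Qed.
Lemma ipNr x y : dot H x (- y) = - dot H x y.
Proof. by rewrite -scaleN1r ipZr rmorphN1 mulN1r. Qed.
Lemma ipBl x y z : dot H (x - y) z = dot H x z - dot H y z.
Proof. by rewrite ipDl ipNl. Qed.
Lemma ipBr x y z : dot H x (y - z) = dot H x y - dot H x z.
Proof. by rewrite ipDr ipNr. Qed.
Lemma ip0l x : dot H 0 x = 0. Proof. by rewrite -(scale0r x) ipZl mul0r. Qed.
Lemma ip0r x : dot H x 0 = 0. Proof. by rewrite ipC ip0l conjc0. Qed.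

Lemma ip_suml (I : Type) (s : seq I) (F : I -> H) y :
  dot H (\sum_(i <- s) F i) y = \sum_(i <- s) dot H (F i) y.
Proof. by elim/big_ind2: _ => [|? ? ? ? <- <-|//]; rewrite ?ip0l ?ipDl. Qed.

(** The norm of [H] has values in [R[i]]; [nr] and [rip] are real, so that estimates take place in
    the ordered field [R]. *)
Definition nr x : R := complex.Re `|x|.
Definition rip x y : R := complex.Re (dot H x y).

Lemma nrE x : `|x| = (nr x)%:C%C. Proof. exact: ge0_complexE. Qed.
Lemma nr_ge0 x : 0 <= nr x. Proof. by rewrite -ler0c -nrE. Qed.
Lemma ip_nr x : dot H x x = (nr x ^+ 2)%:C%C.
Proof. by rewrite -dot_normE nrE rmorphXn. Qed.
Lemma nr_sqr x : nr x ^+ 2 = rip x x. Proof. by rewrite /rip ip_nr. Qed.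
Lemma nr0 : nr 0 = 0. Proof. by rewrite /nr normr0. Qed.
Lemma nr_eq0 x : (nr x == 0) = (x == 0).
Proof. by rewrite -[RHS]normr_eq0 nrE eq_complex /= eqxx andbT. Qed.
Lemma nr_eq0P x : nr x = 0 -> x = 0. Proof. by move/eqP; rewrite nr_eq0 => /eqP. Qed.
Lemma nrD x y : nr (x + y) <= nr x + nr y.
Proof. by have := ler_normD x y; rewrite !nrE -rmorphD lecR. Qed.
Lemma nrN x : nr (- x) = nr x. Proof. by rewrite /nr normrN. Qed.
Lemma nrZ k x : nr (k *: x) = normc k * nr x.
Proof.
by apply: complexI; rewrite -nrE normrZ normcEn nrE -rmorphM.
Qed.
Lemma nrB x y : nr (x - y) = nr (y - x). Proof. by rewrite -nrN opprB. Qed.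
Lemma nrB_le x y : nr (x - y) <= nr x + nr y.
Proof. by rewrite -(nrN y) nrD. Qed.
Lemma nr_tri x y z : nr (x - z) <= nr (x - y) + nr (y - z).
Proof. by rewrite -[x - z](subrKA y) nrD. Qed.

Lemma ripDl x y z : rip (x + y) z = rip x z + rip y z.
Proof. by rewrite /rip ipDl cReD. Qed.
Lemma ripC x y : rip x y = rip y x. Proof. by rewrite /rip ipC cReJ. Qed.
Lemma ripDr x y z : rip x (y + z) = rip x y + rip x z.
Proof. by rewrite ripC ripDl !(ripC x). Qed.
Lemma ripNl x y : rip (- x) y = - rip x y.
Proof. by rewrite /rip ipNl cReN. Qed.
Lemma ripNr x y : rip x (- y) = - rip x y.
Proof. by rewrite ripC ripNl ripC. Qed.
Lemma ripBl x y z : rip (x - y) z = rip x z - rip y z.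
Proof. by rewrite ripDl ripNl. Qed.
Lemma ripBr x y z : rip x (y - z) = rip x y - rip x z.
Proof. by rewrite ripDr ripNr. Qed.
Lemma ripZl r x y : rip (r%:C%C *: x) y = r * rip x y.
Proof. by rewrite /rip ipZl cReMr. Qed.
Lemma ripZr r x y : rip x (r%:C%C *: y) = r * rip x y.
Proof. by rewrite ripC ripZl ripC. Qed.
Lemma rip0l x : rip 0 x = 0. Proof. by rewrite /rip ip0l. Qed.
Lemma rip0r x : rip x 0 = 0. Proof. by rewrite /rip ip0r. Qed.

(** The square of the norm of [|y| x - |x| y] is [2 |x| |y| (|x| |y| - rip x y)]. *)
Lemma rip_le x y : rip x y <= nr x * nr y.
Proof.
have [->|y0] := eqVneq y 0; first by rewrite rip0r nr0 mulr0.
have ny : 0 < nr y by rewrite lt_neqAle nr_ge0 eq_sym nr_eq0 y0.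
have nx := nr_ge0 x.
have : 0 <= nr ((nr y)%:C%C *: x - (nr x)%:C%C *: y) ^+ 2 by exact: sqr_ge0.
rewrite nr_sqr !(ripBl, ripBr, ripZl, ripZr) (ripC y) -!nr_sqr => h.
have [->|x0] := eqVneq x 0; first by rewrite rip0l nr0 mul0r.
have px : 0 < nr x by rewrite lt_neqAle nr_ge0 eq_sym nr_eq0 x0.
rewrite -subr_ge0 -(pmulr_rge0 _ px) -(pmulr_rge0 _ ny) -(pmulr_rge0 _ (ltr0n R 2)).
by apply: le_trans h _; rewrite le_eqVlt; apply/orP; left; apply/eqP; ring.
Qed.

Lemma ip_le x y : normc (dot H x y) <= nr x * nr y.
Proof.
set c := dot H x y.
have [c0|c0] := eqVneq c 0; first by rewrite c0 normc0 mulr_ge0 ?nr_ge0.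
have nc : 0 < normc c by rewrite lt_neqAle normc_ge0 eq_sym normc_eq0 c0.
(* A rotation of [x] by this scalar of modulus one makes the inner product real and nonnegative,
   which reduces the claim to [rip_le]. *)
pose k : R[i] := conjc c / (normc c)%:C%C.
have nk : normc k = 1.
  by rewrite normcM normcV normc_conj normc_real ger0_norm ?normc_ge0 ?divff ?gt_eqF.
have -> : normc c = rip (k *: x) y.
  rewrite /rip ipZl -/c /k mulrAC [conjc c * c]mulrC normc_mulJ expr2 rmorphM mulfK //.
  by rewrite eq_complex /= gt_eqF.
by apply: (le_trans (rip_le _ _)); rewrite nrZ nk mul1r.
Qed.

Lemma rip_le_abs x y : `|rip x y| <= nr x * nr y.
Proof. by rewrite ler_norml rip_le lerNl -ripNl (le_trans (rip_le _ _)) ?nrN. Qed.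

Lemma ip_eq0r y : (forall x, rip x y = 0) -> y = 0.
Proof. by move=> h; apply: nr_eq0P; apply/eqP; rewrite -sqrf_eq0 nr_sqr h. Qed.

Definition cauchy_nr (u : nat -> H) :=
  forall e : R, 0 < e -> exists N, forall m n, (N <= m)%N -> (N <= n)%N -> nr (u m - u n) < e.
Definition lim_nr (u : nat -> H) l :=
  forall e : R, 0 < e -> exists N, forall n, (N <= n)%N -> nr (u n - l) < e.

Lemma cauchy_nr_lim u : cauchy_nr u -> exists l, lim_nr u l.
Proof.
move=> cu.
have cv : cvg (u @ \oo).
  apply/cauchy_cvgP/cauchy_ballP => e e0.
  have er : e = (complex.Re e)%:C%C by exact/ge0_complexE/ltW.
  have e0' : 0 < complex.Re e by rewrite -ltr0c -er.
  have [N hN] := cu _ e0'.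
  exists (u @` [set n | (N <= n)%N], u @` [set n | (N <= n)%N]).
    by split; (exists N => // n Nn; exists n).
  case=> _ _ [[m hm <-] [n hn <-]].
  by rewrite -ball_normE /ball_ /= nrE er ltcR; exact: hN.
exists (lim (u @ \oo)) => e e0.
have e0' : 0 < e%:C%C :> R[i] by rewrite ltr0c.
move/cvgrPdist_lt: cv => /(_ _ e0') [N _ hN].
exists N => n Nn; have := hN n Nn.
by rewrite nrE ltcR nrB.
Qed.

End InnerProduct.

(** * Minimum of a quadratic functional over a real subspace *)

Section Minimization.
Context {R : realType} {V : lmodType R[i]} {H : hilbert R} {I : finType}.
Variables (L : I -> V -> H) (D : set V) (phi : V -> R) (C : R).

Hypotheses (D0 : D 0)
  (Dlin : forall (r : R) v w, D v -> D w -> D (r%:C%C *: v + w))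
  (Llin : forall i (r : R) v w, D v -> D w -> L i (r%:C%C *: v + w) = r%:C%C *: L i v + L i w)
  (philin : forall (r : R) v w, D v -> D w -> phi (r%:C%C *: v + w) = r * phi v + phi w)
  (phibd : forall v, D v -> 2 * phi v <= C + \sum_i nr (L i v) ^+ 2).

Let Q v := \sum_i nr (L i v) ^+ 2.
Let J v := Q v - 2 * phi v.
Let S v w := \sum_i rip (L i v) (L i w).

Let Q_ge0 v : 0 <= Q v. Proof. by apply: sumr_ge0 => i _; exact: sqr_ge0. Qed.

Let Qlin (r : R) v w : D v -> D w ->
  Q (r%:C%C *: v + w) = r ^+ 2 * Q v + 2 * r * S v w + Q w.
Proof.
move=> Dv Dw; rewrite /Q /S !mulr_sumr -!big_split; apply: eq_bigr => i _ /=.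
rewrite Llin // !nr_sqr !(ripDl, ripDr, ripZl, ripZr) (ripC (L i w)); ring.
Qed.

Let Jlin (r : R) v w : D v -> D w ->
  J (r%:C%C *: v + w) = r ^+ 2 * Q v + 2 * r * (S v w - phi v) + J w.
Proof. by move=> Dv Dw; rewrite /J Qlin // philin //; ring. Qed.

Let J_ge v : D v -> - C <= J v.
Proof. by move=> Dv; have := phibd Dv; rewrite /J /Q; lra. Qed.

(* The minimum of [v |-> sum_i |L_i v|^2 - 2 phi v] over [D] is attained in
   the completion; its Euler equation is the representation of [phi]. *)
Lemma riesz_family : exists eta : I -> H,
  (forall e : R, 0 < e -> exists2 v, D v & forall i, nr (L i v - eta i) < e) /\
  (forall v, D v -> \sum_i rip (L i v) (eta i) = phi v).
Proof.
pose E := J @` D.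
have hE : has_inf E.
  split; first by exists (J 0), 0.
  by exists (- C) => _ [v Dv <-]; exact: J_ge.
pose m := inf E.
have mle v : D v -> m <= J v by move=> Dv; apply: ge_inf; [case: hE|exists v].
pose e n : R := n.+1%:R^-1.
have e0 n : 0 < e n by rewrite invr_gt0 ltr0n.
have /choice[v hv] : forall n, exists v, D v /\ J v < m + e n.
  move=> n; have [_ [v Dv <-] ?] := inf_adherent (e0 n) hE.
  by exists v.
have Dvn n : D (v n) by case: (hv n).
have Jvn n : J (v n) < m + e n by case: (hv n).
(* [J] is at least [m] at the midpoint of [v n] and [v k]; the parallelogram identity turns this
   into a bound on their difference. *)
have Qdiff n k : Q ((-1)%:C%C *: v n + v k) <= 2 * (e n + e k).
  have Dh : D ((2^-1)%:C%C *: v n + ((2^-1)%:C%C *: v k + 0)) by do !apply: Dlin.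
  have := mle _ Dh.
  rewrite Jlin //; last by apply: Dlin.
  have -> : J ((2^-1)%:C%C *: v k + 0) = 2^-1 ^+ 2 * Q (v k) - phi (v k).
    rewrite Jlin //.
    have Q0 : Q 0 = 0.
      apply: big1 => i _; have := @Llin i (-1) 0 0 D0 D0.
      by rewrite scaler0 addr0 rmorphN1 scaleN1r addNr => ->; rewrite nr0 expr0n.
    have p0 : phi 0 = 0.
      by have := @philin (-1) 0 0 D0 D0; rewrite scaler0 addr0 mulN1r addNr.
    have S0 : S (v k) 0 = 0.
      apply: big1 => i _; have := @Llin i (-1) 0 0 D0 D0.
      by rewrite scaler0 addr0 rmorphN1 scaleN1r addNr => ->; rewrite rip0r.
    by rewrite S0 /J Q0 p0; field.
  have -> : S (v n) ((2^-1)%:C%C *: v k + 0) = 2^-1 * S (v n) (v k).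
    rewrite addr0 /S mulr_sumr; apply: eq_bigr => i _.
    have := @Llin i 2^-1 (v k) 0 (Dvn k) D0; rewrite addr0 => ->.
    have := @Llin i (-1) 0 0 D0 D0.
    by rewrite scaler0 addr0 rmorphN1 scaleN1r addNr => ->; rewrite addr0 ripZr.
  rewrite Qlin //; have := Jvn n; have := Jvn k; rewrite /J.
  move: (Q (v n)) (Q (v k)) (S (v n) (v k)) (phi (v n)) (phi (v k)) => a b c d f.
  have -> : 2^-1 ^+ 2 = 4^-1 :> R by field.
  lra.
have cau i : cauchy_nr (fun n => L i (v n)).
  move=> d d0.
  have d2 : 0 < d ^+ 2 / 4 by rewrite divr_gt0 ?exprn_gt0.
  have [N _ hN] := near_infty_natSinv_lt (PosNum d2).
  exists N => n k Nn Nk.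
  have hn := hN n Nn; have hk := hN k Nk; rewrite /= -/(e n) -/(e k) in hn hk.
  rewrite nrB -ltr_sqr ?nnegrE ?nr_ge0 ?(ltW d0) //.
  apply: (@le_lt_trans _ _ (Q ((-1)%:C%C *: v n + v k))).
    rewrite /Q (bigD1 i) //= Llin // rmorphN1 scaleN1r [- _ + _]addrC lerDl.
    by apply: sumr_ge0 => j _; exact: sqr_ge0.
  by have := Qdiff n k; lra.
have /choice[eta heta] i := cauchy_nr_lim (cau i).
exists eta.
have near_all (d : R) N0 : 0 < d -> exists n, (N0 <= n)%N /\ forall i, nr (L i (v n) - eta i) < d.
  move=> d0; have /choice[N hN] : forall i, exists N, forall n, (N <= n)%N -> nr (L i (v n) - eta i) < d.
    by move=> i; exact: heta.
  exists (maxn N0 (\max_i N i)%N); split; first exact: leq_maxl.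
  by move=> i; apply: hN; rewrite (leq_trans _ (leq_maxr _ _)) // leq_bigmax.
split.
  by move=> d /(near_all d 0%N)[n [_ h]]; exists (v n).
move=> w Dw.
pose g := \sum_i rip (L i w) (eta i) - phi w.
apply/eqP; rewrite -subr_eq0 -/g; have [//|g0] := eqVneq g 0; exfalso.
have q0 := Q_ge0 w; set q := Q w in q0.
(* A move by [t w] changes [J] by about [2 t g + t^2 q = - dl < 0]; the denominator is [q + 1]
   because [q] may vanish. The gain [dl] exceeds the sum of [e n < dl / 2] and the error
   [2 t (gn - g) <= dl / 2], against the minimality of [m]. *)
pose t := - g / (q + 1).
have q1 : 0 < q + 1 by lra.
pose dl := - (2 * t * g + t ^+ 2 * q).
have dl0 : 0 < dl.
  have -> : dl = g ^+ 2 * (q + 2) / (q + 1) ^+ 2.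
    by rewrite /dl /t; field; rewrite gt_eqF.
  apply: divr_gt0; last exact: exprn_gt0.
  by apply: mulr_gt0; [rewrite exprn_even_gt0|lra].
pose bw := \sum_i nr (L i w).
have bw0 : 0 <= bw by apply: sumr_ge0 => i _; exact: nr_ge0.
pose d := dl / (4 * (`|t| + 1) * (bw + 1)).
have t0 : 0 <= `|t| by [].
have d0 : 0 < d by apply: divr_gt0 => //; apply: mulr_gt0; [apply: mulr_gt0|]; lra.
have dl2 : 0 < dl / 2 by lra.
have [N _ hN] := near_infty_natSinv_lt (PosNum dl2).
have [n [Nn hn]] := near_all d N d0.
have en := hN n Nn; rewrite /= -/(e n) in en.
pose gn := S w (v n) - phi w.
have gng : `|gn - g| <= bw * d.
  rewrite /gn /g opprB addrA subrK /S -sumrB (le_trans (ler_norm_sum _ _ _)) //.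
  rewrite /bw mulr_suml; apply: ler_sum => i _.
  rewrite -ripBr (le_trans (rip_le_abs _ _)) // ler_wpM2l ?nr_ge0 //.
  exact/ltW.
have := mle _ (Dlin t Dw (Dvn n)); rewrite Jlin // -/gn -/q.
have := Jvn n.
have h1 : 2 * t * (gn - g) <= dl / 2.
  apply: le_trans (ler_norm _) _; rewrite (normrM (2 * t)) (normrM 2) (ger0_norm (ler0n _ 2)).
  apply: (@le_trans _ _ (2 * (`|t| + 1) * ((bw + 1) * d))).
    apply: ler_pM; [by apply: mulr_ge0|by []| |].
      by rewrite ler_pM2l ?ltr0n // lerDl ler01.
    by apply: (le_trans gng); apply: ler_wpM2r; [exact: ltW|lra].
  rewrite le_eqVlt; apply/orP; left; apply/eqP.
  by rewrite /d; field; apply/andP; split; rewrite gt_eqF //; lra.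
move: h1 en; rewrite /dl; clear => h1 en; lra.
Qed.

End Minimization.

(** * Representation of bounded linear functionals *)

Section Riesz.
Context {R : realType} {V : lmodType R[i]} {H : hilbert R}.
Variables (L : V -> H) (D : set V) (psi : V -> R[i]) (C : R).

Hypotheses (D0 : D 0) (Dlin : forall (k : R[i]) v w, D v -> D w -> D (k *: v + w))
  (Llin : forall (k : R[i]) v w, D v -> D w -> L (k *: v + w) = k *: L v + L w)
  (psilin : forall (k : R[i]) v w, D v -> D w -> psi (k *: v + w) = k * psi v + psi w)
  (psibd : forall v, D v -> normc (psi v) <= C * nr (L v)).

(** A family with one member and the functional [Re psi] give [eta] for real parts, the lower bound
    being [2 C s <= C^2 + s^2]. The imaginary part of [psi v] is read off from the real part at
    ['i v]. *)
Lemma riesz : exists eta : H, forall v, D v -> psi v = dot H (L v) eta.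
Proof.
have [|||||eta [_ heta]] := @riesz_family R V H 'I_1 (fun=> L) D
    (fun v => complex.Re (psi v)) (C ^+ 2); do ?by [].
- by move=> r v w; exact: Dlin.
- by move=> _ r v w; exact: Llin.
- by move=> r v w Dv Dw; rewrite psilin // cReD cReMr.
- move=> v Dv; rewrite big_ord1.
  have h1 := le_trans (Re_le_normc _) (psibd Dv).
  have := sqr_ge0 (C - nr (L v)); set a := nr _ in h1 *.
  have -> : (C - a) ^+ 2 = C ^+ 2 - 2 * (C * a) + a ^+ 2 by ring.
  lra.
have h v : D v -> rip (L v) (eta ord0) = complex.Re (psi v).
  by move=> /heta; rewrite big_ord1.
exists (eta ord0) => v Dv.
have := h _ Dv; have Div : D ('i%C *: v) by rewrite -[_ *: v]addr0; exact: Dlin.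
have := h _ Div.
have L0 : L 0 = 0.
  have := Llin (-1) D0 D0; rewrite scaler0 addr0 scaleN1r addNr; exact.
have p0 : psi 0 = 0.
  have := psilin (-1) D0 D0; rewrite scaler0 addr0 mulN1r addNr; exact.
have -> : L ('i%C *: v) = 'i%C *: L v by rewrite -[_ *: v]addr0 Llin // L0 addr0.
have -> : psi ('i%C *: v) = 'i%C * psi v by rewrite -[_ *: v]addr0 psilin // p0 addr0.
rewrite /rip ipZl; case: (dot H _ _) => a b; case: (psi v) => c d /=.
by rewrite !mul0r !mul1r !sub0r => /oppr_inj -> ->.
Qed.

End Riesz.

(** * Bounded operators *)

Section Operators.
Context {R : realType} {H : hilbert R}.
Implicit Types (T S X Y Z : H -> H) (x y : H) (C r : R).

Lemma linopD T x y : linear T -> T (x + y) = T x + T y.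
Proof. by move=> lT; have := lT 1 x y; rewrite !scale1r. Qed.
Lemma linop0 T : linear T -> T 0 = 0.
Proof. by move=> lT; have := lT (-1) 0 0; rewrite scaler0 addr0 scaleN1r addNr. Qed.
Lemma linopZ T k x : linear T -> T (k *: x) = k *: T x.
Proof. by move=> lT; have := lT k x 0; rewrite !addr0 linop0 // addr0. Qed.
Lemma linopN T x : linear T -> T (- x) = - T x.
Proof. by move=> lT; rewrite -scaleN1r linopZ // scaleN1r. Qed.
Lemma linopB T x y : linear T -> T (x - y) = T x - T y.
Proof. by move=> lT; rewrite linopD // linopN. Qed.
Lemma linop_sum T (I : Type) (s : seq I) (F : I -> H) : linear T ->
  T (\sum_(i <- s) F i) = \sum_(i <- s) T (F i).
Proof.
move=> lT; elim: s => [|a s IH]; first by rewrite !big_nil linop0.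
by rewrite !big_cons linopD // IH.
Qed.

Definition opb T C := forall x, nr (T x) <= C * nr x.

Lemma opb_le T C C' : C <= C' -> opb T C -> opb T C'.
Proof. by move=> CC' h x; apply: (le_trans (h x)); apply: ler_wpM2r => //; exact: nr_ge0. Qed.

Lemma opb_comp T S C C' : 0 <= C -> opb T C -> opb S C' -> opb (T \o S) (C * C').
Proof.
move=> C0 hT hS x; apply: (le_trans (hT _)); rewrite -mulrA.
by apply: ler_wpM2l => //; exact: hS.
Qed.

Lemma opb_add T S C C' : opb T C -> opb S C' -> opb (fun x => T x + S x) (C + C').
Proof.
by move=> hT hS x; apply: (le_trans (nrD _ _)); rewrite mulrDl lerD.
Qed.

Lemma opb_sub T S C C' : opb T C -> opb S C' -> opb (fun x => T x - S x) (C + C').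
Proof.
by move=> hT hS x; apply: (le_trans (nrB_le _ _)); rewrite mulrDl lerD.
Qed.

Lemma opb_scale k T C : opb T C -> opb (fun x => k *: T x) (normc k * C).
Proof.
by move=> hT x; rewrite nrZ -mulrA ler_wpM2l ?normc_ge0.
Qed.

Lemma bounded_opP T : bounded_op T <-> linear T /\ exists2 C, 0 <= C & opb T C.
Proof.
split=> [[lT cT]|[lT [C C0 hC]]]; split=> //; last first.
  move=> x; apply/cvgrPdist_lt => e e0.
  have er : e = (complex.Re e)%:C%C by exact/ge0_complexE/ltW.
  have e1 : 0 < complex.Re e by rewrite -ltr0c -er.
  have d0 : 0 < (complex.Re e / (C + 1))%:C%C :> R[i].
    by rewrite ltr0c divr_gt0 //; lra.
  near=> y.
  have : `|x - y| < (complex.Re e / (C + 1))%:C%C.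
    by near: y; apply: cvgr_dist_lt => //; exact: cvg_id.
  rewrite !nrE er !ltcR -linopB // ltr_pdivlMr; last lra.
  move=> h; apply: (le_lt_trans (hC _)); apply: le_lt_trans h.
  by have := nr_ge0 (x - y); lra.
have /cvgrPdist_lt /(_ 1 ltr01) /nbhs_normP [d d0 hd] := cT 0.
have dr : d = (complex.Re d)%:C%C by exact/ge0_complexE/ltW.
have d1 : 0 < complex.Re d by rewrite -ltr0c -dr.
set dd := complex.Re d in d1 dr.
(* Vectors of norm [dd / 2] are sent into the unit ball. *)
exists (2 / dd) => [|x]; first by rewrite divr_ge0 ?ltW.
have [->|x0] := eqVneq x 0; first by rewrite linop0 // !nr0 mulr0.
have nx : 0 < nr x by rewrite lt_neqAle nr_ge0 eq_sym nr_eq0 x0.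
have := hd ((dd / 2 / nr x)%:C%C *: x).
rewrite /ball_ /= sub0r normrN nrE dr ltcR nrZ normc_real ger0_norm; last first.
  by rewrite !divr_ge0 ?ltW.
rewrite divfK ?gt_eqF // => /(_ ltac:(lra)).
rewrite linop0 // sub0r normrN linopZ // nrE nrZ normc_real ger0_norm; last first.
  by rewrite !divr_ge0 ?ltW.
rewrite -[X in _ < X](rmorph1 (real_complex R)) ltcR mulrAC ltr_pdivrMr // mul1r => h.
rewrite mulrAC ler_pdivlMr //; lra.
Unshelve. all: by end_near. Qed.

Lemma bop_lin T : bounded_op T -> linear T. Proof. by case. Qed.

Lemma bop_bd T : bounded_op T -> exists2 C, 0 < C & opb T C.
Proof.
case/bounded_opP => _ [C C0 h]; exists (C + 1); first lra.
by apply: opb_le h; lra.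
Qed.

Lemma bop_intro T C : linear T -> 0 <= C -> opb T C -> bounded_op T.
Proof. by move=> lT C0 h; apply/bounded_opP; split=> //; exists C. Qed.

Lemma bop_id : bounded_op (@id H).
Proof. by apply: (@bop_intro _ 1) => // x; rewrite mul1r. Qed.

Lemma bop_comp T S : bounded_op T -> bounded_op S -> bounded_op (T \o S).
Proof.
move=> hT hS; have [C C0 hC] := bop_bd hT; have [C' C0' hC'] := bop_bd hS.
apply: (@bop_intro _ (C * C')); [|by rewrite mulr_ge0 ?ltW|by apply: opb_comp => //; exact: ltW].
by move=> k x y /=; rewrite (bop_lin hS) (bop_lin hT).
Qed.

Lemma bop_lincomb k T S : bounded_op T -> bounded_op S -> bounded_op (fun x => k *: T x + S x).
Proof.
move=> hT hS; have [C C0 hC] := bop_bd hT; have [C' C0' hC'] := bop_bd hS.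
apply: (@bop_intro _ (normc k * C + C')).
- move=> a x y; rewrite (bop_lin hS) (bop_lin hT) !scalerDr !scalerA [k * a]mulrC.
  by rewrite addrACA.
- by apply: addr_ge0; [apply: mulr_ge0; [exact: normc_ge0|exact: ltW]|exact: ltW].
- by apply: opb_add => //; exact: opb_scale.
Qed.

Lemma ext_ip x y : (forall z, dot H z x = dot H z y) -> x = y.
Proof.
move=> h; apply/eqP; rewrite -subr_eq0; apply/eqP/ip_eq0r => z.
by rewrite /rip ipBr h subrr.
Qed.

Lemma ext_ipl x y : (forall z, dot H x z = dot H y z) -> x = y.
Proof. by move=> h; apply: ext_ip => z; rewrite ipC h -ipC. Qed.

(* Two applications of Riesz: a sesquilinear form bounded on [D] gives an
   operator on the space where the vectors [L v], [v] in [D], are dense. *)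
Lemma form_op (V : lmodType R[i]) (L : V -> H) (D : set V) (beta : V -> V -> R[i]) (C : R) :
  0 <= C -> D 0 -> (forall (k : R[i]) v w, D v -> D w -> D (k *: v + w)) ->
  (forall (k : R[i]) v w, D v -> D w -> L (k *: v + w) = k *: L v + L w) ->
  (forall x (e : R), 0 < e -> exists2 v, D v & nr (x - L v) < e) ->
  (forall (k : R[i]) v v' w, D v -> D v' -> D w ->
     beta (k *: v + v') w = k * beta v w + beta v' w) ->
  (forall (k : R[i]) v w w', D v -> D w -> D w' ->
     beta v (k *: w + w') = conjc k * beta v w + beta v w') ->
  (forall v w, D v -> D w -> normc (beta v w) <= C * (nr (L v) * nr (L w))) ->
  exists T, [/\ bounded_op T, opb T C &
    forall v w, D v -> D w -> dot H (T (L v)) (L w) = beta v w].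
Proof.
move=> C0 D0 Dlin Llin dense bl br bb.
have L0 : L 0 = 0.
  by have := Llin (-1) 0 0 D0 D0; rewrite scaler0 addr0 scaleN1r addNr.
have eqD x y : (forall v, D v -> dot H x (L v) = dot H y (L v)) -> x = y.
  move=> h; apply/eqP; rewrite -subr_eq0; apply/eqP/nr_eq0P/eqP.
  rewrite -sqrf_eq0; apply/eqP/le_anti; rewrite sqr_ge0 andbT.
  apply/ler_addgt0Pr => e e0; rewrite add0r.
  have n0 : 0 < nr (x - y) + 1 by have := nr_ge0 (x - y); lra.
  have [v Dv hv] := dense (x - y) _ (divr_gt0 e0 n0).
  have -> : nr (x - y) ^+ 2 = rip (x - y) (x - y - L v).
    by rewrite nr_sqr [in RHS]ripBr {3}/rip (ipBl x y (L v)) h // subrr subr0.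
  apply: (le_trans (rip_le _ _)).
  apply: (@le_trans _ _ ((nr (x - y) + 1) * nr (x - y - L v))).
    by apply: ler_wpM2r; [exact: nr_ge0|lra].
  by rewrite mulrC -ler_pdivlMr // ltW.
(* The first representation fixes the second argument of [beta]; outside [D] the vector [tau w] is
   arbitrary. *)
have /choice[tau htau] : forall w, exists t, D w -> forall v, D v -> beta v w = dot H (L v) t.
  move=> w; have [Dw|nDw] := pselect (D w); last by exists 0.
  have [||||//|t ht] := @riesz R V H L D (beta^~ w) (C * nr (L w)).
  - exact: D0.
  - exact: Dlin.
  - exact: Llin.
  - by move=> k v v' Dv Dv'; exact: bl.
  - by move=> v Dv; rewrite -mulrA [nr (L w) * _]mulrC; exact: bb.
  by exists t.
have tau_lin k v w : D v -> D w -> tau (k *: v + w) = k *: tau v + tau w.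
  move=> Dv Dw; apply: eqD => z Dz.
  apply: (inv_inj (@conjcK R)).
  rewrite -!ipC -htau //; last exact: Dlin.
  by rewrite br // ipDr ipZr !htau.
(* [rip (tau w) (tau w)] is close to [Re (beta v w)] when [L v] is close to [tau w], and [beta] is
   bounded; the errors are absorbed in [e]. *)
have tau_bd w : D w -> nr (tau w) <= C * nr (L w).
  move=> Dw.
  have [->|t0] := eqVneq (tau w) 0; first by rewrite nr0 mulr_ge0 ?nr_ge0.
  have nt : 0 < nr (tau w) by rewrite lt_neqAle nr_ge0 eq_sym nr_eq0 t0.
  apply/ler_addgt0Pr => e e0.
  rewrite -(ler_pM2r nt) -expr2 nr_sqr.
  have K0 : 0 < nr (tau w) + C * nr (L w) + 1.
    by have := mulr_ge0 C0 (nr_ge0 (L w)); lra.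
  have [v Dv hv] := dense (tau w) _ (divr_gt0 (mulr_gt0 e0 nt) K0).
  set dlt := nr (tau w - L v) in hv.
  have -> : rip (tau w) (tau w) = rip (tau w - L v) (tau w) + complex.Re (beta v w).
    by rewrite ripBl htau // /rip; ring.
  have h1 := rip_le (tau w - L v) (tau w); rewrite -/dlt in h1.
  have h2 : complex.Re (beta v w) <= C * (nr (L v) * nr (L w)).
    exact: le_trans (Re_le_normc _) (bb _ _ Dv Dw).
  have h3 : nr (L v) <= nr (tau w) + dlt.
    by have := nr_tri (L v) (tau w) 0; rewrite !subr0 nrB -/dlt addrC.
  have h4 : C * (nr (L v) * nr (L w)) <= C * nr (L w) * nr (tau w) + C * nr (L w) * dlt.
    rewrite -mulrDr [nr (L v) * _]mulrC mulrA; apply: ler_wpM2l h3.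
    by rewrite mulr_ge0 ?nr_ge0.
  have h5 : dlt * (nr (tau w) + C * nr (L w) + 1) < e * nr (tau w) by rewrite -ltr_pdivlMr.
  have h6 : 0 <= dlt := nr_ge0 _.
  lra.
(* The second representation is that of [w |-> dot H (tau w) x], linear because [tau] is linear on
   [D]. *)
have /choice[T hT] : forall x, exists t, forall w, D w -> dot H x (tau w) = dot H t (L w).
  move=> x.
  have [||||//|t ht] := @riesz R V H L D (fun w => dot H (tau w) x) (nr x * C).
  - exact: D0.
  - exact: Dlin.
  - exact: Llin.
  - by move=> k v v' Dv Dv'; rewrite tau_lin // ipDl ipZl.
  - move=> v Dv; apply: (le_trans (ip_le _ _)); rewrite mulrC -mulrA.
    by apply: ler_wpM2l; [exact: nr_ge0|exact: tau_bd].
  by exists t => w Dw; rewrite ipC ht // -ipC.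
have lT : linear T.
  move=> k x y; apply: eqD => w Dw.
  by rewrite -hT // !ipDl !ipZl !hT.
have bT : opb T C.
  move=> x.
  have [->|t0] := eqVneq (T x) 0; first by rewrite nr0 mulr_ge0 ?nr_ge0.
  have nt : 0 < nr (T x) by rewrite lt_neqAle nr_ge0 eq_sym nr_eq0 t0.
  apply/ler_addgt0Pr => e e0.
  rewrite -(ler_pM2r nt) -expr2 nr_sqr.
  have K0 : 0 < nr (T x) + C * nr x + 1.
    by have := mulr_ge0 C0 (nr_ge0 x); lra.
  have [v Dv hv] := dense (T x) _ (divr_gt0 (mulr_gt0 e0 nt) K0).
  set dlt := nr (T x - L v) in hv.
  have -> : rip (T x) (T x) = rip (T x) (T x - L v) + rip x (tau v).
    by rewrite ripBr /rip hT //; ring.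
  have h1 := rip_le (T x) (T x - L v); rewrite -/dlt in h1.
  have h2 := rip_le x (tau v).
  have h3 : nr (L v) <= nr (T x) + dlt.
    by have := nr_tri (L v) (T x) 0; rewrite !subr0 nrB -/dlt addrC.
  have h4 : nr x * nr (tau v) <= nr x * (C * (nr (T x) + dlt)).
    apply: ler_wpM2l; first exact: nr_ge0.
    by apply: (le_trans (tau_bd _ Dv)); exact: ler_wpM2l.
  have h5 : dlt * (nr (T x) + C * nr x + 1) < e * nr (T x) by rewrite -ltr_pdivlMr.
  have h6 : 0 <= dlt := nr_ge0 _.
  have -> : (C * nr x + e) * nr (T x) = nr x * (C * nr (T x)) + e * nr (T x) by ring.
  move: h4; rewrite mulrDr mulrDr.
  lra.
exists T; split=> //; first exact: bop_intro bT.
by move=> v w Dv Dw; rewrite -hT // htau.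
Qed.

(** The adjoint is the operator of the form [(x, y) |-> dot H x (T y)], taken on the whole space. *)
Lemma adjoint_ex T : bounded_op T -> exists2 S, bounded_op S & adjoint_pair T S.
Proof.
move=> hT; have [C C0 hC] := bop_bd hT.
have [||||||//|S [bS _ hS]] := @form_op H id setT (fun x y => dot H x (T y)) C (ltW C0).
- by [].
- by [].
- by [].
- by move=> x e e0; exists x => //; rewrite subrr nr0.
- by move=> k v v' w _ _ _; rewrite ipDl ipZl.
- by move=> k v w w' _ _ _; rewrite (bop_lin hT) ipDr ipZr.
- move=> v w _ _; apply: (le_trans (ip_le _ _)); rewrite mulrCA.
  by apply: ler_wpM2l; [exact: nr_ge0|exact: hC].
by exists S => // x y; rewrite ipC -(hS y x) // -ipC.
Qed.

End Operators.

(** * Norm limits of sequences of vectors *)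

Section Limits.
Context {R : realType} {H : hilbert R}.
Implicit Types (u v : nat -> H) (l x y : H).

Lemma lim_nr_cst l : lim_nr (fun=> l) l.
Proof. by move=> e e0; exists 0%N => n _; rewrite subrr nr0. Qed.

Lemma lim_nr_shift u l : lim_nr u l -> lim_nr (fun n => u n.+1) l.
Proof. by move=> h e /h[N hN]; exists N => n Nn; apply: hN; exact: leqW. Qed.

Lemma lim_nr_uniq u l l' : lim_nr u l -> lim_nr u l' -> l = l'.
Proof.
move=> h h'; apply/eqP; rewrite -subr_eq0; apply/eqP/nr_eq0P/le_anti.
rewrite nr_ge0 andbT; apply/ler_addgt0Pr => e e0; rewrite add0r.
have e2 : 0 < e / 2 by lra.
have [N hN] := h _ e2; have [N' hN'] := h' _ e2.
have a := hN _ (leq_maxl N N'); have b := hN' _ (leq_maxr N N').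
have := nr_tri l (u (maxn N N')) l'; rewrite (nrB l (u _)) => c; lra.
Qed.

Lemma lim_nr_lincomb u v l l' (k : R[i]) : lim_nr u l -> lim_nr v l' ->
  lim_nr (fun n => k *: u n + v n) (k *: l + l').
Proof.
move=> h h' e e0.
have k0 := normc_ge0 k.
have e1 : 0 < e / (2 * (normc k + 1)) by apply: divr_gt0 => //; lra.
have e2 : 0 < e / 2 by lra.
have [N hN] := h _ e1; have [N' hN'] := h' _ e2.
exists (maxn N N') => n; rewrite geq_max => /andP[/hN a /hN' b].
rewrite opprD addrACA -scalerBr; apply: le_lt_trans (nrD _ _) _; rewrite nrZ.
have p : 0 < 2 * (normc k + 1) by lra.
have : nr (u n - l) * (2 * (normc k + 1)) < e by rewrite -ltr_pdivlMr.
have := nr_ge0 (u n - l); lra.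
Qed.

Lemma lim_nr_le u l C : lim_nr u l -> (forall n, nr (u n) <= C) -> nr l <= C.
Proof.
move=> h hC; apply/ler_addgt0Pr => e e0; have [N hN] := h _ e0.
have := hN N (leqnn N); have := hC N; have := nr_tri l (u N) 0.
rewrite !subr0 (nrB l); lra.
Qed.

Lemma expr_small (r e : R) : 0 <= r -> r < 1 -> 0 < e ->
  exists N, forall n, (N <= n)%N -> r ^+ n < e.
Proof.
move=> r0 r1 e0; have h : `|r| < 1 by rewrite ger0_norm.
have /cvgrPdist_lt /(_ _ e0)[N _ hN] := cvg_expr h.
exists N => n Nn; have := hN n Nn; rewrite /= sub0r normrN normrX ger0_norm //.
Qed.

End Limits.

(** * Positive operators *)

Section Positive.
Context {R : realType} {H : hilbert R}.
Implicit Types (T S X Y Z : H -> H) (x y : H) (C r : R).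

Definition opos T := forall x, 0 <= dot H (T x) x.

Lemma opos_rip T x : opos T -> 0 <= rip (T x) x.
Proof. by move=> /(_ x); rewrite ge0cE => /andP[]. Qed.

Lemma opos_ip T x : opos T -> dot H (T x) x = (rip (T x) x)%:C%C.
Proof. by move=> /(_ x); exact: ge0_complexE. Qed.

(** In the order of [R[i]] positivity includes being real. Polarisation: the imaginary part of
    [dot H (T z) z] vanishes at [x + y] and at [x + 'i y]. *)
Lemma opos_sa T : linear T -> opos T -> adjoint_pair T T.
Proof.
move=> lT pT x y.
have im z : complex.Im (dot H (T z) z) = 0.
  by have := pT z; rewrite ge0cE => /andP[/eqP].
have a : complex.Im (dot H (T x) y + dot H (T y) x) = 0.
  have := im (x + y); rewrite linopD // ipDl !ipDr !cImD !im.
  by rewrite add0r addr0 -cImD.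
have b : complex.Im (dot H (T x) ('i%C *: y) + dot H (T ('i%C *: y)) x) = 0.
  have := im (x + 'i%C *: y); rewrite linopD // ipDl !ipDr !cImD !im.
  by rewrite add0r addr0 -cImD.
move: a b; rewrite (ipC (T y)) linopZ // ipZl ipZr.
case: (dot H (T x) y) => a b; case: (dot H (T y) x) => c d /=.
move=> h1 h2.
by congr Complex; lra.
Qed.

Lemma sa_rip T x : adjoint_pair T T -> dot H (T x) x = (rip (T x) x)%:C%C.
Proof.
move=> sT; have : dot H (T x) x = conjc (dot H (T x) x) by rewrite -ipC -sT.
by rewrite /rip; case: (dot H (T x) x) => a b /= [] h; congr Complex; lra.
Qed.

(** This is [T^2 <= r T] for [0 <= T <= r]. Positivity of [T] is used at [x - T x / r], where the
    quadratic term [rip (T (T x)) (T x) / r^2] is at most [|T x|^2 / r]. *)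
Lemma opos_bd T r x : 0 < r -> linear T -> opos T ->
  (forall x, rip (T x) x <= r * nr x ^+ 2) -> nr (T x) ^+ 2 <= r * rip (T x) x.
Proof.
move=> r0 lT pT hT; have sT := opos_sa lT pT.
have := opos_rip (x - (r^-1)%:C%C *: T x) pT.
rewrite linopB // linopZ // !(ripBl, ripBr, ripZl, ripZr).
have -> : rip (T (T x)) x = nr (T x) ^+ 2 by rewrite nr_sqr /rip sT.
rewrite -nr_sqr; have := hT (T x); set a := rip (T (T x)) _; set b := nr _ ^+ 2.
move=> h1 h2.
have h3 : r^-1 * (r^-1 * a) <= r^-1 * b.
  rewrite ler_pM2l ?invr_gt0 // -(ler_pM2l r0) mulrA mulfV ?gt_eqF //; lra.
have h4 : r^-1 * b <= rip (T x) x by lra.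
by move: h4; rewrite ler_pdivrMl.
Qed.

Lemma opos_opb T r : 0 < r -> linear T -> opos T ->
  (forall x, rip (T x) x <= r * nr x ^+ 2) -> opb T r.
Proof.
move=> r0 lT pT hT x.
have h := opos_bd x r0 lT pT hT.
have h2 := rip_le (T x) x.
have [->|t0] := eqVneq (T x) 0; first by rewrite nr0 mulr_ge0 ?nr_ge0 // ltW.
have nt : 0 < nr (T x) by rewrite lt_neqAle nr_ge0 eq_sym nr_eq0 t0.
rewrite -(ler_pM2r nt) -expr2; apply: (le_trans h).
by rewrite -mulrA ler_pM2l // mulrC.
Qed.

Lemma opb_rip T C x : opb T C -> rip (T x) x <= C * nr x ^+ 2.
Proof.
move=> h; apply: (le_trans (rip_le _ _)); rewrite expr2 mulrA.
by apply: ler_wpM2r => //; exact: nr_ge0.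
Qed.

Lemma adj_sym T S : adjoint_pair T S -> adjoint_pair S T.
Proof. by move=> h x y; rewrite ipC -h -ipC. Qed.

Lemma adj_uniq T S S' : adjoint_pair T S -> adjoint_pair T S' -> S = S'.
Proof. by move=> h h'; apply/funext => x; apply: ext_ip => y; rewrite -h -h'. Qed.

End Positive.

(** * Weak closures of *-algebras and Neumann series *)

Section StarAlgebras.
Context {R : realType} {H : hilbert R}.
Implicit Types (T S X Y Z : H -> H) (x y : H) (C r : R) (M : set (H -> H)).

Lemma weak_closureP M T : weak_closure M T <-> bounded_op T /\
  forall (s : seq (H * H)) (e : R), 0 < e -> exists2 S, M S &
    forall v, v \in s -> normc (dot H (T v.1) v.2 - dot H (S v.1) v.2) < e.
Proof.
split=> -[bT h]; split=> // s e e0.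
  have [|S MS hS] := h s (e%:C%C); first by rewrite ltr0c.
  by exists S => // v /hS; rewrite normcEn ltcR.
have er : e = (complex.Re e)%:C%C by exact/ge0_complexE/ltW.
have e1 : 0 < complex.Re e by rewrite -ltr0c -er.
have [S MS hS] := h s _ e1.
by exists S => // v /hS; rewrite normcEn er ltcR.
Qed.

Lemma sub_weak_closure M : (forall T, M T -> bounded_op T) -> M `<=` weak_closure M.
Proof.
move=> bM T MT; apply/weak_closureP; split; first exact: bM.
by move=> s e e0; exists T => // v _; rewrite subrr normc0.
Qed.

Lemma weak_closure_mono M N : M `<=` N -> weak_closure M `<=` weak_closure N.
Proof.
move=> MN T /weak_closureP[bT h]; apply/weak_closureP; split=> // s e e0.
by have [S MS hS] := h s e e0; exists S => //; exact: MN.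
Qed.

Lemma weak_closure_idem M : weak_closure (weak_closure M) `<=` weak_closure M.
Proof.
move=> T /weak_closureP[bT h]; apply/weak_closureP; split=> // s e e0.
have e2 : 0 < e / 2 by lra.
have [S /weak_closureP[bS hS] hT] := h s _ e2.
have [X MX hX] := hS s _ e2; exists X => // v vs.
rewrite -[_ - _](subrKA (dot H (S v.1) v.2)).
by apply: le_lt_trans (le_normcD _ _) _; have := hT v vs; have := hX v vs; lra.
Qed.

Lemma strong_seq_closure M (u : nat -> H -> H) T : bounded_op T ->
  (forall n, M (u n)) -> (forall x, lim_nr (fun n => u n x) (T x)) -> weak_closure M T.
Proof.
move=> bT Mu hu; apply/weak_closureP; split=> // s e e0.
have [N hN] : exists N, forall n, (N <= n)%N ->
    forall v, v \in s -> normc (dot H (T v.1) v.2 - dot H (u n v.1) v.2) < e.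
  elim: s => [|v s [N hN]]; first by exists 0%N.
  have n0 : 0 < nr v.2 + 1 by have := nr_ge0 v.2; lra.
  have [N' hN'] := hu v.1 _ (divr_gt0 e0 n0).
  exists (maxn N N') => n; rewrite geq_max => /andP[Nn Nn'] w.
  rewrite inE => /orP[/eqP ->|]; last exact: hN.
  rewrite -ipBl; apply: (le_lt_trans (ip_le _ _)).
  have := hN' n Nn'; rewrite ltr_pdivlMr // nrB.
  have := nr_ge0 (T v.1 - u n v.1); lra.
by exists (u N) => //; exact: hN.
Qed.

Definition star_alg M :=
  [/\ forall T, M T -> bounded_op T, M id,
      forall k T S, M T -> M S -> M (fun x => k *: T x + S x),
      forall T S, M T -> M S -> M (T \o S)
    & forall T, M T -> exists2 S, M S & adjoint_pair T S].

(** Multiplication is only separately weakly continuous. For a product [T \o S] of limits, [S] is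
    first replaced by an element [X] of [M], the adjoint of [T] moving [T] into the test vectors;
    then [T \o X] is in the closure by [right]. *)
Lemma star_alg_closure M : star_alg M -> star_alg (weak_closure M).
Proof.
move=> [bM M1 Ml Mm Ms].
have right S T : M S -> weak_closure M T -> weak_closure M (T \o S).
  move=> MS /weak_closureP[bT hT]; apply/weak_closureP.
  split=> [|s e e0]; first by apply: bop_comp => //; exact: bM.
  have [X MX hX] := hT [seq (S v.1, v.2) | v <- s] e e0.
  exists (X \o S); first exact: Mm.
  by move=> v vs; apply: (hX (S v.1, v.2)); apply/mapP; exists v.
split.
- by move=> T /weak_closureP[].
- exact: sub_weak_closure.
- move=> k T S /weak_closureP[bT hT] /weak_closureP[bS hS].
  apply/weak_closureP; split=> [|s e e0]; first exact: bop_lincomb.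
  have k0 := normc_ge0 k.
  have e1 : 0 < e / (2 * (normc k + 1)) by apply: divr_gt0 => //; lra.
  have e2 : 0 < e / 2 by lra.
  have [X MX hX] := hT s _ e1; have [Y MY hY] := hS s _ e2.
  exists (fun x => k *: X x + Y x); first exact: Ml.
  move=> v vs; rewrite !ipDl !ipZl opprD addrACA -mulrBr.
  apply: le_lt_trans (le_normcD _ _) _; rewrite normcM.
  have := hX v vs; have := hY v vs.
  set a := normc (_ - _); set b := normc (_ - _) => h1 h2.
  have p : 0 < 2 * (normc k + 1) by lra.
  have : b * (2 * (normc k + 1)) < e by rewrite -ltr_pdivlMr.
  have : 0 <= b := normc_ge0 _; lra.
- move=> T S hT hS; apply: weak_closure_idem.
  have [bT _] := hT; have [bS _] := hS.
  move/weak_closureP: (hS) => [_ aS].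
  apply/weak_closureP; split=> [|s e e0]; first exact: bop_comp.
  have [T' bT' adT] := adjoint_ex bT.
  have [X MX hX] := aS [seq (v.1, T' v.2) | v <- s] e e0.
  exists (T \o X); first exact: right.
  move=> v vs; rewrite /= !adT.
  by apply: (hX (v.1, T' v.2)); apply/mapP; exists v.
- move=> T /weak_closureP[bT hT]; have [S bS adT] := adjoint_ex bT.
  exists S => //; apply/weak_closureP; split=> // s e e0.
  have [X MX hX] := hT [seq (v.2, v.1) | v <- s] e e0.
  have [Y MY adX] := Ms _ MX; exists Y => // v vs.
  rewrite (ipC v.2) -adT (ipC v.2 (Y _)) -adX -rmorphB normc_conj.
  by apply: (hX (v.2, v.1)); apply/mapP; exists v.
Qed.

Lemma norm_limit (u : nat -> H -> H) : (forall n, bounded_op (u n)) ->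
  (forall e : R, 0 < e -> exists N, forall m n, (N <= m)%N -> (N <= n)%N ->
     opb (fun x => u m x - u n x) e) ->
  exists2 T, bounded_op T & forall e : R, 0 < e -> exists N, forall n, (N <= n)%N ->
     opb (fun x => u n x - T x) e.
Proof.
move=> bu cu.
have /choice[T hT] : forall x, exists l, lim_nr (fun n => u n x) l.
  move=> x; apply: cauchy_nr_lim => e e0.
  have n0 : 0 < nr x + 1 by have := nr_ge0 x; lra.
  have [N hN] := cu _ (divr_gt0 e0 n0); exists N => m n Nm Nn.
  apply: le_lt_trans (hN m n Nm Nn x) _; rewrite mulrAC ltr_pdivrMr // ltr_pM2l //; lra.
have lT : linear T.
  move=> k x y; apply: lim_nr_uniq (hT _) _.
  have -> : (fun n => u n (k *: x + y)) = (fun n => k *: u n x + u n y).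
    by apply/funext => n; exact: (bop_lin (bu n)).
  exact: lim_nr_lincomb.
have key (e : R) : 0 < e -> exists N, forall n, (N <= n)%N -> opb (fun x => u n x - T x) e.
  move=> e0; have [N hN] := cu _ e0; exists N => n Nn x.
  have h := lim_nr_lincomb (-1) (hT x) (lim_nr_cst (u n x)).
  have h' := lim_nr_shift h.
  rewrite addrC -scaleN1r.
  have : lim_nr (fun m => -1 *: u (m + N)%N x + u n x) (-1 *: T x + u n x).
    by move=> d /h[K hK]; exists K => m Km; apply: hK; rewrite (leq_trans Km) ?leq_addr.
  move/lim_nr_le; apply => m; rewrite scaleN1r addrC; apply: hN => //.
  exact: leq_addl.
exists T => //; have [N hN] := key _ ltr01.
have [C C0 hC] := bop_bd (bu N).
apply: (@bop_intro _ _ _ (C + 1)) => //; first lra.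
move=> x; have -> : T x = u N x - (u N x - T x) by rewrite opprB addrC subrK.
exact: (opb_sub hC (hN N (leqnn N))).
Qed.

Lemma norm_seq_closure M (u : nat -> H -> H) T : bounded_op T ->
  (forall n, M (u n)) ->
  (forall e : R, 0 < e -> exists N, forall n, (N <= n)%N -> opb (fun x => u n x - T x) e) ->
  weak_closure M T.
Proof.
move=> bT Mu hu; apply: (strong_seq_closure bT Mu) => x e e0.
have n0 : 0 < nr x + 1 by have := nr_ge0 x; lra.
have [N hN] := hu _ (divr_gt0 e0 n0); exists N => n Nn.
apply: le_lt_trans (hN n Nn x) _; rewrite mulrAC ltr_pdivrMr // ltr_pM2l //; lra.
Qed.

(** [M] need not be closed: the partial sums of the Neumann series stay in [M], and the inverse of
    [1 - Z] is their norm limit. *)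
Lemma neumann M Z r : star_alg M -> M Z -> opb Z r -> 0 <= r -> r < 1 ->
  exists X, [/\ bounded_op X, (forall x, X (x - Z x) = x), (forall x, X x - Z (X x) = x)
    & forall e : R, 0 < e -> exists2 Y, M Y & opb (fun x => Y x - X x) e].
Proof.
move=> [bM M1 Ml Mm _] MZ hZ r0 r1.
have lZ := bop_lin (bM _ MZ).
(* Horner form of the partial sum [1 + Z + ... + Z^(n-1)]; hence [s (n + k) - s n = Z^n (s k)],
   which is of order [r^n]. *)
pose s := fix s n x := if n is m.+1 then x + Z (s m x) else 0.
have Ms n : M (s n).
  elim: n => [|n IH].
    have -> : s 0%N = (fun x => -1 *: id x + id x).
      by apply/funext => x /=; rewrite scaleN1r addNr.
    exact: Ml.
  have -> : s n.+1 = (fun x => 1 *: id x + (Z \o s n) x).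
    by apply/funext => x /=; rewrite scale1r.
  by apply: Ml => //; exact: Mm.
have ls n := bop_lin (bM _ (Ms n)).
have sZ n x : s n (Z x) = Z (s n x).
  by elim: n => [|n IH] /=; rewrite ?linop0 // IH [RHS]linopD.
have iterl n : linear (iter n Z).
  by elim: n => [//|n IH] k x y /=; rewrite IH lZ.
have sdiff n k x : s (n + k)%N x - s n x = iter n Z (s k x).
  elim: n => [|n IH]; first by rewrite subr0.
  by rewrite addSn /= -IH linopB // opprD addrACA subrr add0r.
have sbd k : opb (s k) (1 - r)^-1.
  have r2 : 0 < 1 - r by lra.
  elim: k => [|k IH] x /=; first by rewrite nr0 mulr_ge0 ?nr_ge0 // invr_ge0 ltW.
  apply: (le_trans (nrD _ _)).
  have h := le_trans (hZ (s k x)) (ler_wpM2l r0 (IH x)).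
  rewrite [leRHS](_ : _ = nr x + r * ((1 - r)^-1 * nr x)).
    by rewrite lerD2l.
  by field; rewrite gt_eqF.
have ibd n : opb (iter n Z) (r ^+ n).
  elim: n => [|n IH] x /=; first by rewrite expr0 mul1r.
  by apply: (le_trans (hZ _)); rewrite exprS -mulrA ler_wpM2l.
have cau (e : R) : 0 < e -> exists N, forall m n, (N <= m)%N -> (N <= n)%N ->
     opb (fun x => s m x - s n x) e.
  move=> e0; have r2 : 0 < 1 - r by lra.
  have [N hN] := expr_small r0 r1 (mulr_gt0 e0 r2); exists N.
  have wl m n : (N <= n)%N -> (n <= m)%N -> opb (fun x => s m x - s n x) e.
    move=> Nn nm x; rewrite -(subnKC nm) sdiff.
    apply: (le_trans (ibd _ _)).
    apply: (@le_trans _ _ (r ^+ n * ((1 - r)^-1 * nr x))).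
      by apply: ler_wpM2l; [exact: exprn_ge0|exact: sbd].
    rewrite mulrA; apply: ler_wpM2r; first exact: nr_ge0.
    by rewrite ler_pdivrMr // ltW // hN.
  move=> m n Nm Nn; have [nm|mn] := leqP n m; first exact: wl.
  by move=> x; rewrite nrB; apply: wl => //; exact: ltnW.
have [X bX hX] := norm_limit (fun n => bM _ (Ms n)) cau.
have limX x : lim_nr (fun n => s n x) (X x).
  move=> e e0; have n0 : 0 < nr x + 1 by have := nr_ge0 x; lra.
  have [N hN] := hX _ (divr_gt0 e0 n0); exists N => n Nn.
  by apply: le_lt_trans (hN n Nn x) _; rewrite mulrAC ltr_pdivrMr // ltr_pM2l //; lra.
have fin x : lim_nr (fun n => s n (x - Z x)) x.
  move=> e e0; have n0 : 0 < nr x + 1 by have := nr_ge0 x; lra.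
  have [N hN] := expr_small r0 r1 (divr_gt0 e0 n0); exists N => n Nn.
  have -> : s n (x - Z x) - x = - iter n Z x.
    rewrite linopB // sZ; elim: n {Nn} => [|n IH] /=.
      by rewrite linop0 // subr0 sub0r.
    rewrite -[RHS]linopN // -IH !linopB // linopD //.
    by rewrite addrAC [x + _]addrC addrK opprD addrA addrAC.
  rewrite nrN; apply: (le_lt_trans (ibd _ _)).
  have := hN n Nn; rewrite ltr_pdivlMr //.
  have := exprn_ge0 n r0; lra.
have eqX x : X (x - Z x) = x by exact: lim_nr_uniq (limX _) (fin x).
exists X; split=> //.
  move=> x; rewrite -[RHS]eqX [RHS]linopB; last exact: bop_lin.
  congr (_ - _); apply: lim_nr_uniq (limX (Z x)) => e e0.
  have [C C0 hC] := bop_bd (bM _ MZ).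
  have [N hN] := limX x _ (divr_gt0 e0 C0); exists N => n Nn.
  rewrite sZ -linopB //; apply: (le_lt_trans (hC _)).
  by rewrite mulrC -ltr_pdivlMr // hN.
move=> e e0; have [N hN] := hX _ e0.
by exists (s N) => //; exact: hN.
Qed.

End StarAlgebras.

(** * Inverses, resolvents and strong density *)

Section OperatorCalculus.
Context {R : realType} {H : hilbert R}.
Implicit Types (T S X Y Z : H -> H) (x y : H) (C r : R) (M : set (H -> H)).

Lemma norm_closure_weak M T : bounded_op T -> (forall T, M T -> bounded_op T) ->
  (forall e : R, 0 < e -> exists2 Y, M Y & opb (fun x => Y x - T x) e) ->
  weak_closure M T.
Proof.
move=> bT bM h.
have e0 n : 0 < n.+1%:R^-1 :> R by rewrite invr_gt0 ltr0n.
have /choice[u hu] : forall n : nat, exists Y, M Y /\ opb (fun x => Y x - T x) n.+1%:R^-1.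
  by move=> n; have [Y MY hY] := h _ (e0 n); exists Y.
apply: (@norm_seq_closure _ _ _ u) => // [n|e ee0]; first by case: (hu n).
have [N _ hN] := near_infty_natSinv_lt (PosNum ee0).
exists N => n Nn; apply: opb_le (proj2 (hu n)).
exact/ltW/(hN n Nn).
Qed.

(** For [c] above the norm of [T], the operator [Z = 1 - T / c] is positive and at most
    [1 - e / c < 1], so that [T / c = 1 - Z] has an inverse given by [neumann]. *)
Lemma positive_inverse M T (e : R) : star_alg M -> M T -> opos T -> 0 < e ->
  (forall x, e * nr x ^+ 2 <= rip (T x) x) ->
  exists X, [/\ bounded_op X, (forall x, X (T x) = x), (forall x, T (X x) = x)
    & forall e : R, 0 < e -> exists2 Y, M Y & opb (fun x => Y x - X x) e].
Proof.
move=> aM MT pT e0 hT; have [bM M1 Ml Mm Ms] := aM.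
have [c0 c00 hc0] := bop_bd (bM _ MT).
(* With the summand [e] the bound [1 - e / c] is strictly positive, as [opos_opb] requires. *)
pose c := c0 + e.
have cc : 0 < c by rewrite /c; lra.
have hc : opb T c by apply: opb_le hc0; rewrite /c; lra.
have lT := bop_lin (bM _ MT).
pose Z := fun x => (- c^-1)%:C%C *: T x + id x.
have MZ : M Z by exact: Ml.
have Zip x : dot H (Z x) x = (nr x ^+ 2 - c^-1 * rip (T x) x)%:C%C.
  by rewrite /Z ipDl ipZl opos_ip // ip_nr -rmorphM -rmorphD mulNr addrC.
have pZ : opos Z.
  move=> x; rewrite Zip ler0c subr_ge0 ler_pdivrMl //; exact: opb_rip.
have r0 : 0 <= 1 - c^-1 * e.
  rewrite subr_ge0 ler_pdivrMl // mulr1 /c; lra.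
have r1 : 1 - c^-1 * e < 1.
  by rewrite gtrDl oppr_lt0 mulr_gt0 // invr_gt0.
have rpos : 0 < 1 - c^-1 * e.
  rewrite subr_gt0 ltr_pdivrMl // mulr1 /c; lra.
have hZ : opb Z (1 - c^-1 * e).
  apply: opos_opb => //; first exact: bop_lin (bM _ MZ).
  move=> x; rewrite /rip Zip /= mulrBl mul1r lerD2l lerN2 -mulrA ler_pM2l ?invr_gt0 //.
have [X [bX X1 X2 aX]] := neumann aM MZ hZ r0 r1.
have ZE x : x - Z x = (c^-1)%:C%C *: T x.
  by rewrite /Z rmorphN scaleNr opprD opprK /= addrC addrNK.
have cN : (c^-1)%:C%C * c%:C%C = 1 :> R[i] by rewrite -rmorphM mulVf ?gt_eqF.
have lX := bop_lin bX.
exists (fun x => (c^-1)%:C%C *: X x); split.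
- have := bop_lincomb (c^-1)%:C%C bX (bop_comp bX (bM _ (Ml (-1) _ _ M1 M1))).
  congr (bounded_op _); apply/funext => x /=.
  by rewrite scaleN1r addNr linop0 // addr0.
- by move=> x; rewrite -linopZ // -ZE X1.
- move=> x; rewrite linopZ //.
  have := X2 x; rewrite -{1}[X x]scale1r => h.
  by rewrite -ZE.
- move=> d d0; have [Y MY hY] := aX _ (mulr_gt0 d0 cc).
  exists (fun x => (c^-1)%:C%C *: Y x).
    have := Ml (c^-1)%:C%C Y _ MY (Ml (-1) _ _ M1 M1).
    congr M; apply/funext => x /=.
    by rewrite scaleN1r addNr addr0.
  have nc : normc (c^-1)%:C%C = c^-1 by rewrite normc_real ger0_norm // invr_ge0 ltW.
  move=> x; rewrite -scalerBr nrZ nc.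
  by rewrite ler_pdivrMl // mulrA [c * d]mulrC; exact: hY.
Qed.

(** [Q] is [(T - 'i t) (T^2 + t^2)^-1], whose denominator is at least [t^2]. The bound comes from
    [|(T + 'i t) y|^2 = |T y|^2 + t^2 |y|^2], valid because [T] is self-adjoint. *)
Lemma resolvent M T (t : R) : star_alg M -> M T -> adjoint_pair T T -> t != 0 ->
  exists Q, [/\ bounded_op Q, opb Q `|t|^-1,
     (forall x, Q (T x + (t%:C%C * 'i%C) *: x) = x),
     (forall x, T (Q x) + (t%:C%C * 'i%C) *: Q x = x)
    & forall e : R, 0 < e -> exists2 Y, M Y & opb (fun x => Y x - Q x) e].
Proof.
move=> aM MT sT t0; have [bM M1 Ml Mm Ms] := aM.
have lT := bop_lin (bM _ MT).
have t2 : 0 < t ^+ 2 by rewrite exprn_even_gt0.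
pose P := fun x => (t ^+ 2)%:C%C *: id x + (T \o T) x.
have MP : M P by apply: Ml => //; exact: Mm.
have lP := bop_lin (bM _ MP).
have Pip x : dot H (P x) x = (t ^+ 2 * nr x ^+ 2 + nr (T x) ^+ 2)%:C%C.
  by rewrite /P ipDl ipZl /= sT !ip_nr -rmorphM -rmorphD.
have pP : opos P.
  by move=> x; rewrite Pip ler0c; apply: addr_ge0; [apply: mulr_ge0; exact: sqr_ge0|exact: sqr_ge0].
have [|X [bX X1 X2 aX]] := positive_inverse aM MP pP t2.
  by move=> x; rewrite /rip Pip /= lerDl sqr_ge0.
have lX := bop_lin bX.
set k : R[i] := t%:C%C * 'i%C.
have kk : k * - k = (t ^+ 2)%:C%C.
  by rewrite /k; apply/eqP; rewrite eq_complex /=; apply/andP; split; apply/eqP; ring.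
have TX x : X (T x) = T (X x).
  rewrite -{1}[x]X2 /P /= linopD // linopZ //= -[_ *: T _ + _]/(P (T (X x))).
  by rewrite X1.
pose Q := fun x => (- k) *: X x + (T \o X) x.
have bQ : bounded_op Q by apply: bop_lincomb => //; apply: bop_comp => //; exact: bM.
have Q1 x : T (Q x) + k *: Q x = x.
  rewrite /Q /= (linopD _ _ lT) (linopZ _ _ lT) scalerDr scalerA kk -[RHS]X2 /P /=.
  by rewrite scaleNr addrC addrA addrK.
have Q2 x : Q (T x + k *: x) = x.
  rewrite (linopD _ _ (bop_lin bQ)) (linopZ _ _ (bop_lin bQ)).
  rewrite -[RHS]Q1; congr (_ + _).
  by rewrite /Q /= TX linopD // linopZ.
exists Q; split=> //.
- move=> x.
  have : t ^+ 2 * nr (Q x) ^+ 2 <= nr x ^+ 2.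
    rewrite -{2}[x]Q1.
    have -> : nr (T (Q x) + k *: Q x) ^+ 2 = nr (T (Q x)) ^+ 2 + t ^+ 2 * nr (Q x) ^+ 2.
      move: (Q x) => q; rewrite !nr_sqr !(ripDl, ripDr) -!nr_sqr nrZ.
      have -> : normc k = `|t|.
        by rewrite /k normcM normc_real /= expr0n /= add0r expr1n sqrtr1 mulr1.
      rewrite exprMn real_normK ?num_real //.
      have -> : rip (k *: q) (T q) = - rip (T q) (k *: q).
        rewrite /rip ipZl ipZr -sT sa_rip // /k; set a := rip _ _; rewrite /=; ring.
      by ring.
    by rewrite lerDr sqr_ge0.
  rewrite -[t ^+ 2]real_normK ?num_real // -exprMn ler_sqr ?nnegrE ?mulr_ge0 ?nr_ge0 //.
  by rewrite ler_pdivlMl ?normr_gt0.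
- move=> e e0.
  have [C C0 hC] := bop_bd (bM _ MT).
  have p : 0 < normc (- k) + C by have := normc_ge0 (- k); lra.
  have [Y MY hY] := aX _ (divr_gt0 e0 p).
  exists (fun x => (- k) *: Y x + (T \o Y) x); first by apply: Ml => //; exact: Mm.
  move=> x; rewrite opprD addrACA -scalerBr /= -linopB //.
  apply: (le_trans (nrD _ _)); rewrite nrZ.
  have h1 := hC (Y x - X x).
  apply: (@le_trans _ _ ((normc (- k) + C) * nr (Y x - X x))); first lra.
  rewrite -ler_pdivlMl // mulrA [_^-1 * e]mulrC; exact: hY.
Qed.

(* A real subspace has the same weak and strong closure: the minimum of
   [sum_i |T x_i - L v x_i|^2] over [v] in [D] is zero. *)
Lemma strong_density (V : lmodType R[i]) (L : V -> H -> H) (D : set V) T :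
  D 0 -> (forall (r : R) v w, D v -> D w -> D (r%:C%C *: v + w)) ->
  (forall (r : R) v w x, D v -> D w -> L (r%:C%C *: v + w) x = r%:C%C *: L v x + L w x) ->
  (forall (s : seq (H * H)) (e : R), 0 < e -> exists2 v, D v &
     forall p, p \in s -> normc (dot H (T p.1) p.2 - dot H (L v p.1) p.2) < e) ->
  forall (xs : seq H) (e : R), 0 < e -> exists2 v, D v & forall x, x \in xs -> nr (T x - L v x) < e.
Proof.
move=> D0 Dlin Llin hw xs e e0.
pose X (i : 'I_(size xs)) := tnth (in_tuple xs) i.
have [|||||eta [cl heta]] := @riesz_family R V H _ (fun i v => L v (X i)) D
   (fun v => \sum_i rip (L v (X i)) (T (X i))) (\sum_i nr (T (X i)) ^+ 2).
- exact: D0.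
- exact: Dlin.
- by move=> i r v w; exact: Llin.
- move=> r v w Dv Dw; rewrite mulr_sumr -big_split; apply: eq_bigr => i _ /=.
  by rewrite Llin // ripDl ripZl.
- move=> v Dv; rewrite mulr_sumr -big_split; apply: ler_sum => i _ /=.
  have := sqr_ge0 (nr (T (X i) - L v (X i))).
  rewrite (nr_sqr (_ - _)) !(ripBl, ripBr) -!nr_sqr (ripC (T (X i))); lra.
pose d i := eta i - T (X i).
have hd v : D v -> \sum_i rip (L v (X i)) (d i) = 0.
  move=> Dv; under eq_bigr do rewrite ripBr.
  by rewrite sumrB heta // subrr.
(* By [hd] the vector [d] is orthogonal to all [L v]. Its square is therefore the pairing of [d]
   with [eta - L w] minus the pairing with [T - L v]: the first is small in norm, the second by weak
   approximation at the pairs [(X i, d i)]. *)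
have d0 : \sum_i nr (d i) ^+ 2 = 0.
  apply/le_anti; rewrite sumr_ge0 ?andbT => [|i _]; last exact: sqr_ge0.
  apply/ler_addgt0Pr => b b0; rewrite add0r.
  pose K : R := (size xs)%:R + \sum_i nr (d i) + 1.
  have sd : 0 <= \sum_i nr (d i) by apply: sumr_ge0 => i _; exact: nr_ge0.
  have n0 : 0 <= (size xs)%:R :> R by [].
  have K0 : 0 < K by rewrite /K; lra.
  have bK := divr_gt0 b0 K0.
  have [v Dv hv] := hw [seq (X i, d i) | i <- enum 'I_(size xs)] _ bK.
  have [w Dw hw'] := cl _ bK.
  have -> : \sum_i nr (d i) ^+ 2 = \sum_i rip (eta i - L w (X i)) (d i)
      - \sum_i rip (T (X i) - L v (X i)) (d i).
    have a : \sum_i rip (eta i - L w (X i)) (d i) = \sum_i rip (eta i) (d i).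
      by under eq_bigr do rewrite ripBl; rewrite sumrB hd // subr0.
    have b' : \sum_i rip (T (X i) - L v (X i)) (d i) = \sum_i rip (T (X i)) (d i).
      by under eq_bigr do rewrite ripBl; rewrite sumrB hd // subr0.
    rewrite a b' -sumrB; apply: eq_bigr => i _.
    by rewrite -ripBl nr_sqr.
  have h1 : \sum_i rip (eta i - L w (X i)) (d i) <= b / K * \sum_i nr (d i).
    rewrite mulr_sumr; apply: ler_sum => i _; apply: (le_trans (rip_le _ _)).
    by apply: ler_wpM2r; [exact: nr_ge0|rewrite nrB; exact/ltW].
  have h2 : - \sum_i rip (T (X i) - L v (X i)) (d i) <= b / K * (size xs)%:R.
    rewrite -sumrN (_ : _ * _ = \sum_(i < size xs) (b / K)); last first.
      by rewrite sumr_const card_ord mulr_natr.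
    apply: ler_sum => i _; rewrite -ripNl opprB.
    apply: (le_trans (Re_le_normc _)); rewrite ipBl normcB; apply/ltW.
    by apply: (hv (X i, d i)); apply/mapP; exists i => //; rewrite mem_enum.
  have h3 : b / K * K = b by rewrite divfK ?gt_eqF.
  have h4 : 0 < b / K * 1 by rewrite mulr1.
  move: h3; rewrite /K !mulrDr; lra.
have dz i : eta i = T (X i).
  move/eqP: d0; rewrite psumr_eq0 => [/allP /(_ i)|j _]; last exact: sqr_ge0.
  rewrite mem_index_enum => /(_ isT) /=; rewrite sqrf_eq0 nr_eq0 subr_eq0.
  by move/eqP.
have [v Dv hv] := cl e e0; exists v => // x /(tnthP (in_tuple xs))[i ->].
by rewrite nrB -dz; exact: hv.
Qed.

End OperatorCalculus.

Section SelfAdjointLimit.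
Context {R : realType} {H : hilbert R}.

Lemma lim_nr_ip (u : nat -> H) l y : lim_nr u l -> forall e : R, 0 < e ->
  exists N, forall n, (N <= n)%N -> normc (dot H (u n) y - dot H l y) < e.
Proof.
move=> hu e e0.
have y0 : 0 < nr y + 1 by have := nr_ge0 y; lra.
have [N hN] := hu _ (divr_gt0 e0 y0).
exists N => n /hN; rewrite -ipBl ltr_pdivlMr // => h.
apply: (le_lt_trans (ip_le _ _)); apply: le_lt_trans h.
have := nr_ge0 (u n - l); lra.
Qed.

Lemma normc_small (z : R[i]) : (forall e : R, 0 < e -> normc z <= e) -> z = 0.
Proof.
move=> h; apply/eqP; rewrite -normc_eq0; apply/eqP/le_anti; rewrite normc_ge0 andbT.
by apply/ler_addgt0Pr => e e0; rewrite add0r h.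
Qed.

Lemma lim_sa (Y : nat -> H -> H) (Z : H -> H) :
  (forall n, adjoint_pair (Y n) (Y n)) -> (forall x, lim_nr (fun n => Y n x) (Z x)) ->
  adjoint_pair Z Z.
Proof.
move=> sY hZ x y; apply/eqP; rewrite -subr_eq0; apply/eqP/normc_small => e e0.
have e2 : 0 < e / 2 by lra.
have [N hN] := lim_nr_ip y (hZ x) e2; have [N' hN'] := lim_nr_ip x (hZ y) e2.
have a := hN _ (leq_maxl N N'); have b := hN' _ (leq_maxr N N').
rewrite -(subrKA (dot H (Y (maxn N N') x) y)).
apply: (le_trans (le_normcD _ _)); rewrite normcB.
move: b; rewrite (ipC x (Y _ y)) (ipC x (Z y)) -rmorphB normc_conj -sY; lra.
Qed.

End SelfAdjointLimit.

(** * Square roots of positive operators *)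

Section SquareRoot.
Context {R : realType} {H : hilbert R}.
Implicit Types (T S : H -> H) (x y : H) (l : seq (R * nat)).

(** Polynomials in [S] are kept as lists of pairs (coefficient, exponent). Nonnegative coefficients
    pass to products, and for positive [S] they make the operator positive; positivity of a product
    of commuting positive operators is thus avoided. *)
Let ev S l x := \sum_(p <- l) p.1%:C%C *: iter p.2 S x.
Let half_mul l l' := [seq (p.1 * q.1 / 2, (p.2 + q.2)%N) | p <- l, q <- l'].
Let pos_coef l := all (fun p => 0 <= p.1) l.

Let linear_iter S n : linear S -> linear (iter n S).
Proof. by move=> lS; elim: n => [//|n IH] k x y /=; rewrite IH lS. Qed.

Let ev_linear S l : linear S -> linear (ev S l).
Proof.
move=> lS k x y; rewrite /ev scaler_sumr -big_split; apply: eq_bigr => p _ /=.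
by rewrite linear_iter // scalerDr !scalerA mulrC.
Qed.

Let ev_cat S l l' x : ev S (l ++ l') x = ev S l x + ev S l' x.
Proof. by rewrite /ev big_cat. Qed.

Let ev_half_mul S l l' x : linear S ->
  ev S (half_mul l l') x = (2^-1)%:C%C *: ev S l (ev S l' x).
Proof.
move=> lS; rewrite /ev big_allpairs_dep scaler_sumr; apply: eq_bigr => p _.
rewrite (linop_sum _ _ (linear_iter _ lS)) !scaler_sumr; apply: eq_bigr => q _ /=.
rewrite (linopZ _ _ (linear_iter _ lS)) iterD !scalerA -!rmorphM.
by congr (_ *: _); congr (_%:C%C); ring.
Qed.

Let pos_half_mul l l' : pos_coef l -> pos_coef l' -> pos_coef (half_mul l l').
Proof.
move=> /allP h /allP h'; apply/allP => _ /allpairsP[[p q] [pl ql ->]] /=.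
by rewrite divr_ge0 // mulr_ge0 //; [exact: h|exact: h'].
Qed.

Let ev_comm S l l' x : linear S -> ev S l (ev S l' x) = ev S l' (ev S l x).
Proof.
move=> lS; rewrite /ev.
under eq_bigr => p _.
  rewrite (linop_sum _ _ (linear_iter _ lS)) scaler_sumr; over.
rewrite exchange_big; apply: eq_bigr => q _ /=.
rewrite (linop_sum _ _ (linear_iter _ lS)) scaler_sumr; apply: eq_bigr => p _.
by rewrite !(linopZ _ _ (linear_iter _ lS)) !scalerA mulrC -!iterD addnC.
Qed.

(** [dot H (S^(n+2) x) x] equals [dot H (S^n (S x)) (S x)]; the induction advances by two and
    carries two consecutive exponents. *)
Let opos_iter S n : linear S -> opos S -> opos (iter n S).
Proof.
move=> lS pS; have sS := opos_sa lS pS.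
suff [] : opos (iter n S) /\ opos (iter n.+1 S) by [].
elim: n => [|n [IH1 IH2]]; first by split=> // x /=; rewrite ip_nr ler0c sqr_ge0.
by split=> // x; rewrite iterS iterSr sS; exact: IH1.
Qed.

Let opos_ev S l : linear S -> opos S -> pos_coef l -> opos (ev S l).
Proof.
move=> lS pS /allP hl x; rewrite /ev ip_suml big_seq; apply: sumr_ge0 => p pl.
rewrite ipZl mulr_ge0 //; last exact: opos_iter.
by rewrite ler0c; exact: hl.
Qed.

(* [Y_0 = 0], [Y_{n+1} = (S + Y_n^2)/2] as polynomials in [S] with nonnegative
   coefficients; their increments also have nonnegative coefficients, so the
   sequence increases, and its limit [Y] satisfies [(1 - Y)^2 = 1 - S]. *)
Let yseq := fix yseq n := if n is m.+1 then (2^-1, 1%N) :: half_mul (yseq m) (yseq m) else [::].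
Let dseq := fix dseq n := if n is m.+1 then half_mul (yseq m.+1 ++ yseq m) (dseq m) else yseq 1%N.

Let pos_yseq n : pos_coef (yseq n).
Proof. by elim: n => [//|n IH] /=; apply/andP; split; [rewrite /= invr_ge0|exact: pos_half_mul]. Qed.

Let pos_dseq n : pos_coef (dseq n).
Proof.
elim: n => [|n IH]; first exact: (pos_yseq 1).
apply: pos_half_mul => //; rewrite /pos_coef all_cat; apply/andP; split; [exact: (pos_yseq n.+1)|exact: pos_yseq].
Qed.

Let ev_yseqS S n x : linear S ->
  ev S (yseq n.+1) x = (2^-1)%:C%C *: (S x + ev S (yseq n) (ev S (yseq n) x)).
Proof. by move=> lS; rewrite {1}/ev big_cons /= -/(ev _ _ _) ev_half_mul // scalerDr. Qed.

(** The recursion of [dseq] is [Y_{n+2} - Y_{n+1} = (Y_{n+1} + Y_n) (Y_{n+1} - Y_n) / 2], where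
    polynomials in [S] commute. *)
Let ev_dseq S n x : linear S ->
  ev S (dseq n) x = ev S (yseq n.+1) x - ev S (yseq n) x.
Proof.
move=> lS; elim: n x => [|n IH] x.
  by rewrite [X in _ - X]/ev /= big_nil subr0.
rewrite (_ : dseq n.+1 = half_mul (yseq n.+1 ++ yseq n) (dseq n)) //.
rewrite ev_half_mul // ev_cat IH !(linopB _ _ (ev_linear _ lS)).
rewrite [X in _ = X - _](ev_yseqS n.+1 x lS) [X in _ = _ - X](ev_yseqS n x lS) -scalerBr.
congr (_ *: _); rewrite (ev_comm (yseq n.+1) (yseq n)) //.
by rewrite [in RHS]opprD [RHS]addrACA subrr add0r subrKA.
Qed.

Lemma sqrt_contraction (M : set (H -> H)) S : star_alg M -> weak_closure M `<=` M ->
  M S -> opos S -> opb S 1 ->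
  exists Q, [/\ M Q, opos Q & forall x, Q (Q x) = x - S x].
Proof.
move=> [bM M1 Ml Mm Ms] wM MS pS hS; have lS := bop_lin (bM _ MS).
pose Y n := ev S (yseq n).
have lY n : linear (Y n) by exact: ev_linear.
have YS n x : Y n.+1 x = (2^-1)%:C%C *: (S x + Y n (Y n x)) by exact: ev_yseqS.
have M0 : M (fun=> 0).
  have -> : (fun=> 0) = (fun x : H => -1 *: id x + id x).
    by apply/funext => x /=; rewrite scaleN1r addNr.
  exact: Ml.
have MY n : M (Y n).
  elim: n => [|n IH].
    by have -> : Y 0%N = (fun=> 0) by apply/funext => x; rewrite /Y /ev big_nil.
  have -> : Y n.+1 = (fun x => (2^-1)%:C%C *: S x + ((2^-1)%:C%C *: (Y n \o Y n) x + (fun=> 0) x)).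
    by apply/funext => x; rewrite YS scalerDr addr0.
  by apply: (Ml) => //; apply: (Ml) => //; exact: Mm.
have bY n : opb (Y n) 1.
  elim: n => [|n IH] x; first by rewrite /Y /ev big_nil nr0 mul1r nr_ge0.
  rewrite YS nrZ normc_real ger0_norm ?invr_ge0 // mul1r ler_pdivrMl //.
  apply: (le_trans (nrD _ _)); have := hS x; have := IH x; have := IH (Y n x); lra.
pose q n x := rip (Y n x) x.
have dpos n k : opos (fun x => Y (n + k)%N x - Y n x).
  elim: k => [|k IH] x; first by rewrite addn0 subrr ip0l.
  rewrite -(subrKA (Y (n + k)%N x)) ipDl addr_ge0 // addnS -ev_dseq //.
  exact: opos_ev.
have qmono n k x : q n x <= q (n + k)%N x.
  by have := opos_rip x (dpos n k); rewrite ripBl subr_ge0.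
have qbd n x : q n x <= nr x ^+ 2 by have := opb_rip x (bY n); rewrite mul1r.
(* A difference [D] of two terms is positive and bounded by 2, so [|D x|^2 <= 2 rip (D x) x] by
   [opos_bd]; convergence of the increasing bounded sequence [q n x] thus forces that of the
   vectors. *)
have cauY x : cauchy_nr (fun n => Y n x).
  move=> e e0.
  pose E := range (fun n => q n x).
  have hE : has_sup E.
    split; first by exists (q 0%N x), 0%N.
    by exists (nr x ^+ 2) => _ [n _ <-].
  have e2 : 0 < e ^+ 2 / 2 by rewrite divr_gt0 ?exprn_gt0.
  have [_ [N _ <-] hN] := sup_adherent e2 hE.
  have wl n k : (N <= n)%N -> nr (Y (n + k)%N x - Y n x) < e.
    move=> Nn; rewrite -ltr_sqr ?nnegrE ?nr_ge0 ?(ltW e0) //.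
    have lD : linear (fun x => Y (n + k)%N x - Y n x).
      move=> a u v; rewrite lY (lY n) scalerBr opprD addrACA //.
    have := @opos_bd _ _ _ 2 x (ltr0n _ 2) lD (dpos n k).
    have h2 : opb (fun x => Y (n + k)%N x - Y n x) 2.
      by have := opb_sub (bY (n + k)%N) (bY n); rewrite -[1 + 1]/(2%:R).
    move=> /(_ (fun z => opb_rip z h2)); rewrite ripBl -/(q _ _) -/(q n x) => h3.
    have : q (n + k)%N x <= sup E by apply: ub_le_sup; [case: hE|exists (n + k)%N].
    have := qmono N (n - N)%N x; rewrite subnKC // => h4 h5.
    by apply: le_lt_trans h3 _; lra.
  exists N => m n Nm Nn; have [nm|mn] := leqP n m.
    by rewrite -(subnKC nm); exact: wl.
  by rewrite nrB -(subnKC (ltnW mn)); exact: wl.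
have /choice[Z hZ] x := cauchy_nr_lim (cauY x).
have lZ : linear Z.
  move=> k x y; apply: lim_nr_uniq (hZ _) _.
  have -> : (fun n => Y n (k *: x + y)) = (fun n => k *: Y n x + Y n y).
    by apply/funext => n; exact: lY.
  exact: lim_nr_lincomb.
have bZ : opb Z 1 by move=> x; apply: (lim_nr_le (hZ x)) => n; exact: bY.
have boZ : bounded_op Z by apply: (@bop_intro _ _ _ 1).
have MZ : M Z by apply: wM; apply: (strong_seq_closure boZ MY).
have ZE x : Z x = (2^-1)%:C%C *: (S x + Z (Z x)).
  apply: lim_nr_uniq (lim_nr_shift (hZ x)) _.
  have -> : (fun n => Y n.+1 x) = (fun n => (2^-1)%:C%C *: (S x + Y n (Y n x)) + 0).
    by apply/funext => n; rewrite YS addr0.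
  rewrite -[_ *: (S x + _)]addr0.
  apply: lim_nr_lincomb; last exact: lim_nr_cst.
  move=> e e0; have e2 : 0 < e / 2 by lra.
  have [N hN] := hZ x _ e2; have [N' hN'] := hZ (Z x) _ e2.
  exists (maxn N N') => n; rewrite geq_max => /andP[/hN a /hN' b].
  rewrite opprD addrACA subrr add0r.
  apply: le_lt_trans (nr_tri _ (Y n (Z x)) _) _.
  have := bY n (Y n x - Z x); rewrite linopB // mul1r; lra.
pose Q := fun x => -1 *: Z x + id x.
exists Q; split.
- exact: Ml.
- have sZ : adjoint_pair Z Z.
    apply: (@lim_sa _ _ Y) hZ => n; apply: opos_sa => //; exact: opos_ev.
  move=> x; rewrite /Q ipDl ipZl /= sa_rip // ip_nr mulN1r addrC -rmorphB ler0c.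
  by rewrite subr_ge0; have := opb_rip x bZ; rewrite mul1r.
- move=> x; rewrite /Q /= !scaleN1r (linopD _ _ lZ) (linopN _ lZ).
  have h := ZE x.
  have h2 : S x = Z x + Z x - Z (Z x).
    have : 2%:C%C *: Z x = S x + Z (Z x).
      by rewrite {1}h scalerA -rmorphM mulfV // scale1r.
    by rewrite rmorph_nat scaler_nat mulr2n => ->; rewrite addrK.
  rewrite h2; move: (Z (Z x)) (Z x) => a b.
  by rewrite opprD opprK opprB opprD [RHS]addrC !addrA.
Qed.

(** [S = 1 - T / c] is a positive contraction; the root of [1 - S = T / c] is multiplied by the
    square root of [c]. *)
Lemma positive_sqrt (M : set (H -> H)) T : star_alg M -> weak_closure M `<=` M ->
  M T -> opos T -> exists Q, [/\ M Q, opos Q & forall x, Q (Q x) = T x].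
Proof.
move=> aM wM MT pT; have [bM M1 Ml Mm Ms] := aM.
have [c c0 hc] := bop_bd (bM _ MT); have lT := bop_lin (bM _ MT).
pose S := fun x => (- c^-1)%:C%C *: T x + id x.
have MS : M S by exact: Ml.
have Sip x : dot H (S x) x = (nr x ^+ 2 - c^-1 * rip (T x) x)%:C%C.
  by rewrite /S ipDl ipZl opos_ip // ip_nr -rmorphM -rmorphD mulNr addrC.
have pS : opos S.
  by move=> x; rewrite Sip ler0c subr_ge0 ler_pdivrMl //; exact: opb_rip.
have bS : opb S 1.
  apply: opos_opb => //; first exact: bop_lin (bM _ MS).
  move=> x; rewrite /rip Sip /= mul1r gerBl; apply: mulr_ge0; last exact: opos_rip.
  by rewrite invr_ge0 ltW.
have [Q [MQ pQ QQ]] := sqrt_contraction aM wM MS pS bS.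
have lQ := bop_lin (bM _ MQ).
have M0 : M (fun=> 0).
  have -> : (fun=> 0) = (fun x : H => -1 *: id x + id x).
    by apply/funext => x /=; rewrite scaleN1r addNr.
  exact: Ml.
exists (fun x => (Num.sqrt c)%:C%C *: Q x); split.
- have := Ml (Num.sqrt c)%:C%C Q _ MQ M0; congr M; apply/funext => x; exact: addr0.
- by move=> x; rewrite ipZl mulr_ge0 // ler0c sqrtr_ge0.
- move=> x; rewrite linopZ // scalerA -rmorphM -expr2 sqr_sqrtr ?ltW // QQ.
  rewrite /S opprD addrCA subrr addr0 rmorphN scaleNr opprK scalerA -rmorphM.
  by rewrite mulfV ?gt_eqF // scale1r.
Qed.

End SquareRoot.

(** * W*-algebras *)

Section UltraLimits.
Context {R : realType} {T : Type} (U : set_system T) {UU : UltraFilter U}.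
Implicit Types (f g : T -> R[i]) (z w : R[i]).

Definition ulim f z := forall e : R, 0 < e -> U [set c | normc (f c - z) < e].

Lemma ulim_uniq f z w : ulim f z -> ulim f w -> z = w.
Proof.
move=> hz hw; apply/eqP; rewrite -subr_eq0; apply/eqP/normc_small => e e0.
have e2 : 0 < e / 2 by lra.
have [c [/= h1 h2]] := filter_ex (filterI (hz _ e2) (hw _ e2)).
rewrite -(subrKA (f c)); apply: (le_trans (le_normcD _ _)).
by rewrite normcB; lra.
Qed.

Lemma ulim_cst z : ulim (fun=> z) z.
Proof. by move=> e e0; apply: filterE => c /=; rewrite subrr normc0. Qed.

Lemma ulim_ext f g z : (forall c, f c = g c) -> ulim f z -> ulim g z.
Proof. by move=> /funext ->. Qed.

Lemma ulim_lincomb f g z w k : ulim f z -> ulim g w ->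
  ulim (fun c => k * f c + g c) (k * z + w).
Proof.
move=> hf hg e e0.
have k0 := normc_ge0 k; have p : 0 < 2 * (normc k + 1) by lra.
have e1 := divr_gt0 e0 p; have e2 : 0 < e / 2 by lra.
apply: filterS (filterI (hf _ e1) (hg _ e2)) => c [/= h1 h2].
rewrite opprD addrACA -mulrBr; apply: le_lt_trans (le_normcD _ _) _; rewrite normcM.
move: h1; rewrite ltr_pdivlMr // => h1.
have := normc_ge0 (f c - z); lra.
Qed.

Lemma ulim_bd f z C : ulim f z -> U [set c | normc (f c) <= C] -> normc z <= C.
Proof.
move=> h hC; apply/ler_addgt0Pr => e e0.
have [c [/= h1 h2]] := filter_ex (filterI (h _ e0) hC).
have -> : z = f c - (f c - z) by rewrite opprB addrC subrK.
by apply: (le_trans (le_normcD _ _)); rewrite normcN; lra.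
Qed.

Lemma ulim_mul f g z w : ulim f z -> ulim g w -> ulim (fun c => f c * g c) (z * w).
Proof.
move=> hf hg e e0.
have z0 := normc_ge0 z; have w0 := normc_ge0 w.
have p : 0 < normc z + normc w + 1 by lra.
pose d := Num.min 1 (e / (normc z + normc w + 1)).
have d0 : 0 < d by rewrite lt_min ltr01 divr_gt0.
apply: filterS (filterI (hf _ d0) (hg _ d0)) => c [/= h1 h2].
have -> : f c * g c - z * w = (f c - z) * (g c - w) + (z * (g c - w) + (f c - z) * w) by ring.
apply: le_lt_trans (le_normcD _ _) _.
have := le_normcD (z * (g c - w)) ((f c - z) * w); rewrite !normcM.
set a := normc (f c - z) in h1 *; set b := normc (g c - w) in h2 *.
have a0 : 0 <= a := normc_ge0 _; have b0 : 0 <= b := normc_ge0 _.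
have d1 : d <= 1 by rewrite ge_min lexx.
have d2 : d * (normc z + normc w + 1) <= e by rewrite -ler_pdivlMr // ge_min lexx orbT.
have h3 : a * b <= d * 1 by apply: ler_pM => //; lra.
have h4 : normc z * b <= normc z * d by apply: ler_wpM2l => //; exact: ltW.
have h5 : a * normc w <= d * normc w by apply: ler_wpM2r => //; exact: ltW.
have : a * b < d.
  have [->|bn] := eqVneq b 0; first by rewrite mulr0.
  by apply: (@lt_le_trans _ _ (d * b)); [rewrite ltr_pM2r // lt_neqAle eq_sym bn|rewrite -[leRHS]mulr1 ler_wpM2l // ltW // (lt_le_trans h2)].
lra.
Qed.

Lemma ulim_ge0 f z : ulim f z -> U [set c | 0 <= f c] -> 0 <= z.
Proof.
move=> h hU.
have zr : z = (complex.Re z)%:C%C.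
  apply/eqP; rewrite -subr_eq0; apply/eqP/normc_small => e e0.
  have [c [/= h1 h2]] := filter_ex (filterI (h _ e0) hU).
  rewrite (ge0_complexE h2) in h1; apply: le_trans (ltW h1).
  rewrite -ler_sqr ?nnegrE ?normc_ge0 // !normc_sqr.
  case: (z) => a b /=; rewrite subrr expr0n /= add0r subr0 sub0r sqrrN.
  by rewrite lerDr sqr_ge0.
rewrite zr ler0c; apply/ler_addgt0Pr => e e0.
have [c [/= h1 h2]] := filter_ex (filterI (h _ e0) hU).
have := Re_le_normc (f c - z); rewrite cReB; move: h2; rewrite ge0cE => /andP[_].
lra.
Qed.

(** The limit is the supremum of the [r] such that [r <= f] on a set of [U]. If [f < sup E + e]
    failed to hold on a set of [U], the complement would be in [U] and [sup E + e] would belong to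
    [E]. *)
Lemma ulim_real (f : T -> R) C : U [set c | `|f c| <= C] ->
  exists l, forall e : R, 0 < e -> U [set c | `|f c - l| < e].
Proof.
move=> hC; pose E := [set r | U [set c | r <= f c]].
have EC : E (- C) by apply: filterS hC => c /=; rewrite ler_norml => /andP[].
have hE : has_sup E.
  split; first by exists (- C).
  exists C => r Er; have [c [/= h1 h2]] := filter_ex (filterI Er hC).
  by apply: (le_trans h1); move: h2; rewrite ler_norml => /andP[].
exists (sup E) => e e0.
have [r Er hr] := sup_adherent e0 hE.
have : U [set c | f c < sup E + e].
  have [h|] := in_ultra_setVsetC [set c | f c < sup E + e] UU; first exact: h.
  rewrite (_ : ~` _ = [set c | sup E + e <= f c]); last first.
    by apply/seteqP; split=> c /=; rewrite leNgt => /negP.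
  move=> h; exfalso; have := ub_le_sup (proj2 hE) h; lra.
move=> h; apply: filterS (filterI Er h) => c [/= h1 h2].
by rewrite ltr_norml; apply/andP; split; lra.
Qed.

Lemma ulim_ex f C : U [set c | normc (f c) <= C] -> exists z, ulim f z.
Proof.
move=> hC.
have [|a ha] := @ulim_real (fun c => complex.Re (f c)) C.
  apply: filterS hC => c /=; apply: le_trans.
  by rewrite -lecR -normcEn; exact: normc_ge_Re.
have [|b hb] := @ulim_real (fun c => complex.Im (f c)) C.
  apply: filterS hC => c /=; apply: le_trans.
  rewrite -ler_sqr ?nnegrE ?normc_ge0 // real_normK ?num_real // normc_sqr.
  by rewrite lerDr sqr_ge0.
exists (Complex a b) => e e0.
have e2 : 0 < e / 2 by lra.
apply: filterS (filterI (ha _ e2) (hb _ e2)) => c [/= h1 h2].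
have -> : f c - Complex a b = (complex.Re (f c) - a)%:C%C + 'i%C * (complex.Im (f c) - b)%:C%C.
  case: (f c) => x y; apply/eqP; rewrite eq_complex /=.
  by apply/andP; split; apply/eqP; ring.
apply: le_lt_trans (le_normcD _ _) _; rewrite normcM !normc_real.
have -> : normc ('i%C : R[i]) = 1 by rewrite /= expr0n /= add0r expr1n sqrtr1.
lra.
Qed.

End UltraLimits.

(** Upper bounds are asked only for nonempty chains, since the suprema of [chain_sup] exist only for
    these; a given point of [Q] bounds the empty chain. *)
Lemma zorn_set (T : Type) (Q : set T) (le : T -> T -> Prop) :
  (forall x, le x x) -> (forall x y z, le x y -> le y z -> le x z) ->
  (forall x y, le x y -> le y x -> x = y) ->
  (forall C : set T, C `<=` Q -> C !=set0 -> (forall x y, C x -> C y -> le x y \/ le y x) ->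
     exists2 t, Q t & forall x, C x -> le x t) ->
  Q !=set0 -> exists2 t, Q t & forall s, Q s -> le t s -> s = t.
Proof.
move=> lxx ltr las chain [q0 Qq0].
pose S := {x : T | Q x}.
have Sinj (a b : S) : sval a = sval b -> a = b.
  by case: a b => a ha [b hb] /= e; subst b; congr exist; exact: Prop_irrelevance.
have [||||[t Qt] ht] := @Zorn S (fun a b => `[< le (sval a) (sval b) >]).
- by move=> a; apply/asboolP.
- by move=> a b c /asboolP h /asboolP h'; apply/asboolP; exact: ltr h h'.
- by move=> a b /asboolP h /asboolP h'; apply: Sinj; exact: las.
- move=> A tA.
  have [[a Aa]|/forallNP An] := pselect (exists a, A a); last first.
    by exists (exist _ q0 Qq0) => s As; have := An s.
  have [| | |t Qt ht] := chain [set x | exists2 s, A s & sval s = x].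
  + by move=> _ [s _ <-]; exact: svalP.
  + by exists (sval a), a.
  + move=> _ _ [s As <-] [r Ar <-].
    by have [/asboolP h|/asboolP h] := tA s r As Ar; [left|right].
  by exists (exist _ t Qt) => s As; apply/asboolP => /=; apply: ht; exists s.
exists t => // s Qs ts.
by have /(congr1 sval) := ht (exist _ s Qs) (asboolT ts).
Qed.

(** * Order, bounds, subalgebras and compact balls in a W*-algebra *)

Section WstarBasics.
Context {R : realType} {A : wstarAlgebra R}.
Implicit Types (a b c u : A) (k : R[i]) (D : set A) (C : R).
Local Notation "a ^@" := (@star R A a) (at level 2, format "a ^@").
Local Notation H := (wspace A).

Lemma rep_lin a : linear (rep a). Proof. by case: (rep_bounded a). Qed.

Lemma repD a b x : rep (a + b) x = rep a x + rep b x.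
Proof. by have := rep_linear 1 a b x; rewrite !scale1r. Qed.
Lemma rep0 x : rep (0 : A) x = 0.
Proof. by have := rep_linear (-1) (0 : A) 0 x; rewrite scaler0 addr0 scaleN1r addNr. Qed.
Lemma repZ k a x : rep (k *: a) x = k *: rep a x.
Proof. by have := rep_linear k a 0 x; rewrite addr0 rep0 addr0. Qed.
Lemma repN a x : rep (- a) x = - rep a x.
Proof. by rewrite -scaleN1r repZ scaleN1r. Qed.
Lemma repB a b x : rep (a - b) x = rep a x - rep b x.
Proof. by rewrite repD repN. Qed.

Lemma rep_eq a b : (forall x, rep a x = rep b x) -> a = b.
Proof. by move=> h; apply: rep_inj; apply/funext. Qed.

(** Adjoints are unique and [rep] is faithful, so identities for the star can be checked on inner
    products. *)
Lemma star_eq a b : adjoint_pair (rep a) (rep b) -> b = a^@.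
Proof. by move=> h; apply: rep_inj; apply: adj_uniq h (rep_star a). Qed.

Lemma starK a : a^@^@ = a.
Proof. by apply/esym/star_eq/adj_sym/rep_star. Qed.
Lemma starM a b : (a * b)^@ = b^@ * a^@.
Proof. by apply/esym/star_eq => x y; rewrite !rep_mul !rep_star. Qed.
Lemma starL k a b : (k *: a + b)^@ = k^*%C *: a^@ + b^@.
Proof.
apply/esym/star_eq => x y.
by rewrite !rep_linear ipDl ipDr ipZl ipZr conjcK !rep_star.
Qed.
Lemma star1 : (1 : A)^@ = 1.
Proof. by apply/esym/star_eq => x y; rewrite !rep_one. Qed.
Lemma star0 : (0 : A)^@ = 0.
Proof. by apply/esym/star_eq => x y; rewrite !rep0 ip0l ip0r. Qed.
Lemma starD a b : (a + b)^@ = a^@ + b^@.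
Proof. by have := starL 1 a b; rewrite conjc1 !scale1r. Qed.
Lemma starZ k a : (k *: a)^@ = k^*%C *: a^@.
Proof. by have := starL k a 0; rewrite star0 !addr0. Qed.
Lemma starN a : (- a)^@ = - a^@.
Proof. by rewrite -scaleN1r starZ rmorphN1 scaleN1r. Qed.
Lemma starB a b : (a - b)^@ = a^@ - b^@.
Proof. by rewrite starD starN. Qed.
Lemma star_sum (I : Type) (s : seq I) (F : I -> A) :
  (\sum_(i <- s) F i)^@ = \sum_(i <- s) (F i)^@.
Proof. by elim/big_ind2: _ => [|? ? ? ? <- <-|//]; rewrite ?star0 ?starD. Qed.

(** [A] carries no norm of its own; this stands for [norm a <= C]. *)
Definition abd a C := opb (rep a) C.

Lemma abd_ex a : exists2 C, 0 < C & abd a C.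
Proof. exact: bop_bd (rep_bounded a). Qed.

Lemma abdM a b C C' : 0 <= C -> abd a C -> abd b C' -> abd (a * b) (C * C').
Proof. by move=> C0 ha hb x; rewrite rep_mul; exact: opb_comp. Qed.
Lemma abdD a b C C' : abd a C -> abd b C' -> abd (a + b) (C + C').
Proof. by move=> ha hb x; rewrite repD; exact: opb_add. Qed.
Lemma abdN a C : abd a C -> abd (- a) C.
Proof. by move=> h x; rewrite repN nrN; exact: h. Qed.
Lemma abdB a b C C' : abd a C -> abd b C' -> abd (a - b) (C + C').
Proof. by move=> ha hb; apply: abdD => //; exact: abdN. Qed.

Lemma abd1 : abd 1 1. Proof. by move=> x; rewrite rep_one mul1r. Qed.

Lemma abd_star a C : 0 <= C -> abd a C -> abd a^@ C.
Proof.
move=> C0 ha x.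
have [->|t0] := eqVneq (rep a^@ x) 0; first by rewrite nr0 mulr_ge0 ?nr_ge0.
have nt : 0 < nr (rep a^@ x) by rewrite lt_neqAle nr_ge0 eq_sym nr_eq0 t0.
rewrite -(ler_pM2r nt) -expr2 nr_sqr /rip -rep_star.
apply: (le_trans (rip_le _ _)).
have := ler_wpM2r (nr_ge0 x) (ha (rep a^@ x)); lra.
Qed.

Definition apos a := opos (rep a).

Lemma apos_sa a : apos a -> a^@ = a.
Proof. by move=> h; apply/esym/star_eq; apply: opos_sa => //; exact: rep_lin. Qed.

Lemma apos_mulstar a : apos (a^@ * a).
Proof. by move=> x; rewrite rep_mul (adj_sym (rep_star a)) ip_nr ler0c sqr_ge0. Qed.

Lemma aposD a b : apos a -> apos b -> apos (a + b).
Proof. by move=> ha hb x; rewrite repD ipDl addr_ge0 ?ha ?hb. Qed.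

Lemma apos_conj a c : apos a -> apos (c^@ * a * c).
Proof. by move=> ha x; rewrite !rep_mul (adj_sym (rep_star c)); exact: ha. Qed.

Lemma aposZ (r : R) a : 0 <= r -> apos a -> apos (r%:C%C *: a).
Proof. by move=> r0 ha x; rewrite repZ ipZl mulr_ge0 ?ler0c. Qed.

Lemma apos0 : apos 0. Proof. by move=> x; rewrite rep0 ip0l. Qed.
Lemma apos1 : apos 1. Proof. by move=> x; rewrite rep_one ip_nr ler0c sqr_ge0. Qed.

Lemma apos_trans a b c : apos (b - a) -> apos (c - b) -> apos (c - a).
Proof. by move=> h h'; rewrite -(subrKA b); exact: aposD. Qed.

Lemma apos_bd a b C : 0 < C -> apos a -> apos (b - a) -> abd b C -> abd a C.
Proof.
move=> C0 pa pb hb; apply: opos_opb => //; first exact: rep_lin.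
move=> x; apply: le_trans (opb_rip x hb).
by have := opos_rip x pb; rewrite repB ripBl subr_ge0.
Qed.

Lemma apos_rip0 a x C : 0 < C -> apos a -> abd a C -> nr (rep a x) ^+ 2 <= C * rip (rep a x) x.
Proof.
by move=> C0 pa ha; apply: opos_bd => //; [exact: rep_lin|move=> y; exact: opb_rip].
Qed.

Lemma apos_anti a b : apos (a - b) -> apos (b - a) -> a = b.
Proof.
move=> h h'; apply/eqP; rewrite -subr_eq0; apply/eqP/rep_eq => x; rewrite rep0.
have [C C0 hC] := abd_ex (a - b).
have := apos_rip0 x C0 h hC.
have : rip (rep (a - b) x) x <= 0.
  by have := opos_rip x h'; rewrite -opprB repN ripNl oppr_ge0.
have := opos_rip x h => h1 h2.
have -> : rip (rep (a - b) x) x = 0 by apply/le_anti/andP.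
rewrite mulr0 => h3; apply/eqP; rewrite -nr_eq0 -sqrf_eq0.
by apply/eqP/le_anti; rewrite h3 sqr_ge0.
Qed.

Lemma star_mul_eq0 a : a^@ * a = 0 -> a = 0.
Proof.
move=> h; apply: rep_eq => x; rewrite rep0; apply: nr_eq0P.
apply/eqP; rewrite -sqrf_eq0 nr_sqr /rip rep_star.
by rewrite -rep_mul h rep0 ip0r.
Qed.

Lemma abd_apos a C : 0 <= C -> abd a C -> apos ((C ^+ 2)%:C%C *: 1 - a^@ * a).
Proof.
move=> C0 ha x; rewrite repB repZ rep_one rep_mul ipBl ipZl (adj_sym (rep_star a)) !ip_nr.
rewrite -rmorphM -rmorphB ler0c subr_ge0 -exprMn ler_sqr ?nnegrE ?mulr_ge0 ?nr_ge0 //.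
Qed.

Lemma apos_abd a C : 0 <= C -> apos ((C ^+ 2)%:C%C *: 1 - a^@ * a) -> abd a C.
Proof.
move=> C0 ha x; have := ha x.
rewrite repB repZ rep_one rep_mul ipBl ipZl (adj_sym (rep_star a)) !ip_nr.
by rewrite -rmorphM -rmorphB ler0c subr_ge0 -exprMn ler_sqr ?nnegrE ?mulr_ge0 ?nr_ge0.
Qed.

Lemma star_alg_rep D : star_subalgebra D -> star_alg (@rep R A @` D).
Proof.
move=> [D1 Dl Dm Ds]; split.
- by move=> _ [a _ <-]; exact: rep_bounded.
- by exists 1 => //; apply/funext => x; exact: rep_one.
- move=> k _ _ [a Da <-] [b Db <-]; exists (k *: a + b); first exact: Dl.
  by apply/funext => x; exact: rep_linear.
- move=> _ _ [a Da <-] [b Db <-]; exists (a * b); first exact: Dm.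
  by apply/funext => x; exact: rep_mul.
- move=> _ [a Da <-]; exists (rep a^@); last exact: rep_star.
  by exists a^@ => //; exact: Ds.
Qed.

Lemma wstar_setT : wstar_subalgebra [set: A].
Proof. by split; [split|exact: rep_closed]. Qed.

Section Subalgebra.
Variable D : set A.
Hypothesis sD : star_subalgebra D.
Let D1 : D 1. Proof. by case: sD. Qed.

Lemma sub_zero : D 0.
Proof. by case: sD => d1 dl _ _; have := dl (-1) 1 1 d1 d1; rewrite scaleN1r addNr. Qed.
Lemma sub_add a b : D a -> D b -> D (a + b).
Proof. by case: sD => d1 dl _ _ Da Db; have := dl 1 a b Da Db; rewrite scale1r. Qed.
Lemma sub_scale k a : D a -> D (k *: a).
Proof. by case: sD => d1 dl _ _ Da; have := dl k a 0 Da sub_zero; rewrite addr0. Qed.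
Lemma sub_opp a : D a -> D (- a).
Proof. by move=> Da; rewrite -scaleN1r; exact: sub_scale. Qed.
Lemma sub_sub a b : D a -> D b -> D (a - b).
Proof. by move=> Da Db; apply: sub_add => //; exact: sub_opp. Qed.
Lemma sub_mul a b : D a -> D b -> D (a * b).
Proof. by case: sD => _ _ + _; apply. Qed.
Lemma sub_star a : D a -> D a^@.
Proof. by case: sD => _ _ _; apply. Qed.
Lemma sub_one : D 1. Proof. exact: D1. Qed.
Lemma sub_sum (I : Type) (s : seq I) (F : I -> A) : (forall i, D (F i)) -> D (\sum_(i <- s) F i).
Proof.
by move=> h; elim/big_ind: _ => [|a b|//]; [exact: sub_zero|exact: sub_add].
Qed.

(** The resolvent of [rep a] is a norm limit of [rep D], hence lies in the weakly closed range of
    [rep]. The element [q] is found in [A] and need not belong to [D]. *)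
Lemma sub_resolvent a (t : R) : D a -> a^@ = a -> t != 0 ->
  exists q, [/\ abd q `|t|^-1, q * (a + (t%:C%C * 'i%C) *: 1) = 1,
     (a + (t%:C%C * 'i%C) *: 1) * q = 1
    & forall e : R, 0 < e -> exists2 b, D b & abd (b - q) e].
Proof.
move=> Da sa t0.
have sT : adjoint_pair (rep a) (rep a) by have := rep_star a; rewrite sa.
have Ma : (@rep R A @` D) (rep a) by exists a.
have [Q [bQ hQ Q1 Q2 aQ]] := resolvent (star_alg_rep sD) Ma sT t0.
have : weak_closure (@rep R A @` D) Q.
  by apply: norm_closure_weak => // _ [b _ <-]; exact: rep_bounded.
move/(weak_closure_mono (fun _ h => let: ex_intro2 b _ e := h in ex_intro2 _ _ b I e)).
move=> /rep_closed[q _ qQ]; exists q; split.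
- by rewrite /abd qQ.
- apply: rep_eq => x.
  by rewrite rep_mul repD repZ !rep_one qQ Q1.
- apply: rep_eq => x.
  by rewrite rep_mul repD repZ !rep_one qQ Q2.
- move=> e /aQ[_ [b Db <-] hb]; exists b => // x.
  by rewrite repB qQ; exact: hb.
Qed.

End Subalgebra.

Section WSubalgebra.
Variable D : set A.
Hypothesis wD : wstar_subalgebra D.
Let sD : star_subalgebra D. Proof. by case: wD. Qed.

Lemma wsub_closed T : weak_closure (@rep R A @` D) T -> exists2 a, D a & rep a = T.
Proof. by case: wD => _ /[apply] -[a Da <-]; exists a. Qed.

Lemma wsub_sqrt a : D a -> apos a -> exists c, [/\ D c, apos c & c * c = a].
Proof.
move=> Da pa.
have Ma : (@rep R A @` D) (rep a) by exists a.
have [_ [[c Dc <-] pc cc]] := positive_sqrt (star_alg_rep sD) (proj2 wD) Ma pa.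
by exists c; split=> //; apply: rep_eq => x; rewrite rep_mul.
Qed.

(** A positive operator of [D] has its square root in [D], because [D] is weakly closed. Positivity
    is therefore the same in all W*-subalgebras and in the representation. *)
Lemma pos_inP a : D a -> pos_in D a <-> apos a.
Proof.
move=> Da; split=> [[c Dc ->]|/(wsub_sqrt Da)[c [Dc pc <-]]].
  exact: apos_mulstar.
by exists c => //; rewrite apos_sa.
Qed.

Lemma wsub_inv a (e : R) : D a -> apos a -> 0 < e ->
  (forall x, e * nr x ^+ 2 <= rip (rep a x) x) -> exists b, [/\ D b, a * b = 1 & b * a = 1].
Proof.
move=> Da pa e0 he.
have Ma : (@rep R A @` D) (rep a) by exists a.
have [X [bX X1 X2 aX]] := positive_inverse (star_alg_rep sD) Ma pa e0 he.
have [|b Db bX'] := @wsub_closed X.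
  by apply: norm_closure_weak => // _ [b _ <-]; exact: rep_bounded.
exists b; split=> //; apply: rep_eq => x.
  by rewrite rep_mul rep_one bX' X2.
by rewrite rep_mul rep_one bX' X1.
Qed.

Lemma wsub_limit (u : nat -> A) : (forall n, D (u n)) ->
  (forall e : R, 0 < e -> exists N, forall m n, (N <= m)%N -> (N <= n)%N -> abd (u m - u n) e) ->
  exists2 a, D a & forall e : R, 0 < e -> exists N, forall n, (N <= n)%N -> abd (u n - a) e.
Proof.
move=> Du cu.
have [||T bT hT] := @norm_limit R H (fun n => rep (u n)).
- by move=> n; exact: rep_bounded.
- move=> e /cu[N hN]; exists N => m n Nm Nn x.
  by have := hN m n Nm Nn x; rewrite repB.
have [|a Da aT] := @wsub_closed T.
  by apply: (norm_seq_closure bT _ hT) => n; exists (u n).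
exists a => // e /hT[N hN]; exists N => n Nn x.
by rewrite repB aT; exact: hN.
Qed.

End WSubalgebra.

(** Weak compactness of balls. The limits of the matrix coefficients along [U] form a bounded
    sesquilinear form; its operator is a weak limit of elements of [rep A], so it comes from [A]. *)
Lemma ball_compact (U : set_system A) (UU : UltraFilter U) C : 0 <= C ->
  U [set c | abd c C] ->
  exists2 a, abd a C & forall x y, ulim U (fun c => dot H (rep c x) y) (dot H (rep a x) y).
Proof.
move=> C0 hU.
have bd x y : U [set c | normc (dot H (rep c x) y) <= C * (nr x * nr y)].
  apply: filterS hU => c /= hc; apply: (le_trans (ip_le _ _)).
  by rewrite mulrA; apply: ler_wpM2r; [exact: nr_ge0|exact: hc].
have /choice[be hbe] : forall p : H * H, exists z, ulim U (fun c => dot H (rep c p.1) p.2) z.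
  by move=> p; exact: ulim_ex (bd _ _).
have [||||||//|T [bT hT TE]] := @form_op R H H id setT (fun x y => be (x, y)) C C0.
- by [].
- by [].
- by [].
- by move=> x e e0; exists x => //; rewrite subrr nr0.
- move=> k v v' w _ _ _; apply: ulim_uniq (hbe _) _ => /=.
  apply: (ulim_ext (f := fun c => k * dot H (rep c v) w + dot H (rep c v') w)).
    by move=> c; rewrite rep_lin ipDl ipZl.
  exact: ulim_lincomb (hbe (v, w)) (hbe (v', w)).
- move=> k v w w' _ _ _; apply: ulim_uniq (hbe _) _ => /=.
  apply: (ulim_ext (f := fun c => conjc k * dot H (rep c v) w + dot H (rep c v) w')).
    by move=> c; rewrite ipDr ipZr.
  exact: ulim_lincomb (hbe (v, w)) (hbe (v, w')).
- by move=> v w _ _; exact: ulim_bd (hbe (v, w)) (bd v w).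
have : weak_closure (range (@rep R A)) T.
  apply/weak_closureP; split=> // s e e0.
  have : U [set c | forall v, v \in s -> normc (dot H (T v.1) v.2 - dot H (rep c v.1) v.2) < e].
    elim: s => [|v s IH]; first exact: filterE.
    have := hbe v e e0; rewrite [v]surjective_pairing -(TE _ _ I I) /= => h.
    apply: filterS (filterI h IH) => c [/= h1 h2] w.
    by rewrite inE => /orP[/eqP ->|]; [rewrite normcB|exact: h2].
  by move=> /filter_ex[c hc]; exists (rep c) => //; exists c.
move=> /rep_closed[a _ aT]; exists a; first by rewrite /abd aT.
by move=> x y; rewrite aT TE //; exact: (hbe (x, y)).
Qed.

(** The supremum is the weak limit along an ultrafilter containing the tails of the chain; [e]
    bounds the chain in norm. The last clause recovers the weak approximation, which being an upper
    bound does not contain. *)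
Lemma chain_sup (S : set A) e : S !=set0 -> (forall a, S a -> apos a) ->
  (forall a, S a -> apos (e - a)) ->
  (forall a b, S a -> S b -> apos (b - a) \/ apos (a - b)) ->
  exists s, [/\ forall a, S a -> apos (s - a),
     forall t, (forall a, S a -> apos (t - a)) -> apos (t - s)
   & forall x (r : R), 0 < r -> exists2 a, S a & rip (rep (s - a) x) x < r].
Proof.
move=> S0 pS Se tS.
have [C C0 eC] := abd_ex e.
pose F := filter_from S (fun a => [set b | S b /\ apos (b - a)]).
have FF : Filter F.
  apply: filter_from_filter => // a b Sa Sb.
  have [ab|ba] := tS a b Sa Sb; [exists b => //|exists a => //] => c [Sc h]; split; split=> //.
    exact: apos_trans ab h.
  exact: apos_trans ba h.
have PF : ProperFilter F.
  apply: filter_from_proper => a Sa; exists a; split=> //.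
  by rewrite subrr; exact: apos0.
have [U [UU FU]] := ultraFilterLemma PF.
have tail a : S a -> U [set b | S b /\ apos (b - a)].
  by move=> Sa; apply: FU; exists a.
have [|s hs ls] := @ball_compact U UU C (ltW C0).
  have [a Sa] := S0; apply: filterS (tail a Sa) => b [Sb _] /=.
  exact: apos_bd (pS _ Sb) (Se _ Sb) eC.
exists s; split.
- move=> a Sa x; apply: (@ulim_ge0 _ _ U UU (fun c => dot H (rep (c - a) x) x)).
    have := ulim_lincomb (UU := UU) (-1) (@ulim_cst _ _ U UU (dot H (rep a x) x)) (ls x x).
    rewrite mulN1r addrC -ipBl -repB; apply: ulim_ext => c.
    by rewrite addrC -ipBl -repB.
  by apply: filterS (tail a Sa) => b [_ h] /=; exact: h.
- move=> t ht x; apply: (@ulim_ge0 _ _ U UU (fun c => dot H (rep (t - c) x) x)).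
    have := ulim_lincomb (UU := UU) (-1) (ls x x) (@ulim_cst _ _ U UU (dot H (rep t x) x)).
    rewrite mulN1r addrC -ipBl -repB; apply: ulim_ext => c.
    by rewrite mulN1r addrC -ipBl -repB.
  have [a Sa] := S0; apply: filterS (tail a Sa) => b [Sb _] /=; exact: ht.
- move=> x r r0; have [a Sa] := S0.
  have [b [/= hb [Sb _]]] := filter_ex (filterI (ls x x r r0) (tail a Sa)).
  exists b => //; apply: le_lt_trans hb; rewrite normcB -ipBl -repB.
  exact: Re_le_normc.
Qed.

End WstarBasics.

(** * Normal functionals *)

Section NormalFunctionals.
Context {R : realType} {A : wstarAlgebra R}.
Implicit Types (a b c : A) (C : R) (psi : A -> R[i]).
Local Notation "a ^@" := (@star R A a) (at level 2, format "a ^@").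
Local Notation H := (wspace A).

Definition vfun (s : seq (H * H)) a := \sum_(v <- s) dot H (rep a v.1) v.2.

(* the norm closure of the weak operator continuous functionals *)
Definition nfun psi := forall e : R, 0 < e -> exists s : seq (H * H),
  forall a C, 0 <= C -> abd a C -> normc (psi a - vfun s a) <= e * C.

Lemma vfun_bd s : exists2 K, 0 <= K & forall a C, 0 <= C -> abd a C -> normc (vfun s a) <= K * C.
Proof.
exists (\sum_(v <- s) nr v.1 * nr v.2).
  by apply: sumr_ge0 => v _; rewrite mulr_ge0 ?nr_ge0.
move=> a C C0 ha; apply: (le_trans (normc_sum _ _)); rewrite mulr_suml.
apply: ler_sum => v _; apply: (le_trans (ip_le _ _)).
rewrite [_ * C]mulrC mulrA; apply: ler_wpM2r; [exact: nr_ge0|exact: ha].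
Qed.

Lemma nfun_bd psi : nfun psi -> exists2 K, 0 < K &
  forall a C, 0 <= C -> abd a C -> normc (psi a) <= K * C.
Proof.
move=> /(_ _ ltr01)[s hs]; have [K K0 hK] := vfun_bd s.
exists (K + 1) => [|a C C0 ha]; first lra.
rewrite -[psi a](subrK (vfun s a)); apply: (le_trans (le_normcD _ _)).
by have := hs a C C0 ha; have := hK a C C0 ha; lra.
Qed.

Lemma nfun_limit psi : (forall e : R, 0 < e -> exists2 psi', nfun psi' &
   forall a C, 0 <= C -> abd a C -> normc (psi a - psi' a) <= e * C) -> nfun psi.
Proof.
move=> h e e0; have e2 : 0 < e / 2 by lra.
have [psi' np hp] := h _ e2; have [s hs] := np _ e2; exists s => a C C0 ha.
rewrite -(subrKA (psi' a)); apply: (le_trans (le_normcD _ _)).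
by have := hp a C C0 ha; have := hs a C C0 ha; lra.
Qed.

Lemma nfun_vec x y : nfun (fun a => dot H (rep a x) y).
Proof.
move=> e e0; exists [:: (x, y)] => a C C0 _.
by rewrite /vfun big_seq1 subrr normc0 mulr_ge0 // ltW.
Qed.

Lemma nfun_add psi psi' : nfun psi -> nfun psi' -> nfun (fun a => psi a + psi' a).
Proof.
move=> h h' e e0; have e2 : 0 < e / 2 by lra.
have [s hs] := h _ e2; have [s' hs'] := h' _ e2; exists (s ++ s') => a C C0 ha.
rewrite /vfun big_cat opprD addrACA; apply: (le_trans (le_normcD _ _)).
by have := hs a C C0 ha; have := hs' a C C0 ha; rewrite /vfun; lra.
Qed.

Lemma nfun_mul psi b c : nfun psi -> nfun (fun a => psi (b * a * c)).
Proof.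
move=> h e e0; have [B B0 hB] := abd_ex b; have [C' C0' hC'] := abd_ex c.
have p : 0 < B * C' by rewrite mulr_gt0.
have [s hs] := h _ (divr_gt0 e0 p).
exists [seq (rep c v.1, rep b^@ v.2) | v <- s] => a C C0 ha.
rewrite /vfun big_map /=.
under eq_bigr do rewrite -rep_star -!rep_mul ?mulrA.
apply: le_trans (hs _ (B * C * C') _ _) _.
- by do !apply: mulr_ge0 => //; exact: ltW.
- apply: abdM => //; first by apply: mulr_ge0 => //; exact: ltW.
  by apply: abdM => //; exact: ltW.
- have -> : e / (B * C') * (B * C * C') = e / (B * C') * (B * C') * C by ring.
  by rewrite divfK ?gt_eqF.
Qed.

End NormalFunctionals.

(** * Positive functionals that are normal on chains *)

Section Weights.
Context {R : realType} {A : wstarAlgebra R}.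
Implicit Types (a b c : A) (C : R) (psi : A -> R[i]).
Local Notation "a ^@" := (@star R A a) (at level 2, format "a ^@").
Local Notation H := (wspace A).

Definition positive_functional (w : A -> R[i]) :=
  (forall k a b, w (k *: a + b) = k * w a + w b) /\ (forall a, apos a -> 0 <= w a).

(** Chains are the families that Zorn's lemma produces; they are directed, so normality along
    directed families implies this form. *)
Definition chain_normal (w : A -> R[i]) := forall (S : set A) s, S !=set0 ->
  (forall a, S a -> apos a) ->
  (forall a b, S a -> S b -> apos (b - a) \/ apos (a - b)) ->
  (forall a, S a -> apos (s - a)) ->
  (forall t, (forall a, S a -> apos (t - a)) -> apos (t - s)) ->
  forall c : R, (forall a, S a -> complex.Re (w a) <= c) -> complex.Re (w s) <= c.

Variable w : A -> R[i].
Hypothesis pw : positive_functional w.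
Let wl k a b : w (k *: a + b) = k * w a + w b. Proof. by case: pw. Qed.

Lemma pf0 : w 0 = 0.
Proof. by have := wl (-1) 0 0; rewrite scaler0 addr0 mulN1r addNr. Qed.
Lemma pfD a b : w (a + b) = w a + w b.
Proof. by have := wl 1 a b; rewrite scale1r mul1r. Qed.
Lemma pfZ k a : w (k *: a) = k * w a.
Proof. by have := wl k a 0; rewrite pf0 !addr0. Qed.
Lemma pfN a : w (- a) = - w a.
Proof. by rewrite -scaleN1r pfZ mulN1r. Qed.
Lemma pfB a b : w (a - b) = w a - w b.
Proof. by rewrite pfD pfN. Qed.
Lemma pf_ge0 a : apos a -> 0 <= w a. Proof. by case: pw => _; apply. Qed.
Lemma pf_Re_ge0 a : apos a -> 0 <= complex.Re (w a).
Proof. by move/pf_ge0; rewrite ge0cE => /andP[]. Qed.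
Lemma pf_Re a : apos a -> w a = (complex.Re (w a))%:C%C.
Proof. by move/pf_ge0/ge0_complexE. Qed.
Lemma pf_le a b : apos (b - a) -> complex.Re (w a) <= complex.Re (w b).
Proof. by move/pf_Re_ge0; rewrite pfB cReB subr_ge0. Qed.

(** Polarisation: [w] is real at [c^@ * c] for [c] equal to [a], [1], [a + 1] and [a + 'i *: 1]. *)
Lemma pf_star a : w a^@ = conjc (w a).
Proof.
have im c : complex.Im (w (c^@ * c)) = 0.
  by have := pf_ge0 (apos_mulstar c); rewrite ge0cE => /andP[/eqP].
have h1 := im (a + 1); have h2 := im (a + 'i%C *: 1).
have h3 := im a; have h4 := im 1.
move: h1 h2; rewrite !starD !starZ !star1.
rewrite !mulrDl !mulrDr !mul1r !mulr1 !pfD !cImD h3.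
rewrite -!scalerAl -!scalerAr !mul1r !mulr1 scalerA.
have -> : ('i%C^*%C * 'i%C : R[i]) = 1.
  by rewrite mulrC normc_mulJ /= expr0n /= add0r expr1n sqrtr1 expr1n.
rewrite scale1r.
have -> : w 1 = (complex.Re (w 1))%:C%C by exact: pf_Re apos1.
rewrite !pfZ; case: (w a) => x y; case: (w a^@) => x' y' /= h1 h2.
by congr Complex; lra.
Qed.

Lemma pf_cs a b : normc (w (b^@ * a)) ^+ 2 <=
  complex.Re (w (a^@ * a)) * complex.Re (w (b^@ * b)).
Proof.
set z := w (b^@ * a); set qa := complex.Re _; set qb := complex.Re _.
have qa0 : 0 <= qa by apply: pf_Re_ge0; exact: apos_mulstar.
have qb0 : 0 <= qb by apply: pf_Re_ge0; exact: apos_mulstar.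
have key (k : R[i]) : 0 <= normc k ^+ 2 * qa + 2 * complex.Re (k * z) + qb.
  have e1 : (k *: a + b)^@ * (k *: a + b) =
      (conjc k * k) *: (a^@ * a) + conjc k *: (a^@ * b) + (k *: (b^@ * a) + b^@ * b).
    by rewrite starL mulrDl !mulrDr -!scalerAl -!scalerAr scalerA.
  have e : w ((k *: a + b)^@ * (k *: a + b)) =
      (normc k ^+ 2 * qa)%:C%C + conjc (k * z) + (k * z + qb%:C%C).
    rewrite e1 !pfD !pfZ.
    have -> : w (a^@ * b) = conjc z by rewrite -[in LHS](starK b) -starM pf_star.
    rewrite -/z (pf_Re (apos_mulstar a)) (pf_Re (apos_mulstar b)) -/qa -/qb.
    have -> : conjc k * k = (normc k ^+ 2)%:C%C by rewrite mulrC normc_mulJ.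
    by rewrite -(rmorphM (real_complex R)) -(rmorphM (@conjc R)).
  have := pf_Re_ge0 (apos_mulstar (k *: a + b)).
  rewrite e !cReD cReJ => h.
  have : 0 <= normc k ^+ 2 * qa + complex.Re (k * z) + (complex.Re (k * z) + qb) := h.
  lra.
have nz := normc_ge0 z.
have [qa1|qa1] := eqVneq qa 0.
  rewrite qa1 mul0r.
  have [->|z0] := eqVneq z 0; first by rewrite normc0 expr0n.
  have nz0 : 0 < normc z by rewrite lt_neqAle nz eq_sym normc_eq0 z0.
  (* For [qa = 0] the inequality [key] is affine in [k], and this [k] would give [- qb - 2 >= 0]. *)
  have := key ((- (qb + 1))%:C%C * z^-1).
  by rewrite qa1 mulr0 add0r mulfVK //= => h; exfalso; lra.
have qa2 : 0 < qa by rewrite lt_neqAle eq_sym qa1.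
(* The minimum over [k] of the quadratic expression in [key]. *)
have := key ((- qa^-1)%:C%C * conjc z).
rewrite normcM normc_conj normc_real normrN ger0_norm ?invr_ge0 //.
rewrite -mulrA [conjc z * z]mulrC normc_mulJ -rmorphM /=.
set n := normc z.
have -> : (qa^-1 * n) ^+ 2 * qa + 2 * (- qa^-1 * n ^+ 2) + qb = qb - n ^+ 2 / qa by field.
by rewrite subr_ge0 ler_pdivrMr // mulrC.
Qed.

Lemma pf_mul_le a b C : 0 <= C -> abd a C ->
  complex.Re (w ((a * b)^@ * (a * b))) <= C ^+ 2 * complex.Re (w (b^@ * b)).
Proof.
move=> C0 ha; have := pf_Re_ge0 (apos_conj b (abd_apos C0 ha)).
rewrite mulrBr mulrBl -scalerAr mulr1 -scalerAl pfB pfZ cReB cReMr.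
by rewrite starM !mulrA; lra.
Qed.

Lemma pf_bd a b C : 0 <= C -> abd a C ->
  normc (w (a * b)) ^+ 2 <= C ^+ 2 * (complex.Re (w 1) * complex.Re (w (b^@ * b))).
Proof.
move=> C0 ha; rewrite -{1}[a]starK; apply: (le_trans (pf_cs _ _)).
have := pf_mul_le 1 C0 (abd_star C0 ha); rewrite !mulr1 star1 => h.
rewrite mulrC mulrA; apply: ler_wpM2r => //; apply: pf_Re_ge0; exact: apos_mulstar.
Qed.

Lemma apos_sub_sqr a : apos a -> apos (1 - a) -> apos (a - a * a).
Proof.
move=> pa p1 x.
have sa := rep_star a; rewrite apos_sa // in sa.
have h := apos_rip0 x ltr01 pa (apos_bd ltr01 pa p1 abd1).
rewrite repB ipBl rep_mul (sa (rep a x) x) opos_ip // ip_nr -rmorphB ler0c subr_ge0.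
by rewrite mul1r in h.
Qed.

Hypothesis nw : chain_normal w.

(* Zorn inside [0, e]: beyond a maximal [h] with [<h xi, xi> <= w h], the
   functional [w] is dominated by the vector functional of [xi]. *)
Lemma dominated_piece e : apos e -> apos (1 - e) -> e <> 0 ->
  exists k, [/\ apos k, apos (e - k), k <> 0 & nfun (fun a => w (a * k))].
Proof.
move=> pe p1e e0.
have [x hx] : exists x, 0 < rip (rep e x) x.
  apply: contrapT => /forallNP h; apply: e0.
  have [C C0 hC] := abd_ex e.
  apply: rep_eq => x; rewrite rep0; apply: nr_eq0P; apply/eqP; rewrite -sqrf_eq0.
  apply/eqP/le_anti; rewrite sqr_ge0 andbT.
  apply: le_trans (apos_rip0 x C0 pe hC) _.
  rewrite pmulr_rle0 // leNgt; apply/negP; exact: h.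
set r := rip (rep e x) x in hx.
(* The scale makes [rip (rep e xi) xi] equal to [Re (w e) + 1]; hence [e] is not in [Q], and the
   maximal [h1] differs from [e]. *)
pose tt : R := (complex.Re (w e) + 1) / r.
have we := pf_Re_ge0 pe.
have tt0 : 0 <= tt by rewrite divr_ge0 ?ltW //; lra.
pose xi := (Num.sqrt tt)%:C%C *: x.
have hxi : complex.Re (w e) < rip (rep e xi) xi.
  rewrite /xi (linopZ _ _ (rep_lin e)) ripZl ripZr mulrA -expr2 sqr_sqrtr // -/r.
  by rewrite /tt divfK ?gt_eqF //; lra.
pose Q := [set h | [/\ apos h, apos (e - h) & rip (rep h xi) xi <= complex.Re (w h)]].
have [|||||h1 [ph1 peh1 wh1] maxh1] := @zorn_set A Q (fun a b => apos (b - a)).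
- by move=> a; rewrite subrr; exact: apos0.
- by move=> a b c; exact: apos_trans.
- by move=> a b h h'; exact: apos_anti.
- move=> S SQ S0 tS.
  have pS a : S a -> apos a by move=> /SQ[].
  have eS a : S a -> apos (e - a) by move=> /SQ[].
  have [s [s1 s2 s3]] := chain_sup S0 pS eS tS.
  exists s => //; split.
  + have [a Sa] := S0; rewrite -[s](subrK a); apply: aposD; [exact: s1|exact: pS].
  + exact: s2.
  + apply/ler_addgt0Pr => d d0; have [a Sa ha] := s3 xi d d0.
    have [_ _ h] := SQ _ Sa; have := pf_le (s1 a Sa).
    by move: ha; rewrite repB ripBl; lra.
- exists 0; split; rewrite ?subr0 //; first exact: apos0.
  by rewrite rep0 rip0l pf0.
have [k kE] : exists k, k = e - h1 by exists (e - h1).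
have pk : apos k by rewrite kE.
have k0 : k <> 0.
  by rewrite kE => /eqP; rewrite subr_eq0 => /eqP ek; move: wh1; rewrite -ek leNgt hxi.
have pk1 : apos (1 - k).
  by rewrite kE opprB addrCA addrC; apply: aposD.
(* If [g <= k = e - h1] violated the inequality, [h1 + g] would be a larger member of [Q]. *)
have dom g : apos g -> apos (k - g) -> complex.Re (w g) <= rip (rep g xi) xi.
  move=> pg pkg; rewrite leNgt; apply/negP => hg.
  have gE : h1 + g = h1.
    apply: maxh1; last by rewrite addrC addKr.
    split; first exact: aposD.
      by rewrite opprD addrA -kE.
    by rewrite repD ripDl pfD cReD; lra.
  have g0 : g = 0 by apply: (addrI h1); rewrite addr0.
  by move: hg; rewrite g0 rep0 rip0l pf0 ltxx.
have sk : k^@ = k by exact: apos_sa.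
(* [k a^@ a k <= C^2 k^2 <= C^2 k] since [0 <= k <= 1]; so [dom] applies after division by [C^2],
   and the factor cancels. *)
have dom2 a : complex.Re (w ((a * k)^@ * (a * k))) <= nr (rep a (rep k xi)) ^+ 2.
  have [C C0 hC] := abd_ex a.
  have i0 : 0 <= (C ^+ 2)^-1 by rewrite invr_ge0 sqr_ge0.
  pose g := ((C ^+ 2)^-1)%:C%C *: ((a * k)^@ * (a * k)).
  have pg : apos g by apply: aposZ => //; exact: apos_mulstar.
  have pkg : apos (k - g).
    have -> : k - g = (k - k * k) + ((C ^+ 2)^-1)%:C%C *: (k^@ * ((C ^+ 2)%:C%C *: 1 - a^@ * a) * k).
      rewrite sk mulrBr mulrBl scalerBr -scalerAr mulr1 -scalerAl scalerA -rmorphM mulVf; last first.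
        by rewrite expf_neq0 // gt_eqF.
      by rewrite scale1r addrA subrK /g starM sk !mulrA.
    apply: aposD; first exact: apos_sub_sqr.
    by apply: aposZ => //; apply: apos_conj; apply: abd_apos => //; exact: ltW.
  have := dom g pg pkg; rewrite /g pfZ cReMr repZ ripZl ler_pM2l ?invr_gt0 ?exprn_gt0 //.
  by rewrite rep_mul nr_sqr [X in _ <= X -> _]/rip (adj_sym (rep_star _)) rep_mul.
exists k; split=> //; first by rewrite kE opprB addrC subrK.
have w1 := pf_Re_ge0 apos1.
(* By [dom2], [w (a * k)] is at most a constant times [|rep a (rep k xi)|]; representing it on these
   vectors makes it a vector functional of [a]. *)
have [||||//|eta heta] := @riesz R A H (fun a => rep a (rep k xi)) setT (fun a => w (a * k))
   (Num.sqrt (complex.Re (w 1))).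
- by [].
- by [].
- by move=> z v v' _ _; exact: rep_linear.
- by move=> z v v' _ _; rewrite mulrDl -scalerAl wl.
- move=> a _; rewrite -ler_sqr ?nnegrE ?mulr_ge0 ?normc_ge0 ?sqrtr_ge0 ?nr_ge0 //.
  rewrite exprMn sqr_sqrtr //.
  have := pf_bd (a * k) ler01 abd1; rewrite mul1r expr1n mul1r => h.
  by apply: (le_trans h); apply: ler_wpM2l => //; exact: dom2.
have := nfun_vec (rep k xi) eta.
by congr nfun; apply/funext => a; rewrite heta.
Qed.

(** Zorn again, for the [h] in [[0, 1]] such that [a |-> w (a * h)] is a norm limit of weakly
    continuous functionals. If a maximal [h0] were not 1, [dominated_piece] inside [1 - h0] would
    enlarge it. Normality serves to keep suprema of chains in [Q]. *)
Lemma normal_nfun : nfun w.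
Proof.
have w1 := pf_Re_ge0 apos1.
pose Q := [set h | [/\ apos h, apos (1 - h) & nfun (fun a => w (a * h))]].
have [|||||h0 [ph0 p1h0 nh0] maxh] := @zorn_set A Q (fun a b => apos (b - a)).
- by move=> a; rewrite subrr; exact: apos0.
- by move=> a b c; exact: apos_trans.
- by move=> a b h h'; exact: apos_anti.
- move=> S SQ S0 tS.
  have pS a : S a -> apos a by move=> /SQ[].
  have eS a : S a -> apos (1 - a) by move=> /SQ[].
  have [s [s1 s2 s3]] := chain_sup S0 pS eS tS.
  have ps : apos s.
    have [a Sa] := S0; rewrite -[s](subrK a); apply: aposD; [exact: s1|exact: pS].
  exists s => //; split=> //; first exact: s2.
  apply: nfun_limit => e e0.
  (* [|w (a (s - h))|^2 <= C^2 w(1) w((s - h)^2) <= C^2 w(1) w(s - h)]; once [w(s - h) < d], this is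
     at most [(e C)^2]. The denominator has [+ 1] because [w(1)] may vanish. *)
  pose d := e ^+ 2 / (complex.Re (w 1) + 1).
  have d0 : 0 < d by rewrite divr_gt0 ?exprn_gt0 //; lra.
  have [h Sh hh] : exists2 h, S h & complex.Re (w s) - d < complex.Re (w h).
    apply: contrapT => hn.
    have : complex.Re (w s) <= complex.Re (w s) - d.
      apply: (nw S0 pS tS s1 s2) => a Sa; rewrite leNgt; apply/negP => h.
      by apply: hn; exists a.
    lra.
  exists (fun a => w (a * h)); first by case: (SQ _ Sh).
  move=> a C C0 ha; rewrite -pfB -mulrBr.
  rewrite -ler_sqr ?nnegrE ?normc_ge0 ?mulr_ge0 ?(ltW e0) //.
  apply: (le_trans (pf_bd (s - h) C0 ha)); rewrite exprMn mulrC.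
  apply: ler_wpM2r; first exact: sqr_ge0.
  have psh := s1 h Sh.
  rewrite apos_sa //.
  have p1sh : apos (1 - (s - h)).
    rewrite opprB addrC -addrA [- s + 1]addrC; apply: aposD; [exact: pS|exact: s2].
  have h2 := pf_le (apos_sub_sqr psh p1sh).
  apply: (@le_trans _ _ ((complex.Re (w 1) + 1) * d)); last first.
    by rewrite /d mulrC divfK // gt_eqF //; lra.
  have := pf_Re_ge0 psh => h3.
  apply: ler_pM => //; [|lra|by move: h2 h3; rewrite pfB cReB; lra].
  have -> : (s - h) * (s - h) = (s - h)^@ * (s - h) by rewrite apos_sa.
  exact: pf_Re_ge0 (apos_mulstar _).
- exists 0; split; rewrite ?subr0; [exact: apos0|exact: apos1|].
  have := nfun_vec (0 : H) (0 : H); congr nfun; apply/funext => a.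
  by rewrite mulr0 pf0 ip0r.
have [e0|e0] := eqVneq (1 - h0) 0.
  have h1 : h0 = 1 by apply/esym/eqP; rewrite -subr_eq0 e0.
  by move: nh0; congr nfun; apply/funext => a; rewrite h1 mulr1.
have p11 : apos (1 - (1 - h0)) by rewrite opprB addrC subrK.
have [k [pk pek k0 nk]] := dominated_piece p1h0 p11 (elimN eqP e0).
exfalso; apply: k0; apply: (addrI h0); rewrite addr0.
apply: maxh; last by rewrite addrC addKr.
split; first exact: aposD.
  by rewrite opprD addrA.
have := nfun_add nh0 nk; congr nfun; apply/funext => a.
by rewrite mulrDr pfD.
Qed.

End Weights.

(** * Approximation by a weakly dense subalgebra *)

Section Kaplansky.
Context {R : realType} {A : wstarAlgebra R}.
Implicit Types (a b c : A) (C : R) (P D : set A).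
Local Notation "a ^@" := (@star R A a) (at level 2, format "a ^@").
Local Notation H := (wspace A).

(** The elements represented in the closure of [P] form a W*-subalgebra containing [S]. *)
Lemma generates_dense S P : generates S -> star_subalgebra P -> S `<=` P ->
  forall a, weak_closure (@rep R A @` P) (rep a).
Proof.
move=> gS sP SP a.
pose D := [set a : A | weak_closure (@rep R A @` P) (rep a)].
have aM := star_alg_closure (star_alg_rep sP).
have [bM M1 Ml Mm Ms] := aM.
have PD : P `<=` D.
  move=> b Pb; apply: sub_weak_closure; last by exists b.
  by move=> _ [c _ <-]; exact: rep_bounded.
suff : D = setT by move=> DT; have : D a by rewrite DT.
apply: gS; last by move=> b Sb; apply: PD; exact: SP.
split.
  split.
  - by apply: PD; exact: sub_one.
  - move=> k b c Db Dc; rewrite /D /=.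
    have -> : rep (k *: b + c) = (fun x => k *: rep b x + rep c x).
      by apply/funext => x; rewrite rep_linear.
    exact: Ml.
  - move=> b c Db Dc; rewrite /D /=.
    have -> : rep (b * c) = rep b \o rep c by apply/funext => x; rewrite rep_mul.
    exact: Mm.
  - move=> b Db; rewrite /D /=; have [S' MS' aS] := Ms _ Db.
    by rewrite (adj_uniq (rep_star b) aS).
move=> T hT.
have wT : weak_closure (@rep R A @` P) T.
  by apply: weak_closure_idem; apply: weak_closure_mono hT => _ [b Db <-].
have [b _ bT] := @rep_closed R A T (weak_closure_mono
  (fun _ h => let: ex_intro2 b _ e := h in ex_intro2 _ _ b I e) wT).
by exists b => //; rewrite /D /= bT.
Qed.

Variable P : set A.
Hypotheses (sP : star_subalgebra P)
  (dP : forall a, weak_closure (@rep R A @` P) (rep a)).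

(** The star is weakly continuous, so weak approximants may be symmetrised; on the real subspace of
    self-adjoint elements [strong_density] then applies. *)
Lemma sa_strong_approx a (s : seq H) (e : R) : a^@ = a -> 0 < e ->
  exists p, [/\ P p, p^@ = p & forall x, x \in s -> nr (rep (a - p) x) < e].
Proof.
move=> sa e0.
have [||||p [Pp sp] hp] := @strong_density R H A (@rep R A) [set p | P p /\ p^@ = p] (rep a) _ _ _ _ s e e0.
- by split; [exact: sub_zero|exact: star0].
- move=> r b c [Pb sb] [Pc sc]; split; last by rewrite starL conjc_real sb sc.
  by apply: sub_add => //; exact: sub_scale.
- by move=> r b c x _ _; exact: rep_linear.
- move=> t d d0; have /weak_closureP[_ hw] := dP a.
  (* The swapped pairs control [p^@], whose coefficient at [(x, y)] is the conjugate of that of [p]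
     at [(y, x)]. *)
  have [_ [p Pp <-] hp] := hw (t ++ [seq (v.2, v.1) | v <- t]) d d0.
  exists ((2^-1)%:C%C *: (p + p^@)).
    split; last by rewrite starZ conjc_real starD starK addrC.
    by apply: sub_scale => //; apply: sub_add => //; exact: sub_star.
  move=> v vt; rewrite repZ repD ipZl ipDl.
  have h1 := hp v; rewrite mem_cat vt in h1; have {}h1 := h1 isT.
  have h2 := hp (v.2, v.1); rewrite mem_cat in h2.
  have {}h2 := h2 (introT orP (or_intror (map_f (fun v => (v.2, v.1)) vt))).
  rewrite /= in h2.
  have e1 : dot H (rep p^@ v.1) v.2 = conjc (dot H (rep p v.2) v.1).
    by rewrite (adj_sym (rep_star p)) -ipC.
  have e2 : dot H (rep a v.1) v.2 = conjc (dot H (rep a v.2) v.1).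
    by rewrite -ipC rep_star sa.
  have -> : dot H (rep a v.1) v.2 - (2^-1)%:C%C * (dot H (rep p v.1) v.2 + dot H (rep p^@ v.1) v.2)
    = (2^-1)%:C%C * (dot H (rep a v.1) v.2 - dot H (rep p v.1) v.2)
      + (2^-1)%:C%C * (dot H (rep a v.1) v.2 - dot H (rep p^@ v.1) v.2).
    have h : (2^-1)%:C%C * 2%:R = 1 :> R[i] by rewrite -(rmorph_nat (real_complex R)) -rmorphM mulVf.
    rewrite -mulrDr addrACA -opprD mulrBr; congr (_ - _).
    by rewrite -mulr2n -[(dot H _ _) *+ 2]mulr_natl mulrA h mul1r.
  apply: le_lt_trans (le_normcD _ _) _; rewrite !normcM !normc_real ger0_norm ?invr_ge0 //.
  have : normc (dot H (rep a v.1) v.2 - dot H (rep p^@ v.1) v.2) < d.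
    by rewrite e1 e2 -rmorphB normc_conj.
  lra.
exists p; split=> // x /hp; by rewrite repB.
Qed.

(** For weak operator continuous [psi] this would be weak density. The approximants [p] carry no
    norm bound, so norm limits of such functionals are not reached directly. *)
Definition apx a := forall n (psi : 'I_n -> A -> R[i]) (e : R), 0 < e ->
  (forall i, nfun (psi i)) -> (forall i k b c, psi i (k *: b + c) = k * psi i b + psi i c) ->
  exists2 p, P p & forall i, normc (psi i a - psi i p) < e.

Let psiB n (psi : 'I_n -> A -> R[i]) :
  (forall i k b c, psi i (k *: b + c) = k * psi i b + psi i c) ->
  forall i b c, psi i (b - c) = psi i b - psi i c.
Proof. by move=> h i b c; rewrite addrC -scaleN1r h mulN1r addrC. Qed.

Lemma apx_mem p : P p -> apx p.
Proof. by move=> Pp n psi e e0 _ _; exists p => // i; rewrite subrr normc0. Qed.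

Lemma apx_lincomb k a b : apx a -> apx b -> apx (k *: a + b).
Proof.
move=> ha hb n psi e e0 npsi lpsi.
have k0 := normc_ge0 k; have p0 : 0 < 2 * (normc k + 1) by lra.
have e2 : 0 < e / 2 by lra.
have [p Pp hp] := ha n psi _ (divr_gt0 e0 p0) npsi lpsi.
have [q Pq hq] := hb n psi _ e2 npsi lpsi.
exists (k *: p + q); first by apply: sub_add => //; exact: sub_scale.
move=> i; rewrite !lpsi opprD addrACA -mulrBr.
apply: le_lt_trans (le_normcD _ _) _; rewrite normcM.
have h1 := hp i; rewrite ltr_pdivlMr // in h1.
have := hq i; have := normc_ge0 (psi i a - psi i p); lra.
Qed.

Lemma apx_limit a : (forall e : R, 0 < e -> exists2 b, apx b & abd (a - b) e) -> apx a.
Proof.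
move=> h n psi e e0 npsi lpsi.
have /choice[K hK] : forall i, exists K, 0 < K /\
    forall a C, 0 <= C -> abd a C -> normc (psi i a) <= K * C.
  by move=> i; have [K K0 hK] := nfun_bd (npsi i); exists K.
pose M := 1 + \sum_i K i.
have KM i : K i <= M.
  rewrite /M (bigD1 i) //= addrCA lerDl; apply: addr_ge0 => //.
  by apply: sumr_ge0 => j _; apply/ltW; case: (hK j).
have M0 : 0 < M.
  by apply: ltr_pwDl => //; apply: sumr_ge0 => j _; apply/ltW; case: (hK j).
have M2 : 0 < 2 * M by lra.
have e2 : 0 < e / 2 by lra.
have d0 := divr_gt0 e0 M2.
have [b ab hb] := h _ d0.
have [p Pp hp] := ab n psi _ e2 npsi lpsi.
exists p => // i; rewrite -(subrKA (psi i b)).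
apply: le_lt_trans (le_normcD _ _) _; rewrite -(psiB lpsi).
have := (hK i).2 _ _ (ltW d0) hb; have := hp i.
have : K i * (e / (2 * M)) <= M * (e / (2 * M)) by apply: ler_wpM2r => //; exact: ltW.
have -> : M * (e / (2 * M)) = e / 2 by field; rewrite gt_eqF.
lra.
Qed.

(* For [y = (x + it)^-1] with [x] in [P], [q - y = y (x - a) q] is small when [x]
   is strongly close to [a], whereas [y] stays bounded by [1/|t|]. *)
Lemma apx_resolvent a (t : R) q : a^@ = a -> t != 0 -> abd q `|t|^-1 ->
  (a + (t%:C%C * 'i%C) *: 1) * q = 1 -> apx q.
Proof.
move=> sa t0 hq aq n psi e e0 npsi lpsi.
have nt : 0 < `|t| by rewrite normr_gt0.
have it : 0 < `|t|^-1 by rewrite invr_gt0.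
(* [q - y] is bounded by [2 / |t|], so passing from [psi i] to [vfun (s i)] costs [e / 4]. Another
   [e / 4] is for [vfun (s i)] at [q - y], and [e / 2] for replacing [y] by [p]. *)
have e4 : 0 < e / (8 * `|t|^-1) by rewrite divr_gt0 // mulr_gt0.
have /choice[s hs] : forall i, exists s, forall a C, 0 <= C -> abd a C ->
    normc (psi i a - vfun s a) <= e / (8 * `|t|^-1) * C.
  by move=> i; exact: npsi.
pose vs := flatten [seq s i | i <- enum 'I_n].
pose M := \sum_(v <- vs) nr v.2 + 1.
have M0 : 0 < M.
  by rewrite /M addrC; apply: ltr_pwDl => //; apply: sumr_ge0 => v _; exact: nr_ge0.
have d0 : 0 < e / (4 * `|t|^-1 * M) by rewrite divr_gt0 // !mulr_gt0.
have [x [Px sx hx]] := sa_strong_approx [seq rep q v.1 | v <- vs] sa d0.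
have [y [hy y1 y2 Py]] := sub_resolvent sP Px sx t0.
have ay : apx y.
  apply: apx_limit => d dd; have [b Pb hb] := Py _ dd.
  exists b; first exact: apx_mem.
  by move=> z; have := hb z; rewrite !repB nrB.
have e2 : 0 < e / 2 by lra.
have [p Pp hp] := ay n psi _ e2 npsi lpsi.
exists p => // i; rewrite -(subrKA (psi i y)).
apply: le_lt_trans (le_normcD _ _) _; rewrite -(psiB lpsi).
have qy : q - y = y * (x - a) * q.
  have -> : x - a = (x + (t%:C%C * 'i%C) *: 1) - (a + (t%:C%C * 'i%C) *: 1).
    by rewrite opprD addrACA subrr addr0.
  by rewrite mulrBr mulrBl y1 mul1r -mulrA aq mulr1.
have bqy : abd (q - y) (`|t|^-1 + `|t|^-1) by exact: abdB.
have i2 : 0 <= `|t|^-1 + `|t|^-1 by lra.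
have h1 := hs i _ _ i2 bqy.
have h2 : normc (vfun (s i) (q - y)) <= e / 4.
  apply: (le_trans (normc_sum _ _)).
  have sub v : v \in s i -> v \in vs.
    by move=> vi; apply/flattenP; exists (s i) => //; apply/mapP; exists i; rewrite ?mem_enum.
  have K0 : 0 <= e / (4 * M) by rewrite divr_ge0 ?mulr_ge0 ?ltW.
  have h v : v \in s i -> normc (dot H (rep (q - y) v.1) v.2) <= e / (4 * M) * nr v.2.
    move=> vi; apply: (le_trans (ip_le _ _)); apply: ler_wpM2r; first exact: nr_ge0.
    rewrite qy !rep_mul; apply: (le_trans (hy _)).
    have := hx (rep q v.1) (map_f (fun v : H * H => rep q v.1) (sub v vi)).
    rewrite -opprB repN nrN => h; rewrite -(ler_pM2l nt) mulrA mulfV ?gt_eqF // mul1r.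
    apply: (le_trans (ltW h)); rewrite le_eqVlt; apply/orP; left; apply/eqP.
    by field; rewrite !gt_eqF.
  rewrite big_seq; apply: (le_trans (ler_sum _ h)); rewrite -big_seq -mulr_sumr.
  have hM : \sum_(v <- s i) nr v.2 <= M.
    rewrite /M /vs big_flatten big_map big_enum (bigD1 i) //= -addrA lerDl.
    apply: addr_ge0 => //; apply: sumr_ge0 => j _; apply: sumr_ge0 => v _; exact: nr_ge0.
  apply: (le_trans (ler_wpM2l K0 hM)); rewrite le_eqVlt; apply/orP; left; apply/eqP.
  by field; rewrite gt_eqF.
have h3 : e / (8 * `|t|^-1) * (`|t|^-1 + `|t|^-1) = e / 4 by field; rewrite gt_eqF.
have h4 := hp i.
have : normc (psi i (q - y)) <= e / 2.
  rewrite -[psi i _](subrK (vfun (s i) (q - y))).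
  by apply: (le_trans (le_normcD _ _)); lra.
lra.
Qed.

(* [a] is the limit of [k - k^2 (a + k)^-1] for [k = it], [t] large. *)
Lemma apx_sa a : a^@ = a -> apx a.
Proof.
move=> sa; apply: apx_limit => e e0.
have [C C0 hC] := abd_ex a.
(* The error will be [a * a * q], bounded by [C^2 / t < e]. *)
pose t : R := C * C / e + 1.
have C2 : 0 < C * C by rewrite mulr_gt0.
have t0 : 0 < t by have := divr_gt0 C2 e0; rewrite /t; lra.
have tn : t != 0 by rewrite gt_eqF.
have [q [hq _ q2 _]] := sub_resolvent (proj1 (@wstar_setT R A)) I sa tn.
have aq := apx_resolvent sa tn hq q2.
set k : R[i] := t%:C%C * 'i%C in q2.
exists ((- (k ^+ 2)) *: q + k *: 1).
  apply: apx_lincomb => //; apply: apx_mem; apply: sub_scale => //; exact: sub_one.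
have kq : k *: q = 1 - a * q.
  by rewrite -q2 mulrDl -scalerAl mul1r addrC addKr.
have -> : a - (- (k ^+ 2) *: q + k *: 1) = a * a * q.
  have -> : - (k ^+ 2) *: q + k *: 1 = k *: (a * q).
    rewrite scaleNr addrC expr2 -(scalerA k k q) -scalerBr; congr (k *: _).
    by rewrite kq opprB addrC subrK.
  rewrite scalerAr kq mulrBr mulr1 opprB addrC subrK mulrA //.
rewrite gtr0_norm // in hq.
have h := abdM (mulr_ge0 (ltW C0) (ltW C0)) (abdM (ltW C0) hC hC) hq.
have et : e * t = C * C + e by rewrite /t; field; rewrite gt_eqF.
apply: opb_le h; rewrite ler_pdivrMr // et; lra.
Qed.

Lemma apx_all a : apx a.
Proof.
have -> : a = 'i%C *: ((- 2^-1)%:C%C *: ('i%C *: (a - a^@))) + ((2^-1)%:C%C *: (a + a^@)).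
  have h : (2^-1)%:C%C * 2%:R = 1 :> R[i] by rewrite -(rmorph_nat (real_complex R)) -rmorphM mulVf.
  have h' : 'i%C * ((- 2^-1)%:C%C * 'i%C) = (2^-1)%:C%C :> R[i].
    by rewrite mulrC -mulrA -expr2 sqr_i mulrN1 -rmorphN opprK.
  rewrite !scalerA -mulrA h' -scalerDr addrACA addNr addr0 -mulr2n -[a *+ 2]scaler_nat scalerA h scale1r //.
have sN : ('i%C : R[i])^*%C = - 'i%C by apply/eqP; rewrite eq_complex /= oppr0 !eqxx.
apply: apx_lincomb; apply: apx_sa.
  by rewrite !starZ conjc_real starB starK sN scaleNr -scalerN opprB.
by rewrite starZ conjc_real starD starK addrC.
Qed.

(** Both functionals are approximated at the same [p]; this is why [apx] handles finite families. *)
Lemma nfun_eq (psi psi' : A -> R[i]) : nfun psi -> nfun psi' ->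
  (forall k b c, psi (k *: b + c) = k * psi b + psi c) ->
  (forall k b c, psi' (k *: b + c) = k * psi' b + psi' c) ->
  (forall p, P p -> psi p = psi' p) -> forall a, psi a = psi' a.
Proof.
move=> n1 n2 l1 l2 h a; apply/eqP; rewrite -subr_eq0; apply/eqP/normc_small => e e0.
have e2 : 0 < e / 2 by lra.
have [| |p Pp hp] := @apx_all a 2 (fun i => if i == ord0 then psi else psi') _ e2.
- by move=> i; case: ifP.
- by move=> i k b c; case: ifP.
have h1 := hp ord0; have h2 := hp ord_max; rewrite /= in h1 h2.
rewrite -(subrKA (psi p)) {2}(h p Pp); apply: (le_trans (le_normcD _ _)).
by rewrite [X in _ + X]normcB; lra.
Qed.

End Kaplansky.

(** * The GNS representation *)

Section GNS.
Context {R : realType} {A : wstarAlgebra R} {K : hilbert R}.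
Implicit Types (a b c p q r : A) (C : R) (T S : K -> K).
Local Notation "a ^@" := (@star R A a) (at level 2, format "a ^@").

Variables (P : set A) (w : A -> R[i]) (L : A -> K).
Hypotheses (sP : star_subalgebra P)
  (dP : forall a, weak_closure (@rep R A @` P) (rep a))
  (pw : positive_functional w) (nw : nfun w)
  (fw : forall a, w (a^@ * a) = 0 -> a = 0)
  (Ll : forall k p q, P p -> P q -> L (k *: p + q) = k *: L p + L q)
  (LE : forall p q, P p -> P q -> dot K (L q) (L p) = w (p^@ * q))
  (Ld : forall x (e : R), 0 < e -> exists2 p, P p & nr (x - L p) < e).

Let wl k a b : w (k *: a + b) = k * w a + w b. Proof. by case: pw. Qed.
Let P0 : P 0. Proof. exact: sub_zero. Qed.
Let Plin (k : R[i]) p q : P p -> P q -> P (k *: p + q).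
Proof. by move=> Pp Pq; apply: sub_add => //; exact: sub_scale. Qed.

Let nrL p : P p -> nr (L p) ^+ 2 = complex.Re (w (p^@ * p)).
Proof. by move=> Pp; rewrite nr_sqr /rip LE. Qed.

Let eqD x y : (forall p, P p -> dot K x (L p) = dot K y (L p)) -> x = y.
Proof.
move=> h; apply/eqP; rewrite -subr_eq0; apply/eqP/nr_eq0P/eqP.
rewrite -sqrf_eq0; apply/eqP/le_anti; rewrite sqr_ge0 andbT.
apply/ler_addgt0Pr => e e0; rewrite add0r.
have n0 : 0 < nr (x - y) + 1 by have := nr_ge0 (x - y); lra.
have [p Pp hp] := Ld (x - y) (divr_gt0 e0 n0).
have -> : nr (x - y) ^+ 2 = rip (x - y) (x - y - L p).
  by rewrite nr_sqr [in RHS]ripBr {3}/rip (ipBl x y (L p)) h // subrr subr0.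
apply: (le_trans (rip_le _ _)).
apply: (@le_trans _ _ ((nr (x - y) + 1) * nr (x - y - L p))).
  by apply: ler_wpM2r; [exact: nr_ge0|lra].
by rewrite mulrC -ler_pdivlMr // ltW.
Qed.

Lemma bop_eq_dense T S : bounded_op T -> bounded_op S ->
  (forall p, P p -> T (L p) = S (L p)) -> T = S.
Proof.
move=> bT bS h; apply/funext => x; apply/eqP; rewrite -subr_eq0; apply/eqP/nr_eq0P.
apply/le_anti; rewrite nr_ge0 andbT; apply/ler_addgt0Pr => e e0; rewrite add0r.
have [C C0 hC] := bop_bd bT; have [C' C0' hC'] := bop_bd bS.
have c0 : 0 < C + C' by lra.
have [p Pp hp] := Ld x (divr_gt0 e0 c0).
have -> : T x - S x = T (x - L p) - S (x - L p).
  by rewrite (linopB _ _ (bop_lin bT)) (linopB _ _ (bop_lin bS)) h // opprB addrA subrK.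
apply: (le_trans (opb_sub hC hC' (x - L p))).
by rewrite mulrC -ler_pdivlMr // ltW.
Qed.

Let bop_eq2 T S : bounded_op T -> bounded_op S ->
  (forall p q, P p -> P q -> dot K (T (L p)) (L q) = dot K (S (L p)) (L q)) -> T = S.
Proof.
by move=> bT bS h; apply: bop_eq_dense => // p Pp; apply: eqD => q Pq; exact: h.
Qed.

(** For [a] outside [P] nothing is known about [L (a * q)], so the operator is obtained from a form.
    Its bound combines Cauchy-Schwarz for [w] with [(a q)^@ (a q) <= C^2 q^@ q]. *)
Let phi_ex a C : 0 <= C -> abd a C -> exists T, [/\ bounded_op T, opb T C &
  forall q r, P q -> P r -> dot K (T (L q)) (L r) = w (r^@ * a * q)].
Proof.
move=> C0 hC.
apply: (@form_op R K A L P (fun q r => w (r^@ * a * q)) C C0).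
- exact: P0.
- exact: Plin.
- exact: Ll.
- exact: Ld.
- by move=> k q q' r _ _ _; rewrite mulrDr -scalerAr wl.
- by move=> k q r r' _ _ _; rewrite starL !mulrDl -!scalerAl wl.
- move=> q r Pq Pr; rewrite -ler_sqr ?nnegrE ?normc_ge0 ?mulr_ge0 ?nr_ge0 // !exprMn.
  rewrite -(mulrA r^@ a q); apply: (le_trans (pf_cs pw (a * q) r)).
  rewrite !nrL // [leRHS]mulrA; apply: ler_wpM2r; last exact: pf_mul_le.
  by apply: pf_Re_ge0 => //; exact: apos_mulstar.
Qed.

Lemma Phi_ex a : exists T, bounded_op T /\
  forall q r, P q -> P r -> dot K (T (L q)) (L r) = w (r^@ * a * q).
Proof.
by have [C C0 hC] := abd_ex a; have [T [bT _ hT]] := phi_ex (ltW C0) hC; exists T.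
Qed.

Definition Phi a : K -> K := projT1 (cid (Phi_ex a)).

Let PhiP a : bounded_op (Phi a) /\
  forall q r, P q -> P r -> dot K (Phi a (L q)) (L r) = w (r^@ * a * q).
Proof. exact: projT2 (cid (Phi_ex a)). Qed.

Lemma Phi_bop a : bounded_op (Phi a). Proof. by case: (PhiP a). Qed.
Lemma PhiE a q r : P q -> P r -> dot K (Phi a (L q)) (L r) = w (r^@ * a * q).
Proof. by case: (PhiP a) => _; apply. Qed.

Lemma Phi_bd a C : 0 <= C -> abd a C -> opb (Phi a) C.
Proof.
move=> C0 hC; have [T [bT hT TE]] := phi_ex C0 hC.
by rewrite (_ : Phi a = T) //; apply: bop_eq2 => // [|p q Pp Pq];
  [exact: Phi_bop|rewrite PhiE // TE].
Qed.

Lemma Phi_lin k a b x : Phi (k *: a + b) x = k *: Phi a x + Phi b x.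
Proof.
have -> // : Phi (k *: a + b) = (fun x => k *: Phi a x + Phi b x).
apply: bop_eq2; [exact: Phi_bop|by apply: bop_lincomb; exact: Phi_bop|move=> p q Pp Pq].
by rewrite ipDl ipZl !PhiE // mulrDr mulrDl -scalerAr -scalerAl wl.
Qed.

Lemma Phi0 x : Phi 0 x = 0.
Proof. by have := Phi_lin (-1) 0 0 x; rewrite scaler0 addr0 scaleN1r addNr. Qed.
Lemma PhiZ k a x : Phi (k *: a) x = k *: Phi a x.
Proof. by rewrite -[k *: a]addr0 Phi_lin Phi0 addr0. Qed.
Lemma PhiD a b x : Phi (a + b) x = Phi a x + Phi b x.
Proof. by have := Phi_lin 1 a b x; rewrite !scale1r. Qed.
Lemma PhiB a b x : Phi (a - b) x = Phi a x - Phi b x.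
Proof. by rewrite PhiD -scaleN1r PhiZ scaleN1r. Qed.

Lemma Phi_mem p q : P p -> P q -> Phi p (L q) = L (p * q).
Proof.
move=> Pp Pq; apply: eqD => r Pr; rewrite PhiE // LE //; last exact: sub_mul.
by rewrite mulrA.
Qed.

Lemma Phi_adj a : adjoint_pair (Phi a) (Phi a^@).
Proof.
have [S bS aS] := adjoint_ex (Phi_bop a).
have -> // : Phi a^@ = S.
apply: bop_eq2 => // [|p q Pp Pq]; first exact: Phi_bop.
rewrite PhiE // [RHS](adj_sym aS) [RHS]ipC PhiE // -(pf_star pw).
by rewrite !starM starK mulrA.
Qed.

Lemma Phi_one x : Phi 1 x = x.
Proof.
have -> // : Phi 1 = id.
apply: bop_eq2; [exact: Phi_bop|exact: bop_id|move=> p q Pp Pq].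
by rewrite PhiE // mulr1 LE.
Qed.

(** At vectors [L q] and [L r] the coefficient is [w (r^@ * a * q)]. General vectors follow by
    density, with errors uniform on balls of [A] by [Phi_bd]. *)
Lemma nfun_Phi x y : nfun (fun a => dot K (Phi a x) y).
Proof.
apply: nfun_limit => e e0.
have y0 : 0 < 2 * (nr y + 1) by have := nr_ge0 y; lra.
have [q Pq hq] := Ld x (divr_gt0 e0 y0).
have q0 : 0 < 2 * (nr (L q) + 1) by have := nr_ge0 (L q); lra.
have [r Pr hr] := Ld y (divr_gt0 e0 q0).
exists (fun a => dot K (Phi a (L q)) (L r)).
  have := nfun_mul r^@ q nw; congr nfun; apply/funext => a.
  by rewrite PhiE.
move=> a C C0 ha; have hP := Phi_bd C0 ha.
rewrite -(subrKA (dot K (Phi a (L q)) y)) -ipBl -ipBr.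
apply: (le_trans (le_normcD _ _)).
rewrite -(linopB _ _ (bop_lin (Phi_bop a))).
rewrite ltr_pdivlMr // in hq; rewrite ltr_pdivlMr // in hr.
have h1 : normc (dot K (Phi a (x - L q)) y) <= e / 2 * C.
  apply: (le_trans (ip_le _ _)).
  apply: (le_trans (ler_wpM2r (nr_ge0 y) (hP _))).
  rewrite -[leLHS]mulrA [leLHS]mulrC; apply: ler_wpM2r => //.
  have := nr_ge0 (x - L q); lra.
have h2 : normc (dot K (Phi a (L q)) (y - L r)) <= e / 2 * C.
  apply: (le_trans (ip_le _ _)).
  apply: (le_trans (ler_wpM2r (nr_ge0 _) (hP _))).
  rewrite -[leLHS]mulrA [leLHS]mulrC; apply: ler_wpM2r => //.
  have := nr_ge0 (y - L r); lra.
lra.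
Qed.

(** With [b], [q], [r] fixed, both sides are normal functionals of [a]. They agree for [a = p] in
    [P], where [Phi p] passes to the other side as [Phi p^@] and acts on [L r] by multiplication. *)
Lemma Phi_mul a b x : Phi (a * b) x = Phi a (Phi b x).
Proof.
have -> // : Phi (a * b) = Phi a \o Phi b.
apply: bop_eq2; [exact: Phi_bop|by apply: bop_comp; exact: Phi_bop|move=> q r Pq Pr /=].
rewrite PhiE //.
apply: (nfun_eq sP dP (psi := fun a => w (r^@ * (a * b) * q))
  (psi' := fun a => dot K (Phi a (Phi b (L q))) (L r))).
- have := nfun_mul r^@ (b * q) nw; congr nfun; apply/funext => c.
  by rewrite !mulrA.
- exact: nfun_Phi.
- by move=> k c d; rewrite mulrDl mulrDr mulrDl -!(scalerAl, scalerAr) wl.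
- by move=> k c d; rewrite Phi_lin ipDl ipZl.
- move=> p Pp; rewrite Phi_adj (@Phi_mem p^@ r (sub_star sP Pp)) //.
  rewrite PhiE //; last by apply: sub_mul => //; exact: sub_star.
  by rewrite starM starK !mulrA.
Qed.

(** If [Phi a] vanishes, the normal functional [c |-> w (c * a)] vanishes on [P], hence at
    [c = a^@]. *)
Lemma Phi_inj a : (forall x, Phi a x = 0) -> a = 0.
Proof.
move=> h; apply: fw.
have n0 : nfun (fun _ : A => 0 : R[i]).
  have := nfun_vec (0 : wspace A) (0 : wspace A); congr nfun; apply/funext => c.
  by rewrite ip0r.
apply: (nfun_eq sP dP (psi := fun c => w (c * a)) (psi' := fun=> 0)) => //.
- have := nfun_mul 1 a nw; congr nfun; apply/funext => c.
  by rewrite mul1r.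
- by move=> k b c; rewrite mulrDl -scalerAl wl.
- by move=> k b c; rewrite mulr0 addr0.
- move=> p Pp; have := PhiE a (sub_one sP) (sub_star sP Pp).
  by rewrite h ip0l starK mulr1 => <-.
Qed.

(** The matrix coefficients of [Phi] are normal, so [apx_all] approximates finitely many of them at
    once by elements of [P]. *)
Lemma Phi_closure a : weak_closure (Phi @` P) (Phi a).
Proof.
apply/weak_closureP; split=> [|s e e0]; first exact: Phi_bop.
have [| |p Pp hp] := @apx_all R A P sP dP a (size s)
    (fun i c => dot K (Phi c (tnth (in_tuple s) i).1) (tnth (in_tuple s) i).2) e e0.
- by move=> i; exact: nfun_Phi.
- by move=> i k b c; rewrite Phi_lin ipDl ipZl.
by exists (Phi p); [exists p|move=> _ /(tnthP (in_tuple s))[i ->]; exact: hp].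
Qed.

Let W := weak_closure (Phi @` P).

Let aW : star_alg (Phi @` P).
Proof.
split.
- by move=> _ [a _ <-]; exact: Phi_bop.
- by exists 1; [exact: sub_one|apply/funext => x; exact: Phi_one].
- move=> k _ _ [a Da <-] [b Db <-]; exists (k *: a + b); first exact: Plin.
  by apply/funext => x; exact: Phi_lin.
- move=> _ _ [a Da <-] [b Db <-]; exists (a * b); first exact: sub_mul.
  by apply/funext => x; exact: Phi_mul.
- move=> _ [a Da <-]; exists (Phi a^@); last exact: Phi_adj.
  by exists a^@ => //; exact: sub_star.
Qed.

(** If the self-adjoint [x] of [P] is such that [Phi x] is strongly close to [S], then
    [c = (x + 'i t)^-1] is bounded by [1 / |t|] and [Phi c] is strongly close to [Q]. A weak limit
    [a] of such [c] satisfies [Phi a = Q], because normal functionals are weakly continuous on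
    bounded sets. *)
Let Phi_resolvent S (t : R) Q : W S -> adjoint_pair S S -> t != 0 -> bounded_op Q ->
  (forall x, S (Q x) + (t%:C%C * 'i%C) *: Q x = x) -> exists a, Phi a = Q.
Proof.
move=> WS sS t0 bQ SQ.
set k : R[i] := t%:C%C * 'i%C in SQ.
have nt : 0 < `|t| by rewrite normr_gt0.
have [bS hS] := (weak_closureP _ _).1 WS.
(* The filter of the bounded [c] for which [Phi c] agrees with [Q] up to a small error on finitely
   many vectors. *)
pose F := filter_from [set i : seq K * R | 0 < i.2]
  (fun i => [set c : A | abd c `|t|^-1 /\ forall x, x \in i.1 -> nr (Phi c x - Q x) < i.2]).
have PF : ProperFilter F.
  apply: filter_from_proper.
    apply: filter_from_filter; first by exists ([::], 1) => /=.
    move=> [s e] [s' e'] /= e0 e0'; exists (s ++ s', Num.min e e').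
      by rewrite /= lt_min e0.
    move=> c [bc hc]; split; split=> // x xs; have := hc x; rewrite mem_cat xs ?orbT => /(_ isT).
      by rewrite lt_min => /andP[].
    by rewrite lt_min => /andP[].
  move=> [s e] /= e0.
  have d0 : 0 < e * `|t| by rewrite mulr_gt0.
  have [||||x [Px sx] hx] := @strong_density R K A Phi [set p | P p /\ p^@ = p] S _ _ _ _ [seq Q x | x <- s] _ d0.
  - by split; [exact: P0|exact: star0].
  - move=> r b c [Pb sb] [Pc sc]; split; last by rewrite starL conjc_real sb sc.
    exact: Plin.
  - by move=> r b c x _ _; exact: Phi_lin.
  - move=> u d dd.
    have [_ [p Pp <-] hp] := hS (u ++ [seq (v.2, v.1) | v <- u]) d dd.
    exists ((2^-1)%:C%C *: (p + p^@)).
      split; last by rewrite starZ conjc_real starD starK addrC.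
      by apply: sub_scale => //; apply: sub_add => //; exact: sub_star.
    move=> v vu.
    rewrite PhiZ PhiD.
    rewrite ipZl ipDl.
    have h1 := hp v; rewrite mem_cat vu in h1; have {}h1 := h1 isT.
    have h2 := hp (v.2, v.1); rewrite mem_cat in h2.
    have {}h2 := h2 (introT orP (or_intror (map_f (fun v => (v.2, v.1)) vu))).
    rewrite /= in h2.
    have e1 : dot K (Phi p^@ v.1) v.2 = conjc (dot K (Phi p v.2) v.1).
      by rewrite (adj_sym (Phi_adj p)) -ipC.
    have e2 : dot K (S v.1) v.2 = conjc (dot K (S v.2) v.1).
      by rewrite -ipC sS.
    have -> : dot K (S v.1) v.2 - (2^-1)%:C%C * (dot K (Phi p v.1) v.2 + dot K (Phi p^@ v.1) v.2)
      = (2^-1)%:C%C * (dot K (S v.1) v.2 - dot K (Phi p v.1) v.2)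
        + (2^-1)%:C%C * (dot K (S v.1) v.2 - dot K (Phi p^@ v.1) v.2).
      have h : (2^-1)%:C%C * 2%:R = 1 :> R[i] by rewrite -(rmorph_nat (real_complex R)) -rmorphM mulVf.
      rewrite -mulrDr addrACA -opprD mulrBr; congr (_ - _).
      by rewrite -mulr2n -[(dot K _ _) *+ 2]mulr_natl mulrA h mul1r.
    apply: le_lt_trans (le_normcD _ _) _; rewrite !normcM !normc_real ger0_norm ?invr_ge0 //.
    have : normc (dot K (S v.1) v.2 - dot K (Phi p^@ v.1) v.2) < d.
      by rewrite e1 e2 -rmorphB normc_conj.
    lra.
  have [c [hc c1 _ _]] := sub_resolvent (proj1 (@wstar_setT R A)) (I : [set: A] x) sx t0.
  exists c; split=> // y ys.
  have -> : Phi c y - Q y = Phi c (S (Q y) - Phi x (Q y)).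
    have h : Phi c (Phi x (Q y) + k *: Q y) = Q y.
      by rewrite -[in RHS](Phi_one (Q y)) -c1 Phi_mul PhiD PhiZ Phi_one.
    rewrite -[X in Phi c X - _]SQ -[X in _ - X = _]h -(linopB _ _ (bop_lin (Phi_bop c))).
    by rewrite opprD addrACA subrr addr0.
  have it0 : 0 <= `|t|^-1 by rewrite invr_ge0.
  apply: (le_lt_trans (Phi_bd it0 hc _)).
  rewrite mulrC ltr_pdivrMr //; apply: hx; exact: map_f.
have [U [UU FU]] := ultraFilterLemma PF.
have Ub : U [set c | abd c `|t|^-1].
  by apply: FU; exists ([::], 1) => //= c [].
have it0 : 0 <= `|t|^-1 by rewrite invr_ge0.
have [a _ ha] := ball_compact UU it0 Ub.
exists a; apply: bop_eq2 => // [|p q Pp Pq]; first exact: Phi_bop.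
apply: (@ulim_uniq _ _ U UU (fun c => dot K (Phi c (L p)) (L q))); last first.
  move=> e e0.
  have q0 : 0 < nr (L q) + 1 by have := nr_ge0 (L q); lra.
  apply: FU; exists ([:: L p], e / (nr (L q) + 1)); first by rewrite /= divr_gt0.
  move=> c [_ /= hc]; rewrite -ipBl; apply: (le_lt_trans (ip_le _ _)).
  have := hc (L p); rewrite mem_head => /(_ isT); rewrite ltr_pdivlMr //.
  have := nr_ge0 (Phi c (L p) - Q (L p)); lra.
have n1 := nfun_Phi (L p) (L q).
move=> e e0.
(* Since [c - a] is bounded by [2 / |t|], the error of [vfun s] on it is at most [e / 2]. *)
have e1 : 0 < e / (4 * `|t|^-1 + 1) by rewrite divr_gt0 //; lra.
have [s hs] := n1 _ e1.
have e2 : 0 < e / 2 by lra.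
have vs : ulim U (vfun s) (vfun s a).
  rewrite /vfun; elim: (s) => [|v s' IH].
    apply: (ulim_ext (f := fun=> 0)) => [c|]; first by rewrite big_nil.
    by rewrite big_nil; exact: ulim_cst.
  rewrite big_cons -[X in X + _]mul1r.
  apply: (ulim_ext (f := fun c => 1 * dot _ (rep c v.1) v.2 + vfun s' c)).
    by move=> c; rewrite /vfun big_cons mul1r.
  exact: ulim_lincomb (ha _ _) IH.
apply: filterS (filterI (vs _ e2) Ub) => c [/= h1 h2].
have bca : abd (c - a) (`|t|^-1 + `|t|^-1).
  apply: abdB => //.
  (* A bounded weak limit [b] along the same ultrafilter equals [a], which bounds [a]. *)
  have [b hb hab] := ball_compact UU it0 Ub.
  rewrite (_ : a = b) //; apply: rep_eq => x; apply: ext_ipl => z.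
  exact: ulim_uniq (ha x z) (hab x z).
have i2 : 0 <= `|t|^-1 + `|t|^-1 by lra.
have := hs _ _ i2 bca.
have -> : dot K (Phi (c - a) (L p)) (L q) = dot K (Phi c (L p)) (L q) - dot K (Phi a (L p)) (L q).
  by rewrite PhiB ipBl.
have -> : vfun s (c - a) = vfun s c - vfun s a.
  by rewrite /vfun -sumrB; apply: eq_bigr => v _; rewrite repB ipBl.
set X := dot K _ _ - _; set Y := vfun s c - _ in h1 *.
move=> h3; rewrite -[X](subrK Y); apply: (le_lt_trans (le_normcD _ _)).
have : e / (4 * `|t|^-1 + 1) * (`|t|^-1 + `|t|^-1) <= e / 2.
  rewrite mulrAC ler_pdivrMr; last lra.
  have := mulr_ge0 (ltW e0) it0; lra.
lra.
Qed.

(* The multiple of [T] by [k], translated by 3/4, lies between 1/2 and 1, so it is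
   [(1 + S^2)^-1 = (i/2) ((S + i)^-1 - (S - i)^-1)] for some [S >= 0]. *)
Let Phi_sa T : W T -> adjoint_pair T T -> exists a, Phi a = T.
Proof.
move=> WT sT; have [bW W1 Wl Wm Ws] := star_alg_closure aW.
have wW : weak_closure W `<=` W by exact: weak_closure_idem.
have [C C0 hC] := bop_bd (bW _ WT).
pose k := (4 * C)^-1.
have k0 : 0 < k by rewrite invr_gt0 mulr_gt0.
pose T' := fun x => k%:C%C *: T x + (3/4)%:C%C *: id x.
have WT' : W T'.
  have W34 : W (fun x => (3/4)%:C%C *: id x).
    have W0 := Wl (-1) _ _ W1 W1.
    have := Wl (3/4)%:C%C _ _ W1 W0; congr W; apply/funext => x.
    by rewrite scaleN1r addNr addr0.
  exact: Wl.
have T'ip x : dot K (T' x) x = (k * rip (T x) x + 3/4 * nr x ^+ 2)%:C%C.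
  by rewrite /T' ipDl !ipZl sa_rip // ip_nr -!rmorphM -rmorphD.
have Tbd x : `|k * rip (T x) x| <= 4^-1 * nr x ^+ 2.
  rewrite normrM ger0_norm ?(ltW k0) //.
  have h : `|rip (T x) x| <= C * nr x ^+ 2.
    apply: (le_trans (rip_le_abs _ _)); rewrite expr2 mulrA.
    by apply: ler_wpM2r; [exact: nr_ge0|exact: hC].
  apply: (le_trans (ler_wpM2l (ltW k0) h)); rewrite /k mulrA invfM.
  by rewrite -[4^-1 * C^-1 * C]mulrA mulVf ?gt_eqF // mulr1.
have pT' : opos T'.
  move=> x; rewrite T'ip ler0c; have := Tbd x; rewrite ler_norml => /andP[h _].
  have := sqr_ge0 (nr x); lra.
have T'1 x : rip (T' x) x <= 1 * nr x ^+ 2.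
  rewrite /rip T'ip /=; have := Tbd x; rewrite ler_norml => /andP[_ h]; lra.
have T'2 x : 2^-1 * nr x ^+ 2 <= rip (T' x) x.
  rewrite /rip T'ip /=; have := Tbd x; rewrite ler_norml => /andP[h _].
  have := sqr_ge0 (nr x); lra.
have lT' := bop_lin (bW _ WT').
have i2 : 0 < 2^-1 :> R by rewrite invr_gt0.
have [X [bX X1 X2 aX]] := positive_inverse (star_alg_closure aW) WT' pT' i2 T'2.
have WX : W X by apply: wW; apply: norm_closure_weak.
pose Y := fun x => -1 *: id x + X x.
have WY : W Y by exact: Wl.
(* [Y] is the inverse of [T'] minus 1. At [x = T' y] its quadratic form is
   [rip (T' y) y - |T' y|^2], nonnegative because [T' <= 1]. *)
have pY : opos Y.
  move=> x; rewrite /Y ipDl ipZl mulN1r ip_nr -{2 3}[x]X2 X1.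
  have -> : dot K (X x) (T' (X x)) = (rip (T' (X x)) (X x))%:C%C.
    by rewrite ipC opos_ip // conjc_real.
  rewrite -{1}[x]X2 -rmorphN -rmorphD ler0c addrC subr_ge0.
  by have := opos_bd (X x) ltr01 lT' pT' T'1; rewrite mul1r.
have [S [WS pS SS]] := positive_sqrt (star_alg_closure aW) wW WY pY.
have lS := bop_lin (bW _ WS).
have sS := opos_sa lS pS.
have SX x : S (S x) + x = X x by rewrite SS /Y scaleN1r addrAC addNr add0r.
(* For [t^2 = 1] one has [S^2 + 1 = (S + 'i t) (S - 'i t)], so the resolvent of [S] sends
   [(S^2 + 1) z] to [(S - 'i t) z]. *)
have res (t : R) : t * t = 1 -> exists a, forall z, Phi a (S (S z) + z) = S z - (t%:C%C * 'i%C) *: z.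
  move=> tt; have t0 : t != 0 by apply/eqP => t0; move: tt; rewrite t0 mul0r => /eqP; rewrite eq_sym oner_eq0.
  have [Q [bQ _ Q1 Q2 _]] := resolvent (star_alg_closure aW) WS sS t0.
  have [a aQ] := Phi_resolvent WS sS t0 bQ Q2.
  exists a => z; rewrite aQ -[RHS]Q1; congr Q.
  rewrite (linopB _ _ lS) (linopZ _ _ lS) scalerBr scalerA.
  have -> : t%:C%C * 'i%C * (t%:C%C * 'i%C) = -1 :> R[i].
    by rewrite mulrACA -rmorphM tt mul1r -expr2 sqr_i.
  by rewrite scaleN1r opprK addrA subrK.
have [a1 h1] := res 1 (mulr1 1).
have [a2 h2] := res (-1) (etrans (mulrNN 1 1) (mulr1 1)).
have T'E x : T' x = (2^-1)%:C%C *: ((- 'i%C) *: (Phi a2 x - Phi a1 x)).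
  have xE : x = S (S (T' x)) + T' x by rewrite SX X1.
  rewrite [in RHS]xE h1 h2 opprB addrC subrKA -scaleNr -scalerDl !scalerA.
  rewrite -[LHS]scale1r; congr (_ *: _).
  by apply/eqP; rewrite eq_complex /=; apply/andP; split; apply/eqP; field.
exists ((k^-1)%:C%C *: ((2^-1)%:C%C *: ((- 'i%C) *: (a2 - a1)) + (- (3/4))%:C%C *: 1)).
apply/funext => x; rewrite PhiZ Phi_lin !PhiZ PhiB -T'E Phi_one /T'.
rewrite -addrA -scalerDl -rmorphD subrr scale0r addr0 scalerA -rmorphM mulVf ?scale1r //.
by rewrite gt_eqF.
Qed.

Lemma Phi_iso : wstar_iso (weak_closure (Phi @` P)) Phi.
Proof.
split; [split| | |].
- by move=> a _; exact: Phi_closure.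
- move=> a b _ _ ab; apply/eqP; rewrite -subr_eq0; apply/eqP/Phi_inj => x.
  by rewrite PhiB ab subrr.
- move=> T WT; have [bW W1 Wl Wm Ws] := star_alg_closure aW.
  have [S WS aS] := Ws _ WT.
  have W0 := Wl (-1) _ _ W1 W1.
  (* The real part of [T], whose adjoint [S] is also in the closure; [a2] is the imaginary part. *)
  have [a1 h1] : exists a, Phi a = (fun x => (2^-1)%:C%C *: T x + (2^-1)%:C%C *: S x).
    apply: Phi_sa.
      have := Wl (2^-1)%:C%C _ _ WT (Wl (2^-1)%:C%C _ _ WS W0); congr W.
      by apply/funext => x; rewrite scaleN1r addNr addr0.
    move=> x y; rewrite ipDl ipDr !ipZl !ipZr conjc_real aS (adj_sym aS).
    by rewrite addrC.
  have [a2 h2] : exists a, Phi a = (fun x => ((2^-1)%:C%C * - 'i%C) *: T x + ((2^-1)%:C%C * 'i%C) *: S x).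
    apply: Phi_sa.
      have := Wl ((2^-1)%:C%C * - 'i%C) _ _ WT (Wl ((2^-1)%:C%C * 'i%C) _ _ WS W0); congr W.
      by apply/funext => x; rewrite scaleN1r addNr addr0.
    move=> x y; rewrite ipDl ipDr !ipZl !ipZr aS (adj_sym aS) addrC.
    by congr (_ * _ + _ * _); apply/eqP; rewrite eq_complex /=; apply/andP; split; apply/eqP; ring.
  exists ('i%C *: a2 + a1) => //; apply/funext => x.
  rewrite Phi_lin h1 h2 scalerDr !scalerA addrACA -!scalerDl.
  have -> : 'i%C * ((2^-1)%:C%C * - 'i%C) + (2^-1)%:C%C = 1 :> R[i].
    by apply/eqP; rewrite eq_complex /=; apply/andP; split; apply/eqP; field.
  have -> : 'i%C * ((2^-1)%:C%C * 'i%C) + (2^-1)%:C%C = 0 :> R[i].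
    by apply/eqP; rewrite eq_complex /=; apply/andP; split; apply/eqP; field.
  by rewrite scale1r scale0r addr0.
- exact: Phi_lin.
- exact: Phi_mul.
- exact: Phi_adj.
Qed.

End GNS.

(** * Partial isometries and the conditional expectation *)

Section PartialIsometries.
Context {R : realType} {A : wstarAlgebra R}.
Variable B : set A.
Implicit Types (a b c h k p u v w : A) (z : R[i]).
Local Notation "a ^@" := (@star R A a) (at level 2, format "a ^@").

Hypotheses (sB : star_subalgebra B) (cB : commutative_set B).

Lemma PIN_star u : PIN B u -> PIN B u^@.
Proof.
move=> [pu uu uu' h h']; split; rewrite ?starK //.
by rewrite /partial_isometry starK -[in RHS]pu !starM starK mulrA.
Qed.

Lemma PIN_one : PIN B 1.
Proof.
have B1 := sub_one sB.
by split; rewrite /partial_isometry ?star1 ?mulr1 //;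
  [move=> b|move=> b]; rewrite ?star1 mulr1 mul1r.
Qed.

(** [b u = b u u^@ u], and [u u^@] commutes with [b]. This carries elements of [B] across a
    normaliser. *)
Lemma PIN_mul_eq u b : PIN B u -> B b -> b * u = u * (u^@ * b * u).
Proof.
move=> [pu _ uu _ _] Bb; rewrite !mulrA (cB uu Bb) -(mulrA b) -[in LHS]pu !mulrA.
by rewrite -!mulrA.
Qed.

Lemma PIN_mul_eqr u b : PIN B u -> B b -> u * b = u * b * u^@ * u.
Proof.
move=> [pu uu _ _ _] Bb; rewrite -!mulrA (cB Bb uu) !mulrA.
by rewrite pu.
Qed.

(** The product is again a partial isometry because [v v^@] and [u^@ u] are in [B] and commute. *)
Lemma PIN_mul u v : PIN B u -> PIN B v -> PIN B (u * v).
Proof.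
move=> [pu u1 u2 u3 u4] [pv v1 v2 v3 v4]; split.
- rewrite /partial_isometry starM.
  have -> : u * v * (v^@ * u^@) * (u * v) = u * ((v * v^@) * (u^@ * u)) * v by rewrite !mulrA.
  rewrite (cB v2 u1).
  have -> : u * ((u^@ * u) * (v * v^@)) * v = (u * u^@ * u) * (v * v^@ * v) by rewrite !mulrA.
  by rewrite pu pv.
- have -> : (u * v)^@ * (u * v) = v^@ * (u^@ * u) * v by rewrite starM !mulrA.
  exact: v4.
- have -> : (u * v) * (u * v)^@ = u * (v * v^@) * u^@ by rewrite starM !mulrA.
  exact: u3.
- move=> b Bb; have -> : u * v * b * (u * v)^@ = u * (v * b * v^@) * u^@ by rewrite starM !mulrA.
  by apply: u3; exact: v3.
- move=> b Bb; have -> : (u * v)^@ * b * (u * v) = v^@ * (u^@ * b * u) * v by rewrite starM !mulrA.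
  by apply: v4; exact: u4.
Qed.

Lemma normc1_mulJ z : `|z| = 1 -> z * z^*%C = 1.
Proof. by rewrite normcEn => - []; rewrite normc_mulJ => ->; rewrite expr1n. Qed.

Lemma PIN_scale z u : `|z| = 1 -> PIN B u -> PIN B (z *: u).
Proof.
move=> z1 [pu u1 u2 u3 u4]; have zz := normc1_mulJ z1.
have e b : z *: u * b * (z *: u)^@ = u * b * u^@.
  by rewrite starZ -scalerAr -!scalerAl scalerA mulrC zz scale1r.
have e' b : (z *: u)^@ * b * (z *: u) = u^@ * b * u.
  by rewrite starZ -scalerAr -!scalerAl scalerA zz scale1r.
have f : (z *: u)^@ * (z *: u) = u^@ * u by rewrite -[X in X * _]mulr1 e' mulr1.
have f' : z *: u * (z *: u)^@ = u * u^@ by rewrite -[X in X * _]mulr1 e mulr1.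
split; rewrite /partial_isometry ?f ?f' //.
- by rewrite -scalerAr pu.
- by move=> b Bb; rewrite e; exact: u3.
- by move=> b Bb; rewrite e'; exact: u4.
Qed.

Lemma PINB_mem u b : PIN B u -> B b -> PINB B (u * b).
Proof.
by move=> Pu Bb; exists 1%N, (fun=> u), (fun=> b); split=> //; rewrite big_ord1.
Qed.

Lemma PINB_PIN u : PIN B u -> PINB B u.
Proof. by move=> Pu; rewrite -[u]mulr1; apply: PINB_mem => //; exact: sub_one. Qed.

Lemma PINB_B b : B b -> PINB B b.
Proof. by move=> Bb; rewrite -[b]mul1r; apply: PINB_mem => //; exact: PIN_one. Qed.

Lemma PINB0 : PINB B 0.
Proof. by exists 0%N, (fun=> 0), (fun=> 0); split=> [[]|[]|] //; rewrite big_ord0. Qed.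

Lemma PINB_add a c : PINB B a -> PINB B c -> PINB B (a + c).
Proof.
move=> [n [u [b [Pu Bb ->]]]] [n' [u' [b' [Pu' Bb' ->]]]].
exists (n + n')%N, (fun i : 'I_(n + n') => match fintype.split i with inl j => u j | inr j => u' j end),
  (fun i : 'I_(n + n') => match fintype.split i with inl j => b j | inr j => b' j end); split.
- by move=> i; case: (fintype.split i).
- by move=> i; case: (fintype.split i).
rewrite big_split_ord; congr (_ + _); apply: eq_bigr => i _.
  by rewrite (unsplitK (inl i)).
by rewrite (unsplitK (inr i)).
Qed.

Lemma PINB_sum n (F : 'I_n -> A) : (forall i, PINB B (F i)) -> PINB B (\sum_i F i).
Proof. by move=> h; elim/big_ind: _ => [|a b|i _]; [exact: PINB0|exact: PINB_add|]. Qed.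

Lemma PINB_star_subalgebra : star_subalgebra (PINB B).
Proof.
have sc z a : PINB B a -> PINB B (z *: a).
  move=> [n [u [b [Pu Bb ->]]]]; rewrite scaler_sumr; apply: PINB_sum => i.
  by rewrite scalerAr; apply: PINB_mem => //; exact: sub_scale.
split.
- by apply: PINB_B; exact: sub_one.
- by move=> z a c Pa Pc; apply: PINB_add => //; exact: sc.
- move=> a c [n [u [b [Pu Bb ->]]]] [n' [u' [b' [Pu' Bb' ->]]]].
  rewrite mulr_suml; apply: PINB_sum => i; rewrite mulr_sumr; apply: PINB_sum => j.
  rewrite mulrA -(mulrA (u i)) (PIN_mul_eq (Pu' j) (Bb i)) mulrA -mulrA.
  apply: PINB_mem; first exact: PIN_mul.
  apply: sub_mul => //; have [_ _ _ _ h] := Pu' j; exact: h.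
- move=> a [n [u [b [Pu Bb ->]]]]; rewrite star_sum; apply: PINB_sum => i.
  have Bs := sub_star sB (Bb i).
  rewrite starM (PIN_mul_eq (PIN_star (Pu i)) Bs) starK.
  apply: PINB_mem; first exact: PIN_star.
  by have [_ _ _ h _] := Pu i; exact: h.
Qed.

End PartialIsometries.

(** * The conditional expectation on normalisers *)

Section Expectation.
Context {R : realType} {A : wstarAlgebra R}.
Variables (B : set A) (E : A -> A).
Implicit Types (a b c h k p u v w : A) (z : R[i]).
Local Notation "a ^@" := (@star R A a) (at level 2, format "a ^@").

Hypotheses (wB : wstar_subalgebra B) (cB : commutative_set B) (mB : maximal_abelian B)
  (hE : conditional_expectation B E).
Let sB : star_subalgebra B. Proof. by case: wB. Qed.

Lemma E_lin z a b : E (z *: a + b) = z *: E a + E b. Proof. by case: hE => h _ _ _ _; exact: h. Qed.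
Lemma E_in a : B (E a). Proof. by case: hE => _ h _ _ _; exact: h. Qed.
Lemma E_id b : B b -> E b = b. Proof. by case: hE => _ _ h _ _; exact: h. Qed.
Lemma E_mull b a : B b -> E (b * a) = b * E a.
Proof.
move=> Bb; case: hE => _ _ _ h _; have := h a b 1 Bb (sub_one sB).
by rewrite !mulr1.
Qed.
Lemma E_mulr a b : B b -> E (a * b) = E a * b.
Proof.
move=> Bb; case: hE => _ _ _ h _; have := h a 1 b (sub_one sB) Bb.
by rewrite !mul1r.
Qed.
Lemma E_pos a : apos a -> apos (E a).
Proof.
case: hE => _ _ _ _ h pa.
by apply/(pos_inP wB (E_in a))/h/(pos_inP (@wstar_setT R A)).
Qed.
Lemma E0 : E 0 = 0. Proof. by apply: E_id; exact: sub_zero. Qed.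
Lemma ED a b : E (a + b) = E a + E b. Proof. by have := E_lin 1 a b; rewrite !scale1r. Qed.
Lemma EZ z a : E (z *: a) = z *: E a. Proof. by have := E_lin z a 0; rewrite E0 !addr0. Qed.
Lemma EB a b : E (a - b) = E a - E b.
Proof. by rewrite ED -scaleN1r EZ scaleN1r. Qed.
Lemma E_sum (I : Type) (s : seq I) (F : I -> A) : E (\sum_(i <- s) F i) = \sum_(i <- s) E (F i).
Proof. by elim/big_ind2: _ => [|? ? ? ? <- <-|//]; rewrite ?E0 ?ED. Qed.

(** Each [a |-> dot (E a x) x] is a positive functional, hence hermitian; an element is determined
    by its quadratic form. *)
Lemma E_star a : E a^@ = (E a)^@.
Proof.
have h x : dot (wspace A) (rep (E a^@) x) x = dot (wspace A) (rep (E a)^@ x) x.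
  have pw : positive_functional (fun a => dot (wspace A) (rep (E a) x) x).
    by split=> [k b c|b pb]; [rewrite E_lin rep_linear ipDl ipZl|exact: E_pos].
  by rewrite (pf_star pw) -ipC (adj_sym (rep_star (E a))).
by apply: apos_anti => x; rewrite repB ipBl h subrr.
Qed.

(* For self-adjoint [k], the double commutant of [B] and [k] is commutative. *)
Lemma commutant_mem h : (forall b, B b -> h * b = b * h) -> B h.
Proof.
have sa k : k^@ = k -> (forall b, B b -> k * b = b * k) -> B k.
  move=> sk kB.
  pose Y := [set y : A | (forall b, B b -> y * b = b * y) /\ y * k = k * y].
  pose D := [set x : A | forall y, Y y -> x * y = y * x].
  have Yst y : Y y -> Y y^@.
    move=> [h1 h2]; split=> [b Bb|].
      apply: (can_inj starK); rewrite !starM starK; apply/esym; apply: h1; exact: sub_star.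
    by apply: (can_inj starK); rewrite !starM starK sk.
  have BD : B `<=` D by move=> b Bb y [hy _]; rewrite hy.
  have kD : D k by move=> y [_ ->].
  have YB b : B b -> Y b by move=> Bb; split=> [c Bc|]; [exact: cB|rewrite kB].
  have Yk : Y k by [].
  have DY x : D x -> Y x by move=> Dx; split=> [b Bb|]; apply: Dx => //; exact: YB.
  have sD : star_subalgebra D.
    split.
    - by apply: BD; exact: sub_one.
    - by move=> z a b Da Db y Yy; rewrite mulrDl mulrDr -scalerAl -scalerAr Da ?Db.
    - by move=> a b Da Db y Yy; rewrite -mulrA (Db _ Yy) !mulrA Da.
    - move=> a Da y Yy; apply: (can_inj starK); rewrite !starM starK.
      by rewrite Da //; exact: Yst.
  have cD : commutative_set D by move=> a b Da Db; apply: Da; exact: DY.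
  have [_ _ /(_ D sD cD BD) DB] := mB.
  by rewrite -DB.
move=> hB.
have hB' b : B b -> h^@ * b = b * h^@.
  move=> Bb; apply: (can_inj starK); rewrite !starM starK; apply/esym.
  by apply: hB; exact: sub_star.
have sN : ('i%C : R[i])^*%C = - 'i%C by apply/eqP; rewrite eq_complex /= oppr0 !eqxx.
have B1 : B (h + h^@).
  apply: sa => [|b Bb]; first by rewrite starD starK addrC.
  by rewrite mulrDl mulrDr hB // hB'.
have B2 : B ('i%C *: (h - h^@)).
  apply: sa => [|b Bb]; first by rewrite starZ starB starK sN scaleNr -scalerN opprB.
  by rewrite -scalerAl -scalerAr mulrBl mulrBr hB // hB'.
have -> : h = (2^-1)%:C%C *: ((h + h^@) + (- 'i%C) *: ('i%C *: (h - h^@))).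
  have h2 : (2^-1)%:C%C * 2%:R = 1 :> R[i] by rewrite -(rmorph_nat (real_complex R)) -rmorphM mulVf.
  rewrite scalerA mulNr -expr2 sqr_i opprK scale1r addrACA addrN addr0.
  by rewrite -mulr2n -[h *+ 2]scaler_nat scalerA h2 scale1r.
by apply: (sub_scale sB); apply: (sub_add sB) => //; exact: sub_scale.
Qed.

Lemma E_PIN w : PIN B w -> exists p, [/\ B p, p^@ = p, p * p = p, w^@ * w * p = p & E w = w * p].
Proof.
move=> Pw; have [pw w1 w2 w3 w4] := Pw.
pose h := w^@ * E w.
have Bh : B h.
  apply: commutant_mem => b Bb; rewrite /h.
  (* [w b = (w b w^@) w], where [w b w^@] is in [B] and comes out of [E]. *)
  have e : E w * b = (w * b * w^@) * E w.
    by rewrite -E_mulr // [in LHS](PIN_mul_eqr cB Pw Bb) E_mull //; exact: w3.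
  rewrite -mulrA e !mulrA.
  have pws : w^@ * w * w^@ = w^@.
    by have [+ _ _ _ _] := PIN_star Pw; rewrite /partial_isometry starK.
  by rewrite (cB w1 Bb) -[b * _ * w^@]mulrA pws.
(* Being in [B], [h] equals [E h = E (w^@) * E w], and so is self-adjoint. Inserting [E w = w * h]
   afterwards makes it idempotent. *)
have hE2 : h = (E w)^@ * E w.
  by rewrite -[LHS](E_id Bh) /h E_mulr ?E_star //; exact: E_in.
have Ew : E w = w * h.
  by rewrite /h mulrA -E_mull // pw.
have wh : w^@ * w * h = h by rewrite -mulrA -Ew.
have hh : h^@ = h by rewrite hE2 starM starK.
clearbody h; exists h; split=> //.
rewrite [in RHS]hE2 Ew starM hh.
by rewrite -!mulrA [w^@ * _]mulrA wh.
Qed.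

(** It is enough to treat [w] in PIN(B), with [E w = w p] and [E w' = w' q] for [w' = v^@ w v].
    Conjugating [w p] by [v] gives [w' p'] in [B], equal to [E w' * p']. Conjugating [w' q] back
    gives an element of [B], fixed by [E], whence [w' q = v^@ (E w) v q]. So [E w' = E w' * p' * q],
    and cutting by [p'] does not change [E w']. *)
Lemma E_conj v a : PIN B v -> PINB B a -> E (v^@ * a * v) = v^@ * E a * v.
Proof.
move=> Pv [n [u [b [Pu Bb ->]]]].
have [pv v1 v2 v3 v4] := Pv.
have key w : PIN B w -> E (v^@ * w * v) = v^@ * E w * v.
  move=> Pw.
  have Pw' : PIN B (v^@ * w * v).
    by apply: PIN_mul => //; apply: PIN_mul => //; exact: PIN_star.
  set w' := v^@ * w * v in Pw' *.
  have [p [Bp sp pp wp Ew]] := E_PIN Pw.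
  have [q [Bq sq qq wq Ew']] := E_PIN Pw'.
  have Bp' := v4 _ Bp; set p' := v^@ * p * v in Bp'.
  have Bq' := v3 _ Bq.
  have h1 : v^@ * E w * v = w' * p'.
    by rewrite Ew -[v^@ * (w * p) * v]mulrA -(mulrA w) (PIN_mul_eq cB Pv Bp) !mulrA.
  have h2 : v^@ * E w * v = E w' * p'.
    rewrite -E_mulr // -h1 [RHS]E_id //; apply: v4; exact: E_in.
  have e3 : v * (w' * q) * v^@ = (v * v^@) * w * (v * q * v^@) by rewrite /w' !mulrA.
  have h3 : (v * v^@) * w * (v * q * v^@) = (v * v^@) * E w * (v * q * v^@).
    rewrite -e3 -[LHS]E_id; last by apply: v3; rewrite -Ew'; exact: E_in.
    by rewrite e3 E_mulr // E_mull.
  have vq : v * q * v^@ * v = v * q by rewrite -(PIN_mul_eqr cB Pv Bq).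
  have pvs : v^@ * v * v^@ = v^@.
    by have [+ _ _ _ _] := PIN_star Pv; rewrite /partial_isometry starK.
  have cv x : v^@ * (v * v^@ * x * (v * q * v^@)) * v = v^@ * x * v * q.
    have -> : v^@ * (v * v^@ * x * (v * q * v^@)) * v =
        (v^@ * v * v^@) * x * (v * q * v^@ * v) by rewrite !mulrA.
    by rewrite vq pvs !mulrA.
  have h4 : w' * q = v^@ * E w * v * q by rewrite -cv -h3 cv.
  have h5 : E w' = E w' * p' * q by rewrite -h2 -h4.
  rewrite h2 [in LHS]h5 -mulrA (cB Bp' Bq) mulrA.
  by congr (_ * _); rewrite Ew' -mulrA qq.
rewrite mulr_sumr mulr_suml !E_sum mulr_sumr mulr_suml; apply: eq_bigr => i _.
have e x : v^@ * (x * b i) * v = (v^@ * x * v) * (v^@ * b i * v).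
  by rewrite -[v^@ * (x * b i) * v]mulrA -(mulrA x) (PIN_mul_eq cB Pv (Bb i)) !mulrA.
by rewrite e E_mulr; [rewrite key // -e -E_mulr|exact: v4].
Qed.

End Expectation.

(** * The Gelfand transform *)

Section Gelfand.
Context {R : realType} {A : wstarAlgebra R}.
Variable B : set A.
Implicit Types (a b c h k : A) (z : R[i]) (x y : spectrum B) (C : R).
Local Notation "a ^@" := (@star R A a) (at level 2, format "a ^@").

Hypotheses (wB : wstar_subalgebra B) (cB : commutative_set B).
Let sB : star_subalgebra B. Proof. by case: wB. Qed.

(* the Gelfand transform as a function on all of [A], with junk value 0 off [B] *)
Definition hat a x : R[i] :=
  if pselect (B a) is left Ba then gelfand (exist _ a (mem_set Ba) : B) x else 0.

Lemma hatE (b : B) x : hat (val b) x = gelfand b x.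
Proof.
rewrite /hat; case: pselect => [Bb|]; last by move/(_ (set_valP b)).
by congr gelfand; exact: val_inj.
Qed.

Lemma hat_exist a (Ba : B a) : exists b : B, val b = a.
Proof. by exists (exist _ a (mem_set Ba)). Qed.

Let charP x : characters (val x). Proof. exact: set_valP. Qed.

Lemma hat_lincomb z a b x : B a -> B b -> hat (z *: a + b) x = z * hat a x + hat b x.
Proof.
move=> Ba Bb; have Bc : B (z *: a + b) by apply: (sub_add sB) => //; exact: sub_scale.
have [a' aE] := hat_exist Ba; have [b' bE] := hat_exist Bb; have [c' cE] := hat_exist Bc.
rewrite -cE -aE -bE !hatE; have [_ h _] := charP x.
by apply: h; rewrite cE aE bE.
Qed.

Lemma hat_mul a b x : B a -> B b -> hat (a * b) x = hat a x * hat b x.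
Proof.
move=> Ba Bb; have Bc := sub_mul sB Ba Bb.
have [a' aE] := hat_exist Ba; have [b' bE] := hat_exist Bb; have [c' cE] := hat_exist Bc.
rewrite -cE -aE -bE !hatE; have [_ _ h] := charP x.
by apply: h; rewrite cE aE bE.
Qed.

Lemma hat_one x : hat 1 x = 1.
Proof.
have [[b hb] _ _] := charP x.
have Bb : B (val b) := set_valP b.
have := hat_mul x Bb (sub_one sB); rewrite mulr1 hatE => h.
by apply: (mulfI hb); rewrite mulr1 -[LHS]h.
Qed.

Lemma hat_zero x : hat 0 x = 0.
Proof.
have B0 := sub_zero sB; have := hat_lincomb (-1) x B0 B0.
by rewrite scaler0 addr0 mulN1r addNr.
Qed.

Lemma hat_add a b x : B a -> B b -> hat (a + b) x = hat a x + hat b x.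
Proof. by move=> Ba Bb; have := hat_lincomb 1 x Ba Bb; rewrite scale1r mul1r. Qed.
Lemma hat_scale z a x : B a -> hat (z *: a) x = z * hat a x.
Proof.
by move=> Ba; have := hat_lincomb z x Ba (sub_zero sB); rewrite hat_zero !addr0.
Qed.
Lemma hat_sub a b x : B a -> B b -> hat (a - b) x = hat a x - hat b x.
Proof.
move=> Ba Bb; rewrite hat_add //; last exact: (sub_opp sB).
by rewrite -scaleN1r hat_scale // mulN1r.
Qed.
Lemma hat_sum (I : Type) (s : seq I) (F : I -> A) x : (forall i, B (F i)) ->
  hat (\sum_(i <- s) F i) x = \sum_(i <- s) hat (F i) x.
Proof.
move=> BF; elim: s => [|i s IH]; first by rewrite !big_nil hat_zero.
by rewrite !big_cons hat_add ?IH //; exact: sub_sum.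
Qed.

(* [c^2 + t^2] is invertible in [B] for [c] self-adjoint and [t <> 0], so no
   character takes the value [it] at [c]. *)
Let hat_sa_im b x : B b -> b^@ = b -> complex.Im (hat b x) = 0.
Proof.
move=> Bb sb; apply/eqP; have [//|t0] := eqVneq (complex.Im (hat b x)) 0; exfalso.
set l := hat b x in t0; set t := complex.Im l in t0.
have Bk : B ((- complex.Re l)%:C%C *: 1) by apply: (sub_scale sB); exact: sub_one.
pose c := b + (- complex.Re l)%:C%C *: 1.
have Bc : B c by exact: sub_add.
have sc : c^@ = c.
  by rewrite /c starD starZ star1 sb conjc_real.
have hc : hat c x = 'i%C * t%:C%C.
  rewrite /c hat_add // hat_scale ?hat_one ?mulr1; last exact: sub_one.
  by rewrite -/l rmorphN [X in X - _]complexE addrAC subrr add0r.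
pose d := c^@ * c + (t ^+ 2)%:C%C *: 1.
have Bt : B ((t ^+ 2)%:C%C *: 1) by apply: (sub_scale sB); exact: sub_one.
have Bcc : B (c^@ * c) by apply: (sub_mul sB) => //; exact: sub_star.
have Bd : B d by exact: sub_add.
have t2 : 0 < t ^+ 2 by rewrite exprn_even_gt0.
have pd : apos d.
  apply: aposD; first exact: apos_mulstar.
  by apply: aposZ; [exact: ltW|exact: apos1].
have [|e [Be de _]] := wsub_inv wB Bd pd t2.
  move=> v; rewrite /d repD repZ rep_one ripDl ripZl -nr_sqr lerDr.
  exact: opos_rip (apos_mulstar c).
have := hat_mul x Bd Be; rewrite de hat_one /d hat_add // hat_scale ?hat_one; last exact: sub_one.
rewrite sc hat_mul // hc mulrACA -expr2 sqr_i -rmorphM -expr2 mulN1r mulr1 addNr mul0r.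
by move/eqP; rewrite oner_eq0.
Qed.

Lemma hat_star b x : B b -> hat b^@ x = conjc (hat b x).
Proof.
move=> Bb; have Bs := sub_star sB Bb.
have sN : ('i%C : R[i])^*%C = - 'i%C by apply/eqP; rewrite eq_complex /= oppr0 !eqxx.
have h1 : complex.Im (hat (b + b^@) x) = 0.
  by apply: hat_sa_im; [exact: sub_add|rewrite starD starK addrC].
have h2 : complex.Im (hat ('i%C *: (b - b^@)) x) = 0.
  apply: hat_sa_im; first by apply: (sub_scale sB); exact: sub_sub.
  by rewrite starZ starB starK sN scaleNr -scalerN opprB.
move: h1 h2; rewrite hat_add // hat_scale ?hat_sub //; last exact: sub_sub.
case: (hat b x) => p q; case: (hat b^@ x) => p' q' /= h1 h2.
by congr Complex; lra.
Qed.

Lemma hat_mulstar b x : B b -> hat (b^@ * b) x = (normc (hat b x) ^+ 2)%:C%C.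
Proof.
by move=> Bb; rewrite hat_mul ?hat_star ?[RHS]normc_mulJ 1?mulrC ?normc_mulJ //; exact: sub_star.
Qed.

Lemma hat_ge0 b x : B b -> apos b -> 0 <= hat b x.
Proof.
move=> Bb /(wsub_sqrt wB Bb)[c [Bc pc <-]].
by rewrite -{1}(apos_sa pc) hat_mulstar // ler0c sqr_ge0.
Qed.

Lemma hat_bd b x C : B b -> 0 <= C -> abd b C -> normc (hat b x) <= C.
Proof.
move=> Bb C0 hC.
have Bc : B (b^@ * b) by apply: (sub_mul sB) => //; exact: sub_star.
have B1 : B ((C ^+ 2)%:C%C *: 1) by apply: (sub_scale sB); exact: sub_one.
have := hat_ge0 x (sub_sub sB B1 Bc) (abd_apos C0 hC).
rewrite hat_sub // hat_scale ?hat_one ?hat_mulstar ?mulr1; last exact: sub_one.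
  by rewrite -rmorphB ler0c subr_ge0 ler_sqr ?nnegrE ?normc_ge0.
exact: Bb.
Qed.

(** Compactness of the spectrum. The limit character is nonzero because every character is 1 at the
    unit. *)
Lemma char_limit (U : set_system (spectrum B)) : UltraFilter U ->
  exists z : spectrum B, forall a, B a -> ulim U (hat a) (hat a z).
Proof.
move=> UU.
have /choice[chi hchi] : forall b : B, exists z, ulim U (fun x => hat (val b) x) z.
  move=> b; have [C C0 hC] := abd_ex (val b); apply: (@ulim_ex _ _ _ UU _ C).
  apply: filterE => x /=; apply: hat_bd => //; [exact: set_valP|exact: ltW].
have cchi : characters (chi : {ptws B -> R[i]^o}).
  split.
  - have [b1 b1E] := hat_exist (sub_one sB); exists b1.
    rewrite (_ : chi b1 = 1) ?oner_eq0 //.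
    apply: (@ulim_uniq _ _ U UU _ _ _ (hchi b1)).
    by apply: (ulim_ext (f := fun=> 1)) => [x|]; [rewrite b1E hat_one|exact: ulim_cst].
  - move=> k a b c cE; apply: (@ulim_uniq _ _ U UU _ _ _ (hchi c)).
    apply: (ulim_ext (f := fun x => k * hat (val a) x + hat (val b) x)).
      by move=> x; rewrite cE hat_lincomb //; exact: set_valP.
    exact: (@ulim_lincomb _ _ U UU).
  - move=> a b c cE; apply: (@ulim_uniq _ _ U UU _ _ _ (hchi c)).
    apply: (ulim_ext (f := fun x => hat (val a) x * hat (val b) x)).
      by move=> x; rewrite cE hat_mul //; exact: set_valP.
    exact: (@ulim_mul _ _ U UU).
exists (exist _ (chi : {ptws B -> R[i]^o}) (mem_set cchi)) => a Ba.
have [b bE] := hat_exist Ba; rewrite -bE hatE /gelfand /=; exact: hchi.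
Qed.

(** The topology is that of pointwise convergence on [B]. *)
Lemma spectrum_cvg (F : set_system (spectrum B)) x : Filter F ->
  (forall b : B, forall e : R, 0 < e -> F [set y | normc (gelfand b y - gelfand b x) < e]) ->
  forall N, nbhs x N -> F N.
Proof.
move=> FF h N [_ [ [V oV <-] Vx sN] ].
apply: filterS sN _.
have : (fmap (set_val : spectrum B -> {ptws B -> R[i]^o}) F) --> (set_val x : {ptws B -> R[i]^o}).
  apply/cvg_sup => b N' [_ [ [V' oV' <-] V'x sN'] ].
  apply: filterS sN' _.
  have : nbhs (set_val x b : R[i]^o) V' by exact: open_nbhs_nbhs.
  move=> /nbhs_normP[e e0 he].
  have er : e = (complex.Re e)%:C%C by exact/ge0_complexE/ltW.
  have e1 : 0 < complex.Re e by rewrite -ltr0c -er.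
  apply: filterS (h b _ e1) => y hy; apply: he.
  rewrite /ball_ /= er normcEn ltcR normcB; exact: hy.
by apply; exact: open_nbhs_nbhs.
Qed.

Lemma gelfand_continuous (b : B) : continuousC (gelfand b).
Proof.
move=> x.
apply: (@continuous_comp (spectrum B) {ptws B -> R[i]^o} (R[i]^o) set_val
  (@proj B (fun=> R[i]^o) b) x); first exact: initial_continuous.
exact: (@proj_continuous B (fun=> R[i]^o) b).
Qed.

(** [state_hat_inj] will provide this; with it, order and norm in [B] are read off from
    transforms. *)
Hypothesis hat_inj : forall b, B b -> (forall x, hat b x = 0) -> b = 0.

Lemma hat_ext a b : B a -> B b -> (forall x, hat a x = hat b x) -> a = b.
Proof.
move=> Ba Bb h; apply/eqP; rewrite -subr_eq0; apply/eqP/hat_inj; first exact: (sub_sub sB).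
by move=> x; rewrite hat_sub // h subrr.
Qed.

(** [c] is the square root of [b * b]; its transform is nonnegative and has the same square as the
    real transform of [b]. *)
Lemma hat_abs b : B b -> b^@ = b ->
  exists c, [/\ B c, apos c & forall x, hat c x = (`|complex.Re (hat b x)|)%:C%C].
Proof.
move=> Bb sb; have Bbb := sub_mul sB Bb Bb.
have [|c [Bc pc cc]] := wsub_sqrt wB Bbb; first by rewrite -{1}sb; exact: apos_mulstar.
exists c; split=> // x.
have h := hat_ge0 x Bc pc; rewrite (ge0_complexE h).
have r0 : 0 <= complex.Re (hat c x) by rewrite ge0cE in h; case/andP: h.
congr (_%:C%C); apply/eqP; rewrite -(eqrXn2 (ltn0Sn 1)) // real_normK ?num_real //.
apply/eqP; apply: complexI; rewrite !rmorphXn /=.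
have hb : hat b x = (complex.Re (hat b x))%:C%C.
  by rewrite [LHS]complexE hat_sa_im // mulr0 addr0.
by rewrite -(ge0_complexE h) -hb !expr2 -!hat_mul // cc.
Qed.

(** Such a [b] coincides with its absolute value, the two having the same transform. *)
Lemma hat_apos b : B b -> (forall x, 0 <= hat b x) -> apos b.
Proof.
move=> Bb hb.
have sb : b^@ = b.
  apply: hat_ext => // [|x]; first exact: (sub_star sB).
  by rewrite hat_star // (ge0_complexE (hb x)) conjc_real.
have [c [Bc pc hc]] := hat_abs Bb sb.
rewrite (_ : b = c) //; apply: hat_ext => // x.
rewrite hc (ge0_complexE (hb x)) /= ger0_norm //.
by have := hb x; rewrite ge0cE => /andP[].
Qed.

Lemma hat_abd b C : B b -> 0 <= C -> (forall x, normc (hat b x) <= C) -> abd b C.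
Proof.
move=> Bb C0 hb; apply: apos_abd => //.
have Bc : B (b^@ * b) by apply: (sub_mul sB) => //; exact: (sub_star sB).
have B1 : B ((C ^+ 2)%:C%C *: 1) by apply: (sub_scale sB); exact: (sub_one sB).
apply: hat_apos => [|x]; first exact: (sub_sub sB).
rewrite hat_sub // hat_scale ?hat_one ?mulr1; last exact: (sub_one sB).
by rewrite hat_mulstar // -rmorphB ler0c subr_ge0 ler_sqr ?nnegrE ?normc_ge0.
Qed.

(** [h] is twice the positive part of [k = d^2 - sum |b - b(x)|^2] over finitely many [b]. Where it
    is nonzero, all these [b] are within [d] of their values at [x], which confines the point to a
    neighbourhood given by [f]. *)
Lemma gelfand_bump (f : spectrum B -> R[i]) x (e : R) : continuousC f -> 0 < e ->
  exists h, [/\ B h, forall y, 0 <= hat h y, 0 < complex.Re (hat h x)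
    & forall y, hat h y != 0 -> normc (f y - f x) < e].
Proof.
move=> cf e0.
pose F := filter_from [set i : seq B * R | 0 < i.2]
  (fun i => [set y | forall b : B, b \in i.1 -> normc (gelfand b y - gelfand b x) < i.2]).
have FF : Filter F.
  apply: filter_from_filter; first by exists ([::], 1) => /=.
  move=> [s d] [s' d'] /= d0 d0'; exists (s ++ s', Num.min d d'); first by rewrite /= lt_min d0.
  move=> y hy; split=> b bs; have := hy b; rewrite mem_cat bs ?orbT => /(_ isT).
    by rewrite lt_min => /andP[].
  by rewrite lt_min => /andP[].
have : nbhs x [set y | normc (f y - f x) < e].
  have e1 : 0 < e%:C%C :> R[i] by rewrite ltr0c.
  have /cvgrPdist_lt/(_ _ e1) := cf x.
  by apply: filterS => y /=; rewrite normcEn ltcR normcB.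
move=> /(spectrum_cvg FF) -[|[s d] /= d0 hs].
  move=> b d d0; exists ([:: b], d) => // y /(_ b); rewrite mem_head.
  exact.
have Bv (b : B) : B (val b) := set_valP b.
have B1 := sub_one sB.
pose t (b : B) := val b + (- gelfand b x) *: 1.
have Bt (b : B) : B (t b) by apply: (sub_add sB) => //; exact: (sub_scale sB).
have ht (b : B) y : hat (t b) y = gelfand b y - gelfand b x.
  by rewrite /t hat_add // ?hat_scale ?hat_one ?mulr1 ?hatE //; exact: (sub_scale sB).
pose g := \sum_(b <- s) (t b)^@ * t b.
have Btt (b : B) : B ((t b)^@ * t b) by apply: (sub_mul sB) => //; exact: (sub_star sB).
have Bg : B g by exact: (sub_sum sB).
have hg y : hat g y = (\sum_(b <- s) normc (gelfand b y - gelfand b x) ^+ 2)%:C%C.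
  rewrite /g hat_sum // rmorph_sum; apply: eq_bigr => b _.
  by rewrite hat_mulstar // ht.
pose k := (d ^+ 2)%:C%C *: 1 - g.
have Bk : B k by apply: (sub_sub sB) => //; exact: (sub_scale sB).
have sk : k^@ = k.
  rewrite /k starB starZ star1 conjc_real /g star_sum; congr (_ - _).
  by apply: eq_bigr => b _; rewrite starM starK.
have hk y : hat k y = (d ^+ 2 - \sum_(b <- s) normc (gelfand b y - gelfand b x) ^+ 2)%:C%C.
  rewrite /k hat_sub ?hat_scale ?hat_one ?mulr1 ?hg ?rmorphB //; exact: (sub_scale sB).
have [c [Bc _ hc]] := hat_abs Bk sk.
exists (c + k).
have hck y : hat (c + k) y = (`|complex.Re (hat k y)| + complex.Re (hat k y))%:C%C.
  by rewrite hat_add // hc [RHS]rmorphD; congr (_ + _); rewrite hk.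
split.
- exact: (sub_add sB).
- move=> y; rewrite hck ler0c; have := ler_norm (- complex.Re (hat k y)); rewrite normrN; lra.
- rewrite hck hk /=; have -> : \sum_(b <- s) normc (gelfand b x - gelfand b x) ^+ 2 = 0.
    by apply: big1 => b _; rewrite subrr normc0 expr0n.
  rewrite subr0 ger0_norm ?sqr_ge0 //; have : 0 < d ^+ 2 by rewrite exprn_gt0.
  lra.
- move=> y; rewrite hck hk /=; set r := d ^+ 2 - _ => hr.
  have r0 : 0 < r.
    rewrite ltNge; apply/negP => r0; move: hr.
    by rewrite ler0_norm // addNr eqxx.
  apply: hs => b bs; rewrite -ltr_sqr ?nnegrE ?normc_ge0 ?ltW //.
  move: r0; rewrite /r subr_gt0; apply: le_lt_trans.
  rewrite (big_rem b) //= lerDl; apply: sumr_ge0 => b' _; exact: sqr_ge0.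
Qed.

(** A partition of unity made of bumps: [b] is the sum of [f(x) h_x] divided by the sum of [h_x],
    over finitely many [x] for which the denominator is bounded below. *)
Lemma gelfand_approx (f : spectrum B -> R[i]) (e : R) : continuousC f -> 0 < e ->
  exists2 b, B b & forall y, normc (hat b y - f y) <= e.
Proof.
move=> cf e0.
have /choice[h hh] : forall x, exists h, [/\ B h, forall y, 0 <= hat h y, 0 < complex.Re (hat h x)
    & forall y, hat h y != 0 -> normc (f y - f x) < e].
  by move=> x; exact: gelfand_bump.
have Bh x : B (h x) by case: (hh x).
have h0 x y : 0 <= hat (h x) y by case: (hh x).
have hr x y : hat (h x) y = (complex.Re (hat (h x) y))%:C%C by exact: ge0_complexE.
have hr0 x y : 0 <= complex.Re (hat (h x) y) by have := h0 x y; rewrite ge0cE => /andP[].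
pose F := filter_from [set i : seq (spectrum B) * R | 0 < i.2]
  (fun i => [set y | forall x, x \in i.1 -> complex.Re (hat (h x) y) < i.2]).
have [s [d [d0 hs]]] : exists s (d : R), 0 < d /\
    forall y, d <= \sum_(x <- s) complex.Re (hat (h x) y).
  (* Otherwise the sets where finitely many bumps are small form a proper filter; at a limit
     character [z] of an ultrafilter above it, the bump of [z] itself is positive. *)
  apply: contrapT => /forallNP hn.
  have PF : ProperFilter F.
    apply: filter_from_proper.
      apply: filter_from_filter; first by exists ([::], 1) => /=.
      move=> [s d] [s' d'] /= d0 d0'; exists (s ++ s', Num.min d d'); first by rewrite /= lt_min d0.
      move=> y hy; split=> b bs; have := hy b; rewrite mem_cat bs ?orbT => /(_ isT).
        by rewrite lt_min => /andP[].
      by rewrite lt_min => /andP[].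
    move=> [s d] /= d0; apply: contrapT => hy; apply: (hn s); exists d; split=> // y.
    rewrite leNgt; apply/negP => hlt; apply: hy; exists y => x xs /=.
    apply: le_lt_trans hlt; rewrite (big_rem x) //= lerDl.
    by apply: sumr_ge0 => x' _.
  have [U [UU FU]] := ultraFilterLemma PF.
  have [z hz] := char_limit UU.
  have [_ _ pz _] := hh z.
  have p2 : 0 < complex.Re (hat (h z) z) / 2 by lra.
  have Uz : U [set y | complex.Re (hat (h z) y) < complex.Re (hat (h z) z) / 2].
    apply: FU; exists ([:: z], complex.Re (hat (h z) z) / 2) => //= y /(_ z).
    by rewrite mem_head; apply.
  have [y [/= h1 h2]] := filter_ex (filterI (hz _ (Bh z) _ p2) Uz).
  have := Re_le_normc (hat (h z) z - hat (h z) y); rewrite normcB cReB; lra.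
pose g := \sum_(x <- s) h x.
have Bg : B g by exact: (sub_sum sB).
have hg y : hat g y = (\sum_(x <- s) complex.Re (hat (h x) y))%:C%C.
  by rewrite /g hat_sum // rmorph_sum; apply: eq_bigr => x _.
have B1 := sub_one sB.
have Bd : B (d%:C%C *: 1) by exact: (sub_scale sB).
have pg : apos (g - d%:C%C *: 1).
  apply: hat_apos => [|y]; first exact: (sub_sub sB).
  by rewrite hat_sub // hat_scale // hat_one mulr1 hg -rmorphB ler0c subr_ge0.
have pg' : apos g.
  rewrite -[g](subrK (d%:C%C *: 1)); apply: aposD => //.
  by apply: aposZ; [exact: ltW|exact: apos1].
have [|gi [Bgi g1 _]] := wsub_inv wB Bg pg' d0.
  move=> v; have := opos_rip v pg; rewrite repB repZ rep_one ripBl ripZl -nr_sqr.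
  by rewrite subr_ge0.
pose b := (\sum_(x <- s) f x *: h x) * gi.
have Bs : B (\sum_(x <- s) f x *: h x) by apply: (sub_sum sB) => x; exact: (sub_scale sB).
exists b; first exact: (sub_mul sB).
move=> y; set S := \sum_(x <- s) complex.Re (hat (h x) y) in hg.
have S0 : 0 < S := lt_le_trans d0 (hs y).
have hgi : S%:C%C * hat gi y = 1.
  by rewrite -[S]/(\sum_(x <- s) complex.Re (hat (h x) y)) -hg -hat_mul // g1 hat_one.
have nS : S%:C%C != 0 :> R[i] by rewrite eq_complex /= gt_eqF.
have -> : hat b y - f y = (\sum_(x <- s) (f x - f y) * (complex.Re (hat (h x) y))%:C%C) / S%:C%C.
  have gE : hat gi y = S%:C%C^-1 by apply: (mulfI nS); rewrite hgi mulfV.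
  have bE : hat b y = (\sum_(x <- s) f x * (complex.Re (hat (h x) y))%:C%C) / S%:C%C.
    rewrite /b hat_mul // gE hat_sum; last by move=> x; exact: (sub_scale sB).
    by congr (_ / _); apply: eq_bigr => x _; rewrite hat_scale // -hr.
  have fE : f y = (\sum_(x <- s) f y * (complex.Re (hat (h x) y))%:C%C) / S%:C%C.
    by rewrite -mulr_sumr -rmorph_sum mulfK.
  rewrite bE [X in _ - X]fE -mulrBl -sumrB; congr (_ / _).
  by apply: eq_bigr => x _; rewrite mulrBl.
rewrite normcM normcV normc_real ger0_norm ?(ltW S0) // ler_pdivrMr //.
apply: (le_trans (normc_sum _ _)); rewrite /S mulr_sumr; apply: ler_sum => x _.
rewrite normcM normc_real ger0_norm //.
have [->|hx] := eqVneq (hat (h x) y) 0; first by rewrite /= !mulr0.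
apply: ler_wpM2r => //; have [_ _ _ /(_ y hx)] := hh x.
by rewrite normcB; exact: ltW.
Qed.

Lemma gelfand_surj (f : spectrum B -> R[i]) : continuousC f ->
  exists b : B, gelfand b = f.
Proof.
move=> cf.
have e0 n : 0 < n.+1%:R^-1 :> R by rewrite invr_gt0 ltr0n.
have /choice[u hu] : forall n : nat, exists b, B b /\ forall y, normc (hat b y - f y) <= n.+1%:R^-1.
  by move=> n; have [b Bb hb] := gelfand_approx cf (e0 n); exists b.
have Bu n : B (u n) by case: (hu n).
have hf n y : normc (hat (u n) y - f y) <= n.+1%:R^-1 by case: (hu n) => _; apply.
have [|b Bb hb] := wsub_limit wB Bu.
  move=> e ee; have e2 : 0 < e / 2 by lra.
  have [N _ hN] := near_infty_natSinv_lt (PosNum e2).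
  exists N => m n Nm Nn; apply: hat_abd; [exact: (sub_sub sB)|exact: ltW|move=> y].
  rewrite hat_sub // -(subrKA (f y)); apply: (le_trans (le_normcD _ _)).
  rewrite [X in _ + X]normcB.
  have h1 : m.+1%:R^-1 < e / 2 := hN m Nm; have h2 : n.+1%:R^-1 < e / 2 := hN n Nn.
  move: (le_lt_trans (hf m y) h1) (le_lt_trans (hf n y) h2); clear; lra.
have [b' bE] := hat_exist Bb; exists b'; apply/funext => y.
rewrite -hatE bE; apply/eqP; rewrite -subr_eq0; apply/eqP/normc_small => e ee.
have e2 : 0 < e / 2 by lra.
have [N _ hN] := near_infty_natSinv_lt (PosNum e2).
have [N' hN'] := hb _ e2.
have h1 : (maxn N N').+1%:R^-1 < e / 2 := hN _ (leq_maxl N N').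
have h2 := hN' _ (leq_maxr N N').
have h3 := hat_bd y (sub_sub sB (Bu (maxn N N')) Bb) (ltW e2) h2.
have h4 := le_lt_trans (hf (maxn N N') y) h1.
rewrite -(subrKA (hat (u (maxn N N')) y)); apply: (le_trans (le_normcD _ _)).
rewrite normcB -hat_sub //; clear -h3 h4; lra.
Qed.

End Gelfand.

(** * The Weyl twist *)

Section FiniteSupportSums.
Context {R : realType} {T : choiceType}.
Implicit Types (S : set T) (t : T).

Lemma fsum_point S (f : T -> R[i]) t0 : S t0 ->
  (forall t, S t -> t <> t0 -> f t = 0) -> \sum_(t \in S) f t = f t0.
Proof.
move=> St0 h; transitivity (\sum_(t \in [set t0]) f t); last by rewrite fsbig_set1.
apply/esym/fsbig_widen; first by move=> _ ->.
by move=> t [St /= /(h t St)].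
Qed.

(** Each [f i] lives on at most one point of [S], as functions on a bisection do in a fibre. All
    supports then lie in one finite sequence [r], and the exchange is that of two finite sums. *)
Lemma fsum_sum S n (f : 'I_n -> T -> R[i]) (pts : 'I_n -> option T) :
  (forall i t, pts i = Some t -> S t) ->
  (forall i t, S t -> pts i <> Some t -> f i t = 0) ->
  \sum_(t \in S) \sum_(i < n) f i t = \sum_(i < n) \sum_(t \in S) f i t.
Proof.
move=> hS h; pose r := undup (pmap pts (enum 'I_n)).
have ur : uniq r by exact: undup_uniq.
have rS : [set` r] `<=` S.
  move=> t /=; rewrite mem_undup mem_pmap => /mapP[i _ /esym]; exact: hS.
have f0 i t : S t -> t \notin r -> f i t = 0.
  move=> St tr; apply: h => // hi; move/negP: tr; apply.
  by rewrite mem_undup mem_pmap; apply/mapP; exists i; rewrite ?mem_enum.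
rewrite (fsbigE r) // => [|t St tr]; last by apply: big1 => i _; exact: f0.
rewrite exchange_big; apply: eq_bigr => i _.
by rewrite (fsbigE r) // => t St tr; exact: f0.
Qed.

End FiniteSupportSums.

(** * Values of functions at germs *)

Section Germs.
Context {R : realType} {A : wstarAlgebra R}.
Variables (B : set A) (E : A -> A).
Implicit Types (a b c h k p u v w : A) (z : R[i]) (x y : spectrum B).
Local Notation "a ^@" := (@star R A a) (at level 2, format "a ^@").
Local Notation hat := (@hat R A B).

Hypotheses (wB : wstar_subalgebra B) (cB : commutative_set B) (mB : maximal_abelian B)
  (hE : conditional_expectation B E).
Let sB : star_subalgebra B. Proof. by case: wB. Qed.
Let Ein := E_in hE.

Lemma spectrum_ext x y : (forall b, B b -> hat b x = hat b y) -> x = y.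
Proof.
move=> h; apply: val_inj; apply/funext => b.
by have := h (val b) (set_valP b); rewrite !hatE.
Qed.

Lemma domP u x : PIN B u -> dom u x <-> hat (u^@ * u) x = 1.
Proof.
move=> [_ uu _ _ _]; split=> [[p pE <-]|h].
  by rewrite -pE hatE.
by have [p pE] := hat_exist uu; exists p => //; rewrite -hatE pE.
Qed.

Lemma hat_proj p x : B p -> p * p = p -> hat p x = 0 \/ hat p x = 1.
Proof.
move=> Bp pp; have := hat_mul wB x Bp Bp; rewrite pp => h.
have [->|h0] := eqVneq (hat p x) 0; [by left|right].
by apply: (mulfI h0); rewrite -h mulr1.
Qed.

Lemma PIN_proj u : PIN B u -> u^@ * u * (u^@ * u) = u^@ * u.
Proof. by move=> [pu _ _ _ _]; rewrite mulrA -(mulrA u^@) -(mulrA u^@) pu. Qed.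

(* the value at the class of [(v, x)] of the function attached to [a] *)
Definition coef v a x := hat (E (v^@ * a)) x.

Lemma coef_lincomb v z a b x : coef v (z *: a + b) x = z * coef v a x + coef v b x.
Proof. by rewrite /coef mulrDr -scalerAr (E_lin hE) (hat_lincomb wB). Qed.

Lemma coef_mulr v a b x : B b -> coef v (a * b) x = coef v a x * hat b x.
Proof. by move=> Bb; rewrite /coef mulrA (E_mulr wB hE) // (hat_mul wB). Qed.

Lemma coef_bigsum v n (F : 'I_n -> A) x : coef v (\sum_i F i) x = \sum_i coef v (F i) x.
Proof. by rewrite /coef mulr_sumr (E_sum wB hE) (hat_sum wB). Qed.

Lemma coef_scalel z v a x : coef (z *: v) a x = conjc z * coef v a x.
Proof. by rewrite /coef starZ -scalerAl (EZ wB hE) (hat_scale wB). Qed.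

Lemma coef_id u x : PIN B u -> dom u x -> coef u u x = 1.
Proof. by move=> Pu /(domP x Pu) h; rewrite /coef (E_id hE) //; case: Pu. Qed.

Lemma coef_domr v u x : PIN B u -> coef v u x != 0 -> dom u x.
Proof.
move=> Pu; have [pu uu _ _ _] := Pu.
rewrite -{1}pu -mulrA coef_mulr // mulf_eq0 => /norP[_ h].
by apply/(domP x Pu); case: (hat_proj x uu (PIN_proj Pu)) => // h0; rewrite h0 eqxx in h.
Qed.

Lemma coef_doml v a x : PIN B v -> coef v a x != 0 -> dom v x.
Proof.
move=> Pv; have [_ vv _ _ _] := Pv; have [pv _ _ _ _] := PIN_star Pv.
rewrite /coef -{1}pv starK -!mulrA [v^@ * _]mulrA (E_mull wB hE) // (hat_mul wB) //.
rewrite mulf_eq0 => /norP[h _].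
by apply/(domP x Pv); case: (hat_proj x vv (PIN_proj Pv)) => // h0; rewrite h0 eqxx in h.
Qed.

(* [E (u^* v) = u^* v p] with [p] a projection of [B], whence [u a = v p] for
   the partial isometry [a = E (u^* v)] of [B] *)
Lemma germ_eq u v : PIN B u -> PIN B v -> exists p,
  [/\ B p, PI B p, PI B (E (u^@ * v)), u * E (u^@ * v) = v * p
    & (E (u^@ * v))^@ * E (u^@ * v) = p /\ E (u^@ * v) * p = E (u^@ * v)].
Proof.
move=> Pu Pv; have [pu u1 u2 u3 u4] := Pu; have [pv v1 v2 v3 v4] := Pv.
have Pw : PIN B (u^@ * v) by apply: PIN_mul => //; exact: PIN_star.
have [p [Bp sp pp wp Ew]] := E_PIN wB cB mB hE Pw.
have Bs : B (p^@ * p) by rewrite sp pp.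
have EE : (E (u^@ * v))^@ * E (u^@ * v) = p.
  by rewrite Ew starM sp -mulrA [_^@ * (_ * p)]mulrA wp pp.
have Ep : E (u^@ * v) * p = E (u^@ * v) by rewrite Ew -mulrA pp.
have [pvs _ _ _ _] := PIN_star Pv; rewrite /partial_isometry starK in pvs.
have vvp : v^@ * v * p = p.
  rewrite -wp starM starK !mulrA pvs //.
exists p; split=> //.
- by split=> //; rewrite /partial_isometry sp !pp.
- by split; [exact: Ein|rewrite /partial_isometry -mulrA EE Ep].
(* The difference is [(u u^@ - 1) v p]; multiplied on the left by its star it gives
   [p v^@ v p - p w^@ w p = p - p] with [w = u^@ v]. *)
- apply/eqP; rewrite -subr_eq0; apply/eqP/star_mul_eq0.
  rewrite Ew.
  have -> : u * (u^@ * v * p) - v * p = (u * u^@ - 1) * (v * p).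
    by rewrite mulrBl mul1r !mulrA.
  have s1 : (u * u^@ - 1)^@ = u * u^@ - 1 by rewrite starB starM starK star1.
  have s2 : (u * u^@ - 1) * (u * u^@ - 1) = 1 - u * u^@.
    rewrite mulrBr mulr1 mulrBl mul1r -mulrA [u^@ * _]mulrA.
    have -> : u * (u^@ * u * u^@) = u * u^@ by rewrite !mulrA pu.
    by rewrite subrr sub0r opprB.
  rewrite starM s1 -mulrA [(u * u^@ - 1) * _]mulrA s2 mulrBl mul1r starM sp mulrBr.
  have -> : p * v^@ * (v * p) = p by rewrite -mulrA [v^@ * _]mulrA vvp pp.
  have -> : p * v^@ * (u * u^@ * (v * p)) = p * ((u^@ * v)^@ * (u^@ * v) * p).
    by rewrite starM starK !mulrA.
  by rewrite wp pp subrr.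
Qed.

(** In [u a0 = v p], with [a0 = E (u^@ v)], the projection [p = a0^@ a0] is 1 at [x], so [a0] has
    modulus one there. The other two claims follow by applying [E] to [(u a0)^@ a = (v p)^@ a] and
    by conjugating [c] with both sides. *)
Lemma coef_cocycle u v x : PIN B u -> PIN B v -> coef u v x != 0 ->
  [/\ normc (coef u v x) = 1, forall a, coef u a x = coef u v x * coef v a x
    & forall c, B c -> hat (u^@ * c * u) x = hat (v^@ * c * v) x].
Proof.
move=> Pu Pv h0; have [p [Bp [_ pp] [Ba pa] eq [EE Ep]]] := germ_eq Pu Pv.
set a0 := E (u^@ * v) in eq EE Ep Ba pa.
have hp : hat p x = 1.
  have p2 : p * p = p by rewrite -{1}EE -mulrA Ep EE.
  case: (hat_proj x Bp p2) => // hp0; move: h0.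
  by rewrite /coef -/a0 -Ep (hat_mul wB) // hp0 mulr0 eqxx.
have n2 : normc (coef u v x) ^+ 2 = 1.
  by apply: complexI; rewrite -(hat_mulstar wB) // EE hp.
have n1 : normc (coef u v x) = 1.
  by apply/eqP; rewrite -(eqrXn2 (ltn0Sn 1)) ?normc_ge0 // n2 expr1n.
have vE a : coef v a x = conjc (coef u v x) * coef u a x.
  have e1 : E (p^@ * v^@ * a) = p^@ * E (v^@ * a).
    by rewrite -mulrA (E_mull wB hE) //; exact: (sub_star sB).
  have e2 : E ((v * p)^@ * a) = a0^@ * E (u^@ * a).
    by rewrite -eq starM -mulrA (E_mull wB hE) //; exact: (sub_star sB).
  have := congr1 (fun c => hat c x) e2; rewrite starM e1 !(hat_mul wB) ?(hat_star wB) //;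
    try exact: (sub_star sB).
  by rewrite hp conjc1 mul1r.
split=> //.
  by move=> a; rewrite vE mulrA normc_mulJ n1 expr1n mul1r.
move=> c Bc; have [_ _ _ _ u4] := Pu; have [_ _ _ _ v4] := Pv.
have Bu := u4 c Bc; have Bv := v4 c Bc.
have Bas := sub_star sB Ba; have Bps := sub_star sB Bp.
have : hat (a0^@ * (u^@ * c * u) * a0) x = hat (p^@ * (v^@ * c * v) * p) x.
  by congr (hat _ x); rewrite !mulrA -starM -(mulrA _ u a0) eq starM !mulrA.
rewrite (hat_mul wB _ (sub_mul sB Bas Bu) Ba) (hat_mul wB _ Bas Bu).
rewrite (hat_mul wB _ (sub_mul sB Bps Bv) Bp) (hat_mul wB _ Bps Bv) !(hat_star wB) //.
by rewrite hp conjc1 mul1r mulr1 mulrAC [conjc _ * _]mulrC normc_mulJ n1 expr1n mul1r.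
Qed.

Let PI_hat a (b : B) x : val b = a -> gelfand b x = hat a x.
Proof. by move=> <-; rewrite hatE. Qed.

(** If [u a = v b], taking [coef u] at [x] gives [a(x) = coef u v x * b(x)]. Conversely [germ_eq]
    supplies the witnesses [a = E (u^@ v)] and [b = p]. *)
Lemma approxP u v x y : germ_dom (u, x) -> germ_dom (v, y) ->
  Defs.approx (u, x) (v, y) <-> x = y /\ coef u v x != 0.
Proof.
move=> [/= Pu du] [/= Pv dv]; split=> [[/= exy [a [b [Pa Pb na nb eab]]]]|[exy h0]].
  split=> //; have Ba := set_valP a; have Bb := set_valP b.
  have [_ uu _ _ _] := Pu.
  have := coef_mulr u v x Bb; rewrite -eab.
  have -> : coef u (u * val a) x = hat (val a) x by rewrite coef_mulr // coef_id // mul1r.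
  move=> h; apply/eqP => h0; rewrite h0 mul0r hatE in h.
  by move: na; rewrite h normr0 => /eqP; rewrite eq_sym oner_eq0.
split=> //=; have [p [Bp Pp Pa eq [EE Ep]]] := germ_eq Pu Pv.
have [a aE] := hat_exist (proj1 Pa); have [b bE] := hat_exist Bp.
exists a, b; rewrite aE bE; split=> //.
  have [n1 _ _] := coef_cocycle Pu Pv h0.
  by rewrite (PI_hat x aE) normcEn -/(coef u v x) n1.
have [n1 _ _] := coef_cocycle Pu Pv h0.
by rewrite (PI_hat x bE) -EE (hat_mulstar wB) // -/(coef u v x) n1 expr1n normr1.
Qed.

Lemma simP u v x y : germ_dom (u, x) -> germ_dom (v, y) ->
  sim (u, x) (v, y) <-> x = y /\ coef u v x = 1.
Proof.
move=> [/= Pu du] [/= Pv dv]; split=> [[/= exy [a [b [Pa Pb na nb eab]]]]|[exy h1]].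
  split=> //; have Ba := set_valP a; have Bb := set_valP b.
  have := coef_mulr u v x Bb; rewrite -eab coef_mulr // coef_id // mul1r !hatE na nb mulr1.
  by move=> <-.
have h0 : coef u v x != 0 by rewrite h1 oner_eq0.
split=> //=; have [p [Bp Pp Pa eq [EE Ep]]] := germ_eq Pu Pv.
have [a aE] := hat_exist (proj1 Pa); have [b bE] := hat_exist Bp.
exists a, b; rewrite aE bE; split=> //; first by rewrite (PI_hat x aE) -/(coef u v x).
have [n1 _ _] := coef_cocycle Pu Pv h0.
by rewrite (PI_hat x bE) -EE (hat_mulstar wB) // -/(coef u v x) n1 expr1n.
Qed.

Lemma coef_sym u v x : PIN B u -> PIN B v -> dom u x -> coef u v x != 0 ->
  coef u v x * coef v u x = 1.
Proof.
by move=> Pu Pv du h; have [_ h2 _] := coef_cocycle Pu Pv h; rewrite -h2 coef_id.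
Qed.

Section Classes.
(** Both relations at once: [P] is [z == 1] for [sim] and [z != 0] for [approx]. The hypotheses make
    [P] a subgroup of the nonzero scalars. *)
Variable (e : A * spectrum B -> A * spectrum B -> Prop) (P : R[i] -> bool).
Hypothesis eP : forall u v x y, germ_dom (u, x) -> germ_dom (v, y) ->
  e (u, x) (v, y) <-> x = y /\ P (coef u v x).
Hypotheses (P1 : P 1) (P0 : forall z, P z -> z != 0)
  (PM : forall z w : R[i], P z -> P w -> P (z * w))
  (PV : forall z w : R[i], z * w = 1 -> P z -> P w).
Implicit Types s t : classes e.

Lemma is_class_repr s : is_class s (Defs.repr_of s).1 (Defs.repr_of s).2.
Proof. by have [h1 h2] := Defs.repr_ofP s; split; rewrite -surjective_pairing. Qed.

Lemma is_class_ex u x : germ_dom (u, x) -> exists s, is_class s u x.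
Proof.
move=> h; pose s : classes e :=
  exist (fun g : set (A * spectrum B) => g \in classes e) (class_of e (u, x)) (class_in e h).
by exists s.
Qed.

Lemma is_class_inj s t u x : is_class s u x -> is_class t u x -> s = t.
Proof. by move=> [_ h] [_ h']; apply: val_inj; rewrite h h'. Qed.

Lemma is_class_germ s u x : is_class s u x -> PIN B u /\ dom u x.
Proof. by case=> -[]. Qed.

Lemma is_class_rel s u v x y : is_class s u x -> is_class s v y -> x = y /\ P (coef u v x).
Proof.
move=> [gu su] [gv sv]; apply/(eP gu gv).
have : class_of e (v, y) (v, y).
  by split=> //; apply/(eP gv gv); rewrite coef_id //; case: gv.
by rewrite -sv su => -[].
Qed.

Lemma rel_is_class s u v x : is_class s u x -> PIN B v -> P (coef u v x) -> is_class s v x.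
Proof.
move=> [gu su] Pv h; have [Pu du] := gu.
have dv : dom v x by apply: (@coef_domr u) => //; exact: P0.
have gv : germ_dom (v, x) by [].
split=> //; rewrite su; apply/seteqP; split=> -[w y] [gw /=].
  move=> /(eP gu gw)[xy h2]; split=> //; apply/(eP gv gw); split=> //.
  have vu : P (coef v u x).
    by apply: (PV _ h); apply: coef_sym => //; exact: (P0 h).
  have [_ hc _] := coef_cocycle Pv Pu (P0 vu); rewrite (hc w); exact: PM.
move=> /(eP gv gw)[xy h2]; split=> //; apply/(eP gu gw); split=> //.
have [_ hc _] := coef_cocycle Pu Pv (P0 h); rewrite (hc w); exact: PM.
Qed.

End Classes.

End Germs.

(** * Operations of the twist computed on representatives *)

Section Twist.
Context {R : realType} {A : wstarAlgebra R}.
Variables (B : set A) (E : A -> A).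
Implicit Types (a b c h k p u v w : A) (z : R[i]) (x y : spectrum B).
Local Notation "a ^@" := (@star R A a) (at level 2, format "a ^@").
Local Notation hat := (@hat R A B).
Local Notation coef := (@coef R A B E).

Hypotheses (wB : wstar_subalgebra B) (cB : commutative_set B) (mB : maximal_abelian B)
  (hE : conditional_expectation B E).
Let sB : star_subalgebra B. Proof. by case: wB. Qed.
Let Ein := E_in hE.
Let cocycle := coef_cocycle wB cB mB hE.

Let simE u v x y : germ_dom (u, x) -> germ_dom (v, y) ->
  sim (u, x) (v, y) <-> x = y /\ coef u v x == 1.
Proof.
move=> gu gv; split=> [/(simP wB cB mB hE gu gv)[xy /eqP]|[xy /eqP h]] //.
by apply/(simP wB cB mB hE gu gv).
Qed.

Lemma sclass_coef (s : SigmaB B) u v x y : is_class s u x -> is_class s v y ->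
  x = y /\ coef u v x = 1.
Proof.
move=> hu hv.
by have [-> /eqP] := is_class_rel hE (P := fun z => z == 1) simE (eqxx _) hu hv.
Qed.

Lemma sclass_of (s : SigmaB B) u v x : is_class s u x -> PIN B v -> coef u v x = 1 ->
  is_class s v x.
Proof.
move=> hu Pv h; apply: (rel_is_class (P := fun z => z == 1) wB cB mB hE simE _ _ _ hu Pv).
- by move=> z /= /eqP e; rewrite e oner_neq0.
- by move=> z w /= /eqP e /eqP e'; rewrite e e' mulr1.
- by move=> z w /= + /eqP e; rewrite e mul1r => e'; rewrite e'.
- by rewrite h.
Qed.

Lemma sclass_source (s : SigmaB B) u x : is_class s u x -> source s = x.
Proof. by move=> h; have [-> _] := sclass_coef h (is_class_repr s). Qed.

Lemma gclass_coef (g : GB B) u v x y : is_class g u x -> is_class g v y ->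
  x = y /\ coef u v x != 0.
Proof.
move=> hu hv.
exact: (is_class_rel hE (P := fun z => z != 0) (approxP wB cB mB hE) (oner_neq0 _) hu hv).
Qed.

Lemma gclass_of (g : GB B) u v x : is_class g u x -> PIN B v -> coef u v x != 0 ->
  is_class g v x.
Proof.
move=> hu Pv h.
apply: (rel_is_class (P := fun z => z != 0) wB cB mB hE (approxP wB cB mB hE) _ _ _ hu Pv h) => //.
- by move=> z w; exact: mulf_neq0.
- by move=> z w zw _; apply/eqP => w0; move: zw; rewrite w0 mulr0 => /eqP; rewrite eq_sym oner_eq0.
Qed.

Lemma gclass_source (g : GB B) u x : is_class g u x -> source g = x.
Proof. by move=> h; have [-> _] := gclass_coef h (is_class_repr g). Qed.

(** As [phi] is chosen by [xget], a point has to be exhibited: the character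
    [c |-> hat (u^@ c u) x], multiplicative because [u u^@] commutes with [B]. *)
Lemma phi_spec u x : PIN B u -> dom u x ->
  dom u^@ (phi u x) /\ forall c, B c -> hat c (phi u x) = hat (u^@ * c * u) x.
Proof.
move=> Pu du; have [pu u1 u2 u3 u4] := Pu.
have hu := (domP x Pu).1 du.
pose chi : {ptws B -> R[i]^o} := fun c : B => hat (u^@ * val c * u) x.
have Bv (c : B) : B (u^@ * val c * u) by apply: u4; exact: set_valP.
have cchi : characters chi.
  split.
  - have [b1 b1E] := hat_exist (sub_one sB); exists b1.
    by rewrite /chi b1E mulr1 hu oner_neq0.
  - move=> k a b c cE; rewrite /chi cE mulrDr mulrDl -scalerAr -scalerAl.
    exact: (hat_lincomb wB).
  - move=> a b c cE; rewrite /chi cE -(hat_mul wB) //; congr (hat _ x).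
    have := cB (set_valP b) u2.
    have -> : u^@ * val a * u * (u^@ * val b * u) = u^@ * val a * ((u * u^@) * val b) * u.
      by rewrite !mulrA.
    by move=> <-; rewrite -!mulrA [u * (u^@ * u)]mulrA pu.
pose y : spectrum B := exist (fun f => f \in @characters R A B) chi (mem_set cchi).
have hy c : B c -> hat c y = hat (u^@ * c * u) x.
  by move=> Bc; have [c' cE] := hat_exist Bc; rewrite -cE hatE.
have : dom u^@ (phi u x) /\
    forall b c : B, val c = u * val b * u^@ -> gelfand c (phi u x) = gelfand b x.
  apply: (@xgetPex _ x [set y | dom u^@ y /\
    forall b c : B, val c = u * val b * u^@ -> gelfand c y = gelfand b x]).
  exists y; split.
    apply/(domP _ (PIN_star Pu)); rewrite starK hy //.
    by rewrite mulrA -mulrA (PIN_proj Pu).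
  move=> b c cE; rewrite -!hatE hy ?cE; last by rewrite -cE; exact: set_valP.
  have Bb : B (val b) := set_valP b.
  have -> : u^@ * (u * val b * u^@) * u = (u^@ * u) * val b * (u^@ * u) by rewrite !mulrA.
  have B3 : B (u^@ * u * val b) by exact: (sub_mul sB).
  by rewrite (hat_mul wB _ B3 u1) (hat_mul wB _ u1 Bb) hu mul1r mulr1.
(* The definition of [phi] tests only elements [u b u^@]; a general [c] is first cut by [u u^@],
   whose transform is 1 at this point. *)
move=> [d h]; split=> // c Bc.
have Bc' := u4 c Bc; have Bc'' := u3 _ Bc'.
have [c1 c1E] := hat_exist Bc'; have [c2 c2E] := hat_exist Bc''.
have := h c1 c2; rewrite c1E c2E => /(_ erefl); rewrite -!hatE c1E c2E => <-.
have -> : u * (u^@ * c * u) * u^@ = (u * u^@) * c * (u * u^@) by rewrite !mulrA.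
have hd := (domP _ (PIN_star Pu)).1 d; rewrite starK in hd.
have B3 : B (u * u^@ * c) by exact: (sub_mul sB).
by rewrite (hat_mul wB _ B3 u2) (hat_mul wB _ u2 Bc) hd mul1r mulr1.
Qed.

Lemma hat_phi u x c : PIN B u -> dom u x -> B c -> hat c (phi u x) = hat (u^@ * c * u) x.
Proof. by move=> Pu du; have [_ h] := phi_spec Pu du; exact: h. Qed.

Lemma dom_phi u x : PIN B u -> dom u x -> dom u^@ (phi u x).
Proof. by move=> Pu du; have [] := phi_spec Pu du. Qed.

Lemma phi_germ u v x : PIN B u -> PIN B v -> coef u v x != 0 -> phi u x = phi v x.
Proof.
move=> Pu Pv h; have [_ _ hc] := cocycle Pu Pv h.
have du := coef_doml wB hE Pu h; have dv := coef_domr wB hE Pv h.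
by apply: spectrum_ext => c Bc; rewrite !hat_phi // hc.
Qed.

Lemma phi_mul u v x : PIN B u -> PIN B v -> dom v x -> dom u (phi v x) ->
  dom (u * v) x /\ phi (u * v) x = phi u (phi v x).
Proof.
move=> Pu Pv dv du; have Puv := PIN_mul cB Pu Pv.
have [_ uu _ _ u4] := Pu.
have duv : dom (u * v) x.
  apply/(domP _ Puv); have := (domP _ Pu).1 du.
  by rewrite (hat_phi Pv dv uu) starM !mulrA.
split=> //; apply: spectrum_ext => c Bc; rewrite !hat_phi //; last exact: u4.
by rewrite starM !mulrA.
Qed.

Lemma phiK u x : PIN B u -> dom u x -> phi u^@ (phi u x) = x.
Proof.
move=> Pu du; have Pus := PIN_star Pu; have dus := dom_phi Pu du.
have [_ uu _ u3 _] := Pu.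
apply: spectrum_ext => c Bc; rewrite hat_phi // starK hat_phi //; last exact: u3.
have -> : u^@ * (u * c * u^@) * u = (u^@ * u) * c * (u^@ * u) by rewrite !mulrA.
have B3 : B (u^@ * u * c) by exact: (sub_mul sB).
have hu := (domP x Pu).1 du.
by rewrite (hat_mul wB _ B3 uu) (hat_mul wB _ uu Bc) hu mul1r mulr1.
Qed.

Lemma sclass_target (s : SigmaB B) u x : is_class s u x -> target s = phi u x.
Proof.
move=> h; have hr := is_class_repr s.
have [xE c1] := sclass_coef h hr; rewrite /target -xE.
have [Pu _] := is_class_germ h; have [Pr _] := is_class_germ hr.
by apply/esym/phi_germ => //; rewrite c1 oner_neq0.
Qed.

Lemma gclass_target (g : GB B) u x : is_class g u x -> target g = phi u x.
Proof.
move=> h; have hr := is_class_repr g.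
have [xE c1] := gclass_coef h hr; rewrite /target -xE.
have [Pu _] := is_class_germ h; have [Pr _] := is_class_germ hr.
exact/esym/phi_germ.
Qed.

Lemma liftG_class (g : GB B) : is_class (liftG g) (Defs.repr_of g).1 (Defs.repr_of g).2.
Proof. by have [h1 _] := Defs.repr_ofP g; split; rewrite -surjective_pairing. Qed.

Lemma coef_scaler v z a x : coef v (z *: a) x = z * coef v a x.
Proof. by rewrite -[z *: a]addr0 coef_lincomb // /coef mulr0 (E0 wB hE) (hat_zero wB) addr0. Qed.

(** [xget] returns a class built from some representative of [s], which is compared with the given
    one; [Sinv_class] and [Smul_class] follow the same pattern. *)
Lemma Sact_class (s : SigmaB B) u x z : `|z| = 1 -> is_class s u x -> is_class (Sact s z) (z *: u) x.
Proof.
move=> z1 h; have zz := normc1_mulJ z1.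
have [Pu du] := is_class_germ h; have Pzu := PIN_scale z1 Pu.
have e v : coef (z *: u) (z *: v) x = coef u v x.
  by rewrite coef_scalel // coef_scaler mulrA [conjc z * z]mulrC zz mul1r.
have dzu : dom (z *: u) x.
  by apply: (coef_domr wB hE (v := z *: u)) => //; rewrite e (coef_id hE Pu du) oner_neq0.
have [r hr] : exists r : SigmaB B, is_class r (z *: u) x by exact: is_class_ex.
have : exists v y, is_class s v y /\ is_class (Sact s z) (z *: v) y.
  apply: (@xgetPex _ s [set r : SigmaB B | exists v y, is_class s v y /\ is_class r (z *: v) y]).
  by exists r, u, x.
move=> [v [y [hv hzv]]]; have [xy c1] := sclass_coef hv h.
rewrite -xy; apply: sclass_of hzv Pzu _.
rewrite coef_scalel // coef_scaler mulrA [conjc z * z]mulrC zz mul1r //.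
Qed.

Lemma Sinv_class (s : SigmaB B) u x : is_class s u x -> is_class (Sinv s) u^@ (phi u x).
Proof.
move=> h; have [Pu du] := is_class_germ h; have Pus := PIN_star Pu.
have [r hr] : exists r : SigmaB B, is_class r u^@ (phi u x).
  by apply: is_class_ex; split=> //=; exact: dom_phi.
have : exists v y, is_class s v y /\ is_class (Sinv s) v^@ (phi v y).
  apply: (@xgetPex _ s [set r : SigmaB B | exists v y, is_class s v y /\ is_class r v^@ (phi v y)]).
  by exists r, u, x.
move=> [v [y [hv hsv]]]; have [xy c1] := sclass_coef h hv.
have [Pv dv] := is_class_germ hv; subst y.
have ph : phi u x = phi v x by apply: phi_germ => //; rewrite c1 oner_neq0.
rewrite ph; apply: sclass_of hsv (Pus) _.
(* Equivariance under [v] moves [E (v u^@)] from [phi v x] to [x], where it becomes [coef u v x]. *)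
have Pvu : PIN B (v * u^@) by exact: (PIN_mul cB).
rewrite /coef starK hat_phi // -(E_conj wB cB mB hE Pv (PINB_PIN sB Pvu)).
have [_ vv _ _ _] := Pv.
have -> : v^@ * (v * u^@) * v = (v^@ * v) * (u^@ * v) by rewrite !mulrA.
rewrite (E_mull wB hE) // (hat_mul wB) // ((domP x Pv).1 dv) mul1r.
exact: c1.
Qed.

Lemma Smul_class (s t : SigmaB B) u v x : is_class s u (phi v x) -> is_class t v x ->
  is_class (Smul s t) (u * v) x.
Proof.
move=> hs ht; have [Pu du] := is_class_germ hs; have [Pv dv] := is_class_germ ht.
have [duv _] := phi_mul Pu Pv dv du; have Puv := PIN_mul cB Pu Pv.
have [r hr] : exists r : SigmaB B, is_class r (u * v) x by exact: is_class_ex.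
have : exists u' v' x', [/\ is_class s u' (phi v' x'), is_class t v' x' &
    is_class (Smul s t) (u' * v') x'].
  apply: (@xgetPex _ s [set r : SigmaB B | exists u v x,
    [/\ is_class s u (phi v x), is_class t v x & is_class r (u * v) x]]).
  by exists r, u, v, x.
move=> [u' [v' [x' [hs' ht' hr']]]].
have [xx c1] := sclass_coef ht' ht; subst x'.
have [Pu' du'] := is_class_germ hs'; have [Pv' dv'] := is_class_germ ht'.
have n1 : coef v' v x != 0 by rewrite c1 oner_neq0.
have ph : phi v' x = phi v x by exact: phi_germ.
have [_ c2] := sclass_coef hs' hs.
apply: sclass_of hr' Puv _.
(* The cocycle identity splits off [coef v' v x = 1]; the rest is [E (u'^@ u)] at [phi v x] by
   equivariance, that is the comparison of [u'] with [u]. *)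
have -> : coef (u' * v') (u * v) x = coef v' (u'^@ * u * v) x.
  by rewrite /coef starM !mulrA.
have [_ hc _] := cocycle Pv' Pv n1; rewrite hc c1 mul1r.
have Pw : PIN B (u'^@ * u) by apply: (PIN_mul cB) => //; exact: PIN_star.
rewrite /coef mulrA (E_conj wB cB mB hE Pv (PINB_PIN sB Pw)) -hat_phi // -ph.
exact: c2.
Qed.

Definition jmap a (s : SigmaB B) := coef (Defs.repr_of s).1 a (Defs.repr_of s).2.

Lemma jmapE (s : SigmaB B) v x a : is_class s v x -> jmap a s = coef v a x.
Proof.
move=> h; have hr := is_class_repr s; have [xE c1] := sclass_coef h hr.
have [Pv _] := is_class_germ h; have [Pr _] := is_class_germ hr.
have n1 : coef v (Defs.repr_of s).1 x != 0 by rewrite c1 oner_neq0.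
by have [_ hc _] := cocycle Pv Pr n1; rewrite hc c1 mul1r /jmap -xE.
Qed.

(** If [s] is the class of [z *: u] at [x], then [1 = coef v (z *: u) x = z * coef v u x], so the
    conjugate of [z] is [coef v u x]. *)
Lemma Delta_class u (s : SigmaB B) v x : PIN B u -> is_class s v x -> Delta u s = coef v u x.
Proof.
move=> Pu h; have [Pv dv] := is_class_germ h.
have key (w : R[i]) : (exists z t, [/\ `|z| = 1, bisection u t, s = Sact t z & w = z^*%C]) -> w = coef v u x.
  move=> [z [t [z1 [y hy] sE ->]]].
  have := Sact_class z1 hy; rewrite -sE => h'.
  have [xy c1] := sclass_coef h h'.
  by move: c1; rewrite coef_scaler => c1; rewrite -[RHS]mul1r -[1](normc1_mulJ z1) mulrAC c1 mul1r.
(* If the coefficient is 0, either no pair exists and [xget] returns its default 0, or [key]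
   applies. *)
have [c0|c0] := eqVneq (coef v u x) 0.
  rewrite c0 /Delta; have [//|h'] := pselect ([set w : R[i] | exists z (t : SigmaB B),
    [/\ `|z| = 1, bisection u t, s = Sact t z & w = z^*%C]] !=set0); last first.
    by apply: xgetPN => w hw; apply: h'; exists w.
  move=> ex; have := xgetPex 0 ex; set w := xget _ _; move=> /key; rewrite c0; exact.
have [n1 _ _] := cocycle Pv Pu c0.
have du := coef_domr wB hE Pu c0.
have [t ht] : exists t : SigmaB B, is_class t u x by exact: is_class_ex.
apply: (xget_unique _ _ key) => /=.
exists (conjc (coef v u x)), t.
have z1 : `|conjc (coef v u x)| = 1 by rewrite normcEn normc_conj n1.
split=> //; first by exists x.
  apply: is_class_inj h _; apply: (sclass_of (Sact_class z1 ht) Pv).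
  rewrite coef_scalel // conjcK mulrC; apply: (coef_sym wB cB mB hE) => //.
  by have := coef_sym wB cB mB hE Pv Pu dv c0; case: eqP => // -> ; rewrite mulr0 => /esym/eqP; rewrite oner_eq0.
by rewrite conjcK.
Qed.

Lemma jmap_sum n (u : 'I_n -> A) (b : 'I_n -> B) : (forall i, PIN B (u i)) ->
  jmap (\sum_(i < n) u i * val (b i)) = \sum_(i < n) Delta_mul (u i) (gelfand (b i)).
Proof.
move=> Pu; apply/funext => s; have h := is_class_repr s.
rewrite fct_sumE /jmap coef_bigsum //; apply: eq_bigr => i _.
rewrite /Delta_mul (Delta_class (Pu i) h) (sclass_source h) -hatE coef_mulr //.
exact: set_valP.
Qed.

Lemma jmap_lincomb z a b : jmap (z *: a + b) = fun s => z * jmap a s + jmap b s.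
Proof. by apply/funext => s; rewrite /jmap coef_lincomb. Qed.

Lemma tilde_jmap (b : B) : tilde (gelfand b) = jmap (val b).
Proof.
apply/funext => s; have h := is_class_repr s.
set v := (Defs.repr_of s).1 in h; set x := (Defs.repr_of s).2 in h.
rewrite (jmapE _ h); have [Pv dv] := is_class_germ h.
have P1 := PIN_one sB.
have -> : coef v (val b) x = coef v 1 x * gelfand b x.
  by rewrite -[val b]mul1r coef_mulr ?hatE //; exact: set_valP.
have key (w : R[i]) : (exists (z : R[i]) y, [/\ `|z| = 1, is_class s (z *: 1) y & w = z^*%C * gelfand b y]) ->
    w = coef v 1 x * gelfand b x.
  move=> [z [y [z1 h' ->]]]; have [xy c1] := sclass_coef h h'; rewrite -xy; congr (_ * _).
  by move: c1; rewrite coef_scaler => c1; rewrite -[RHS]mul1r -[1](normc1_mulJ z1) mulrAC c1 mul1r.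
have [c0|c0] := eqVneq (coef v 1 x) 0.
  rewrite c0 mul0r; have [ex|h'] := pselect ([set w : R[i] | exists (z : R[i]) y,
    [/\ `|z| = 1, is_class s (z *: 1) y & w = z^*%C * gelfand b y]] !=set0); last first.
    by apply: xgetPN => w hw; apply: h'; exists w.
  by have := xgetPex 0 ex => /key; rewrite c0 mul0r.
apply: (xget_unique _ _ key) => /=.
have [n1 _ _] := cocycle Pv P1 c0.
exists (conjc (coef v 1 x)), x.
have z1 : `|conjc (coef v 1 x)| = 1 by rewrite normcEn normc_conj n1.
split=> //; last by rewrite conjcK.
apply: sclass_of h (PIN_scale z1 P1) _.
by rewrite coef_scaler mulrC normc_mulJ n1 expr1n.
Qed.

(** At the inverse germ the value is [E (v a)] at [phi v x]; equivariance moves it to [E (a v)] at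
    [x], the conjugate of [E (v^@ a^@)] there. *)
Lemma convstar_jmap a : PINB B a -> jmap a^@ = convstar (jmap a).
Proof.
move=> Pa; apply/funext => s; have h := is_class_repr s.
set v := (Defs.repr_of s).1 in h; set x := (Defs.repr_of s).2 in h.
have [Pv dv] := is_class_germ h; have [_ vv _ _ _] := Pv.
rewrite (jmapE _ h) /convstar (jmapE _ (Sinv_class h)) /coef starK.
rewrite hat_phi // -(E_conj wB cB mB hE Pv); last first.
  by apply: (sub_mul (PINB_star_subalgebra sB cB)) => //; exact: PINB_PIN.
have -> : v^@ * (v * a) * v = (v^@ * v) * (a * v) by rewrite !mulrA.
rewrite (E_mull wB hE (b := v^@ * v)) // (hat_mul wB) // ((domP x Pv).1 dv) mul1r.
by rewrite -[RHS]/(conjc _) -(hat_star wB) // -(E_star wB hE) starM.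
Qed.

End Twist.

Lemma conj_unit_mul (R : realType) (k z w : R[i]) : normc k = 1 ->
  (k * z)^* * (k * w) = z^* * w.
Proof.
move=> k1; have kk : k^* * k = 1 by rewrite mulrC -[_^*]/(conjc k) normc_mulJ k1 expr1n.
by rewrite rmorphM /= mulrACA kk mul1r.
Qed.

(** * Convolution and scalar product on fibres *)

Section Convolution.
Context {R : realType} {A : wstarAlgebra R}.
Variables (B : set A) (E : A -> A).
Implicit Types (a b c h k p u v w : A) (z : R[i]) (x y : spectrum B).
Local Notation "a ^@" := (@star R A a) (at level 2, format "a ^@").
Local Notation hat := (@hat R A B).
Local Notation coef := (@coef R A B E).
Local Notation jmap := (@jmap R A B E).

Hypotheses (wB : wstar_subalgebra B) (cB : commutative_set B) (mB : maximal_abelian B)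
  (hE : conditional_expectation B E).
Let sB : star_subalgebra B. Proof. by case: wB. Qed.
Let Ein := E_in hE.
Let cocycle := coef_cocycle wB cB mB hE.

Lemma fsum_sum_val (T : choiceType) (S : set T) n (f : 'I_n -> T -> R[i]) (F : 'I_n -> R[i]) :
  (forall i, exists o : option T, [/\ forall t, o = Some t -> S t /\ f i t = F i,
     o = None -> F i = 0 & forall t, S t -> o <> Some t -> f i t = 0]) ->
  \sum_(t \in S) \sum_(i < n) f i t = \sum_(i < n) F i.
Proof.
move=> /choice[pts hp].
rewrite (@fsum_sum _ _ S n f pts) => [|i t|i t]; last 2 first.
- by have [h _ _] := hp i; move=> /h[].
- by have [_ _ h] := hp i; exact: h.
apply: eq_bigr => i _; have [h1 h2 h3] := hp i; case e : (pts i) => [t0|].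
  have [St0 <-] := h1 t0 e; apply: fsum_point => // t St tt; apply: h3 => //.
  by rewrite e => -[] /esym.
rewrite (h2 e); apply: fsbig1 => t St; apply: h3 => //; by rewrite e.
Qed.

Lemma hat_conj_coef v a x : PIN B v -> dom v x -> PINB B a ->
  hat (E a) (phi v x) = coef v (a * v) x.
Proof.
move=> Pv dv Pa.
by rewrite (hat_phi wB cB) // -(E_conj wB cB mB hE) // /coef mulrA.
Qed.

(** Independence of the lift: replacing the representative [w] of [g] by [u] multiplies the two
    factors by the mutually inverse scalars [coef u w y] and [coef w u y]. *)
Lemma conv_term (g : GB B) (s : SigmaB B) u v x y a b : is_class g u y ->
  is_class s v x -> target g = target s ->
  jmap a (liftG g) * jmap b (Smul (Sinv (liftG g)) s) =
    coef u a y * coef (u^@ * v) b x.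
Proof.
move=> hu hs; have hw := is_class_repr g; have hl := liftG_class g.
have [yE n0] := gclass_coef wB cB mB hE hw hu; rewrite yE in hw hl n0.
set w := (Defs.repr_of g).1 in hw hl n0.
have [Pu du] := is_class_germ hu; have [Pw dw] := is_class_germ hw.
have [Pv dv] := is_class_germ hs.
rewrite (gclass_target wB cB mB hE hu) (sclass_target wB cB mB hE hs) => tE.
have wE : phi w y = phi v x by rewrite (phi_germ wB cB mB hE Pw Pu n0).
have := Sinv_class wB cB mB hE hl; rewrite wE => hi.
rewrite (jmapE wB cB mB hE a hl) (jmapE wB cB mB hE b (Smul_class wB cB mB hE hi hs)).
have [Pus Pws] := (PIN_star Pu, PIN_star Pw).
have uw : coef (w^@ * v) (u^@ * v) x = coef u w y.
  have -> : coef (w^@ * v) (u^@ * v) x = coef v (w * u^@ * v) x.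
    by rewrite /coef starM starK !mulrA.
  have Pwu : PINB B (w * u^@) by apply: (PINB_PIN sB); exact: (PIN_mul cB).
  rewrite -hat_conj_coef // -tE hat_conj_coef // -mulrA.
  have [_ uu _ _ _] := Pu.
  by rewrite (coef_mulr wB hE) // ((domP y Pu).1 du) mulr1.
have [_ hwu _] := cocycle Pw Pu n0.
have inv := coef_sym wB cB mB hE Pw Pu dw n0.
have n2 : coef (w^@ * v) (u^@ * v) x != 0.
  by rewrite uw; apply/eqP => e0; move: inv; rewrite e0 mulr0 => /eqP; rewrite eq_sym oner_eq0.
have [_ hwv _] := cocycle (PIN_mul cB Pws Pv) (PIN_mul cB Pus Pv) n2.
by rewrite hwu hwv uw mulrACA inv mul1r.
Qed.

(** Left multiplication by [u c] contributes a single convolution term, at the germ of [u] whose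
    target is [phi v x]. *)
Lemma coef_mul_PIN u c b v x : PIN B u -> B c -> PIN B v -> dom v x ->
  dom u^@ (phi v x) ->
  coef v (u * c * b) x = hat c (phi u^@ (phi v x)) * coef (u^@ * v) b x.
Proof.
move=> Pu Bc Pv dv du; have Pus := PIN_star Pu; have Pw := PIN_mul cB Pus Pv.
have [dw <-] := phi_mul wB cB Pus Pv dv du; rewrite (hat_phi wB cB) //.
set w := u^@ * v in Pw dw *; have [pw w1 w2 w3 w4] := Pw.
have wE : v^@ * u = w^@ by rewrite /w starM starK.
clearbody w; rewrite /coef 2!mulrA wE -(hat_mul wB) //; last exact: w4.
rewrite -(E_mull wB hE) //; last exact: w4.
have -> : w^@ * c * w * (w^@ * b) = w^@ * (c * (w * w^@)) * b by rewrite !mulrA.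
rewrite (cB Bc w2) !mulrA.
have [pws _ _ _ _] := PIN_star Pw; rewrite /partial_isometry starK in pws. by rewrite pws.
Qed.

Lemma coef_mul_dom u a v x : PIN B u -> PIN B v -> coef v (u * a) x != 0 ->
  dom u^@ (phi v x).
Proof.
move=> Pu Pv h; have dv := coef_doml wB hE Pv h.
have [pu _ u2 _ _] := Pu; have [_ _ v2 _ v4] := Pv.
have [pvs _ _ _ _] := PIN_star Pv; rewrite /partial_isometry starK in pvs.
apply/(domP _ (PIN_star Pu)); rewrite starK.
have := PIN_proj (PIN_star Pu); rewrite starK => pp.
case: (hat_proj wB (phi v x) u2 pp) => // h0; move: h.
rewrite (hat_phi wB cB) // in h0.
have -> : coef v (u * a) x = hat (v^@ * (u * u^@) * v) x * coef v (u * a) x.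
  rewrite /coef -(hat_mul wB) //; last exact: v4.
  rewrite -(E_mull wB hE) //; last exact: v4.
  have -> : v^@ * (u * u^@) * v * (v^@ * (u * a)) = v^@ * ((u * u^@) * (v * v^@)) * (u * a).
    by rewrite !mulrA.
  rewrite (cB u2 v2) !mulrA pvs -!mulrA; congr (hat (E (_ * _)) x).
  by rewrite !mulrA pu.
by rewrite h0 mul0r eqxx.
Qed.

(** By linearity [a] is a single [u c]. Its function lives on the bisection of [u], which has at
    most one arrow with the target of [s], so the sum reduces to the term given by
    [coef_mul_PIN]. *)
Lemma conv_jmap a b : PINB B a -> Defs.conv (jmap a) (jmap b) = jmap (a * b).
Proof.
move=> [n [u [c [Pu Bc ->]]]]; apply/funext => s; have hs := is_class_repr s.
set v := (Defs.repr_of s).1 in hs; set x := (Defs.repr_of s).2 in hs.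
have [Pv dv] := is_class_germ hs.
rewrite (jmapE wB cB mB hE _ hs) mulr_suml (coef_bigsum wB hE) /Defs.conv.
pose f i (t : GB B) := jmap (u i * c i) (liftG t) * jmap b (Smul (Sinv (liftG t)) s).
rewrite (eq_fsbigr (fun t => \sum_(i < n) f i t)); last first.
  by move=> t _; rewrite {1}/jmap (coef_bigsum wB hE) mulr_suml.
have tE := sclass_target wB cB mB hE hs.
have supp i t : target t = target s -> f i t <> 0 -> 
    dom (u i)^@ (phi v x) /\ is_class t (u i) (phi (u i)^@ (phi v x)).
  move=> tt fn; have ht := is_class_repr t; have [Pw dw] := is_class_germ ht.
  have n0 : coef (Defs.repr_of t).1 (u i) (Defs.repr_of t).2 != 0.
    apply/eqP => e0; apply: fn; rewrite /f (conv_term _ _ ht hs tt).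
    by rewrite (coef_mulr wB hE) // e0 !mul0r.
  have hu := gclass_of wB cB mB hE ht (Pu i) n0.
  have [_ du] := is_class_germ hu.
  rewrite -tE -tt (gclass_target wB cB mB hE hu); split; first exact: (dom_phi wB cB).
  by rewrite (phiK wB cB).
(* If the target of [s] is outside the range of [u i], both the term and the coefficient of the
   product vanish. *)
apply: fsum_sum_val => i; have [du|du] := pselect (dom (u i)^@ (phi v x)); last first.
  exists None; split=> //.
    by move=> _; apply: contrapT => /eqP h; apply: du; move: h; rewrite -mulrA; exact: coef_mul_dom.
  move=> t St _; have [//|/eqP fn] := eqVneq (f i t) 0.
  by have [] := supp i t St fn.
have Pus := PIN_star (Pu i).
have [t0 ht0] : exists t : GB B, is_class t (u i) (phi (u i)^@ (phi v x)).
  by apply: is_class_ex; split=> //=; rewrite -{1}[u i]starK; exact: (dom_phi wB cB).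
have St0 : target t0 = target s.
  by rewrite (gclass_target wB cB mB hE ht0) tE -{1}[u i]starK (phiK wB cB).
exists (Some t0); split=> //.
  move=> _ [<-]; split=> //; rewrite /f (conv_term _ _ ht0 hs St0) coef_mul_PIN //.
  have [_ du0] := is_class_germ ht0.
  by rewrite (coef_mulr wB hE) // (coef_id hE) // mul1r.
move=> t St tt; have [//|/eqP fn] := eqVneq (f i t) 0.
have [_ ht] := supp i t St fn.
by exfalso; apply: tt; congr Some; exact: is_class_inj ht0 ht.
Qed.

(** The bisection of each [u i] meets the fibre over [x] in at most one germ, where the scalars of
    modulus one cancel. After integration this identifies [L2dot] with the form of [m o E]. *)
Lemma fiber_jmap a b x : PINB B a ->
  \sum_(t \in [set t : GB B | source t = x])
     (jmap a (liftG t))^* * jmap b (liftG t) = hat (E (a^@ * b)) x.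
Proof.
move=> [n [u [c [Pu Bc ->]]]].
rewrite star_sum mulr_suml (E_sum wB hE) (hat_sum wB) //.
pose f i (t : GB B) := (jmap (u i * c i) (liftG t))^* * jmap b (liftG t).
rewrite (eq_fsbigr (fun t => \sum_(i < n) f i t)); last first.
  by move=> t _; rewrite {1}/jmap (coef_bigsum wB hE) raddf_sum mulr_suml.
have hc i : hat (E ((u i * c i)^@ * b)) x = (hat (c i) x)^* * coef (u i) b x.
  have Bcs := sub_star sB (Bc i).
  by rewrite starM -mulrA (E_mull wB hE) // (hat_mul wB) // (hat_star wB).
have supp i t : source t = x -> f i t <> 0 -> is_class t (u i) x.
  move=> <- fn; have ht := is_class_repr t; apply: (gclass_of wB cB mB hE ht) => //.
  apply/eqP => e0; apply: fn; rewrite /f (jmapE wB cB mB hE _ (liftG_class t)).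
  by rewrite (coef_mulr wB hE) // e0 mul0r conjC0 mul0r.
apply: fsum_sum_val => i; have [du|du] := pselect (dom (u i) x); last first.
  exists None; split=> //.
    move=> _; rewrite hc; have [->|h] := eqVneq (coef (u i) b x) 0; first by rewrite mulr0.
    by case: du; exact: (coef_doml wB hE (Pu i) h).
  move=> t St _; have [//|/eqP fn] := eqVneq (f i t) 0.
  by have [] := is_class_germ (supp i t St fn).
have [t0 ht0] : exists t : GB B, is_class t (u i) x by apply: is_class_ex; split=> /=.
exists (Some t0); split=> //.
  move=> _ [<-]; split; first exact: (gclass_source wB cB mB hE ht0).
  have hl := liftG_class t0; have hw := is_class_repr t0.
  have [xE n0] := gclass_coef wB cB mB hE hw ht0; rewrite xE in hl n0.
  have [Pw _] := is_class_germ hl; have [n1 hwu _] := cocycle Pw (Pu i) n0.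
  rewrite hc /f !(jmapE wB cB mB hE _ hl) (hwu b) (hwu (u i * c i)).
  rewrite (coef_mulr wB hE) // (coef_id hE) // mul1r.
  exact: conj_unit_mul.
move=> t St tt; have [//|/eqP fn] := eqVneq (f i t) 0.
by exfalso; apply: tt; congr Some; exact: is_class_inj ht0 (supp i t St fn).
Qed.

End Convolution.

(** * The regular representation *)

Section CartanState.
Context {R : realType} {A : wstarAlgebra R}.
Variables (B : set A) (E : A -> A) (m : B -> R[i]).
Implicit Types (a b c h k p u v w : A) (z : R[i]) (x y : spectrum B).
Local Notation "a ^@" := (@star R A a) (at level 2, format "a ^@").
Local Notation hat := (@hat R A B).
Local Notation jmap := (@jmap R A B E).

Hypotheses (wB : wstar_subalgebra B) (cB : commutative_set B) (mB : maximal_abelian B)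
  (hE : conditional_expectation B E) (fE : faithful_map E) (nE : normal_map B E)
  (hm : faithful_normal_state m).
Let sB : star_subalgebra B. Proof. by case: wB. Qed.
Let Ein := E_in hE.

Definition expect a : B := exist (fun b => b \in B) (E a) (mem_set (Ein a)).
Definition state a := m (expect a).

Lemma state_positive : positive_functional state.
Proof.
have [ml _ mp _ _] := hm; split=> [k a b|a pa].
  by apply: ml; rewrite /= (E_lin hE).
by apply: mp; apply/(pos_inP wB (Ein a)); exact: (E_pos wB hE).
Qed.

(** A chain is an increasing family in [A]; normality of [E] carries its supremum to the one in [B],
    where that of [m] applies. The notions of positivity involved agree by [pos_inP]. *)
Lemma state_normal : chain_normal state.
Proof.
move=> S s S0 pS tS ub lub c hc.
have [a0 Sa0] := S0.
have ps : apos s by rewrite -[s](subrK a0); apply: aposD; [exact: ub|exact: pS].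
have posT a : pos_in [set: A] a <-> apos a := pos_inP wstar_setT I.
have chain a b : S a -> S b -> exists c, [/\ S c, apos (c - a) & apos (c - b)].
  move=> Sa Sb; have [h|h] := tS a b Sa Sb; [exists b|exists a]; rewrite subrr; split=> //; exact: apos0.
have incS : increases_to [set: A] S s.
  split=> //.
  - by move=> a Sa; apply/posT; exact: pS.
  - move=> a b Sa Sb; have [d [Sd da db]] := chain a b Sa Sb.
    by exists d; split=> //; apply/posT.
  - split=> // [a Sa|t _ ht]; apply/posT; first exact: ub.
    by apply: lub => a Sa; apply/posT; exact: ht.
have lubE := nE incS.
pose SB : set B := [set b | (E @` S) (val b)].
have SBE : val @` SB = E @` S.
  apply/seteqP; split=> [_ [b Sb <-] //|_ [a Sa <-]].
  by exists (expect a) => //; exists a.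
have incB : increases_to B (val @` SB) (val (expect s)).
  rewrite SBE; split=> //.
  - by exists (E a0), a0.
  - by move=> _ [a Sa <-]; apply/(pos_inP wB (Ein a)); apply: (E_pos wB hE); exact: pS.
  - move=> _ _ [a Sa <-] [b Sb <-]; have [d [Sd da db]] := chain a b Sa Sb.
    exists (E d); split; first by exists d.
    + rewrite /le_in -(EB wB hE); apply/(pos_inP wB (Ein _)); exact: (E_pos wB hE).
    + rewrite /le_in -(EB wB hE); apply/(pos_inP wB (Ein _)); exact: (E_pos wB hE).
have [_ _ _ _ mn] := hm.
have : m (expect s) <= c%:C%C.
  apply: (mn SB _ incB) => b [a Sa eb].
  have -> : b = expect a by apply: val_inj.
  by rewrite -/(state a) (pf_Re state_positive (pS a Sa)) lecR; exact: hc.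
by rewrite -/(state s) {1}(pf_Re state_positive ps) lecR.
Qed.

Lemma state_faithful a : state (a^@ * a) = 0 -> a = 0.
Proof.
have [_ _ _ mf _] := hm; move=> h; apply: star_mul_eq0; apply: fE.
  by exists a.
apply: (mf (expect (a^@ * a))) => //; apply/(pos_inP wB (Ein _)).
by apply: (E_pos wB hE); exact: apos_mulstar.
Qed.

(* [f] is the integral for [mu]: of it one only needs that [m] depends on [b]
   through its Gelfand transform. *)
Lemma state_hat_inj (f : (spectrum B -> R[i]) -> R[i]) :
  (forall b : B, m b = f (gelfand b)) ->
  forall b, B b -> (forall x, hat b x = 0) -> b = 0.
Proof.
move=> mE b Bb h; have [ml _ _ mf _] := hm; apply: star_mul_eq0.
have [c cE] := hat_exist (sub_mul sB (sub_star sB Bb) Bb).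
have [z0 zE] := hat_exist (sub_zero sB).
rewrite -cE; apply: mf.
  by apply/(pos_inP wB (set_valP c)); rewrite cE; exact: apos_mulstar.
have -> : m c = m z0.
  rewrite !mE; congr f; apply/funext => x; rewrite -!hatE cE zE hat_mulstar // h.
  by rewrite normc0 expr0n (hat_zero wB).
have := ml (-1) z0 z0 z0; rewrite zE scaler0 addr0 => /(_ erefl).
by rewrite mulN1r addNr.
Qed.

Hypothesis hat_inj : forall b, B b -> (forall x, hat b x = 0) -> b = 0.

(** Vanishing of the function means [E (u^@ a) = 0] for all [u] in PIN(B), by [hat_inj]. Expanding
    the left factor gives [E (a^@ a) = 0], and [E] is faithful. *)
Lemma jmap_inj0 a : PINB B a -> (forall s, jmap a s = 0) -> a = 0.
Proof.
move=> Pa h.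
have E0 u : PIN B u -> E (u^@ * a) = 0.
  move=> Pu; apply: hat_inj => // x; rewrite -/(coef E u a x).
  have [//|n0] := eqVneq (coef E u a x) 0.
  have du := coef_doml wB hE Pu n0.
  have [s hs] : exists s : SigmaB B, is_class s u x by apply: is_class_ex.
  by have := h s; rewrite (jmapE wB cB mB hE a hs).
apply: star_mul_eq0; apply: fE; first by exists a.
have [n [u [b [Pu Bb aE]]]] := Pa.
rewrite {1}aE star_sum mulr_suml (E_sum wB hE) big1 // => i _.
by rewrite starM -mulrA (E_mull wB hE) ?E0 ?mulr0 //; exact: (sub_star sB).
Qed.

(** Surjectivity of the Gelfand transform lifts the continuous coefficients of a function in [Cc] to
    [B]. *)
Lemma Cc_jmap : jmap @` (PINB B) = @Cc R A B.
Proof.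
apply/seteqP; split=> [_ [a [n [u [b [Pu Bb ->]]]] <-]|f [n [u [b [Pu cb ->]]]]].
  have /choice[c cE] : forall i, exists c : B, val c = b i by move=> i; exact: hat_exist.
  exists n, u, (fun i => gelfand (c i)); split=> // [i|]; first exact: gelfand_continuous.
  by rewrite -(jmap_sum wB cB mB hE c Pu); congr jmap; apply: eq_bigr => i _; rewrite cE.
have /choice[c cE] : forall i, exists c : B, gelfand c = b i.
  by move=> i; exact: (gelfand_surj wB hat_inj (cb i)).
exists (\sum_(i < n) u i * val (c i)).
  by exists n, u, (fun i => val (c i)); split=> // i; exact: set_valP.
by rewrite (jmap_sum wB cB mB hE c Pu); apply: eq_bigr => i _; rewrite cE.
Qed.

Lemma jmap_iso : star_iso_Cc jmap.
Proof.
have sP := PINB_star_subalgebra sB cB; split.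
- split.
  + by move=> a Pa; rewrite -Cc_jmap; exists a.
  + move=> a b /set_mem Pa /set_mem Pb ab; apply/eqP; rewrite -subr_eq0; apply/eqP.
    apply: jmap_inj0; first exact: (sub_sub sP).
    move=> s; have -> : a - b = (-1) *: b + a by rewrite scaleN1r addrC.
    by rewrite (jmap_lincomb wB hE) ab mulN1r addNr.
  + by rewrite -Cc_jmap.
- by move=> k a b _ _; exact: (jmap_lincomb wB hE).
- by move=> a b Pa _; rewrite (conv_jmap wB cB mB hE).
- by move=> a; exact: (convstar_jmap wB cB mB hE).
Qed.

Variable mu : regular_probability R (spectrum B).
Hypotheses (mE : forall b : B, m b = cintegral mu (gelfand b)) (gB : generates (PIN B)).
Variables (K : hilbert R) (iota : (SigmaB B -> R[i]) -> K).
Hypothesis L2 : is_L2 mu iota.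

Let Cj a : PINB B a -> @Cc R A B (jmap a).
Proof. by move=> Pa; rewrite -Cc_jmap; exists a. Qed.

(** By [fiber_jmap] and the integral formula for [m], the space [K] with [iota \o jmap] is the GNS
    space of [state] on PIN(B)B, and by [conv_jmap] convolution is left multiplication there. *)
Lemma regular_iso : exists Phi : A -> K -> K,
  [/\ wstar_iso (twist_Wstar iota) Phi,
      (forall a, PINB B a -> is_Reg iota (jmap a) (Phi a))
    & Phi @` B = Reg_CX iota].
Proof.
have sP := PINB_star_subalgebra sB cB; have [il id ic] := L2.
pose L a := iota (jmap a).
have Ll (k : R[i]) p q : PINB B p -> PINB B q -> L (k *: p + q) = k *: L p + L q.
  by move=> Pp Pq; rewrite /L (jmap_lincomb wB hE) il //; exact: Cj.
have LE p q : PINB B p -> PINB B q -> dot K (L q) (L p) = state (p^@ * q).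
  move=> Pp Pq; rewrite /L id ?/L2dot; [|exact: Cj..].
  rewrite /state mE; congr cintegral; apply/funext => x.
  by rewrite (fiber_jmap wB cB mB hE) // -hatE.
have Ld (x : K) (e : R) : 0 < e -> exists2 p, PINB B p & nr (x - L p) < e.
  move=> e0; have : closure (iota @` @Cc R A B) x by rewrite ic.
  have eC : 0 < e%:C%C by rewrite ltr0c.
  move=> /(_ _ (nbhsx_ballx x (e%:C%C) eC))[_ [[f + <-]]].
  rewrite -Cc_jmap => -[p Pp <-]; rewrite -ball_normE /ball_ /= nrE ltcR => h.
  by exists p.
have dP := generates_dense gB sP (fun u => PINB_PIN sB (u := u)).
have pw := state_positive; have nw := normal_nfun pw state_normal.
pose Phi := Phi sP pw Ll LE Ld.
have reg a : PINB B a -> is_Reg iota (jmap a) (Phi a).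
  move=> Pa; split; first exact: Phi_bop.
  move=> xi; rewrite -Cc_jmap => -[b Pb <-].
  by rewrite (conv_jmap wB cB mB hE) //; exact: (Phi_mem sP pw Ll LE Ld Pa Pb).
(* [is_Reg] prescribes an operator on a dense subspace only; boundedness makes it unique, which
   identifies [twist_Wstar] and [Reg_CX] with images under [Phi]. *)
have reg_uniq a T : PINB B a -> is_Reg iota (jmap a) T -> T = Phi a.
  move=> Pa [bT hT]; have [bP hP] := reg a Pa.
  apply: (bop_eq_dense Ld bT bP) => p Pp.
  by rewrite /L hT ?hP //; exact: Cj.
exists Phi; split=> //.
- have -> : twist_Wstar iota = weak_closure (Phi @` (PINB B)).
    rewrite /twist_Wstar; congr weak_closure; apply/seteqP; split=> T.
      by move=> [f + hT]; rewrite -Cc_jmap => -[a Pa ef]; exists a => //; apply/esym/reg_uniq => //; rewrite ef.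
    by move=> [a Pa <-]; exists (jmap a); [exact: Cj|exact: reg].
  exact: (Phi_iso sP dP pw nw state_faithful Ll LE Ld).
- apply/seteqP; split=> T.
    move=> [b Bb <-]; have [c cE] := hat_exist Bb.
    exists (gelfand c); first exact: gelfand_continuous.
    by rewrite (tilde_jmap wB cB mB hE) cE; apply: reg; exact: (PINB_B sB).
  move=> [f cf]; have [b <-] := gelfand_surj wB hat_inj cf.
  rewrite (tilde_jmap wB cB mB hE) => hT; exists (val b); first exact: set_valP.
  by apply/esym/reg_uniq => //; apply: (PINB_B sB); exact: set_valP.
Qed.

End CartanState.

Theorem theorem2p22 (R : realType) (A : wstarAlgebra R) (B : set A)
    (m : B -> R[i]) (mu : regular_probability R (spectrum B)) :
  cartan B ->
  faithful_normal_state m ->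
  (forall b : B, m b = cintegral mu (gelfand b)) ->
  exists j : A -> SigmaB B -> R[i],
    [/\ star_iso_Cc j,
        (forall n (u : 'I_n -> A) (b : 'I_n -> B),
           (forall i, PIN B (u i)) ->
           j (\sum_(i < n) u i * val (b i)) =
             \sum_(i < n) Delta_mul (u i) (gelfand (b i)))
      & forall (K : hilbert R) (iota : (SigmaB B -> R[i]) -> K),
          is_L2 mu iota ->
          exists Phi : A -> K -> K,
            [/\ wstar_iso (twist_Wstar iota) Phi,
                (forall a, PINB B a -> is_Reg iota (j a) (Phi a))
              & Phi @` B = Reg_CX iota]].
Proof.
move=> [wB cB mB gB [E [hE fE nE]]] hm mE.
have hi := state_hat_inj wB hm mE.
exists (jmap E); split.
- exact: jmap_iso.
- by move=> n u b Pu; exact: jmap_sum.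
- by move=> K iota L2; exact: (regular_iso wB cB mB hE fE nE hm hi mE gB L2).
Qed.
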